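(* Let $\zeta$ be a primitive aperiodic (non-periodic) substitution on the alphabet $\mathcal{A}=\{0,\ldots,d-1\}$ with $d\ge 2$, whose substitution matrix $\mathsf{S}_\zeta$ is invertible and has characteristic polynomial irreducible over $\mathbb{Q}$. Let $\theta_1$ be the Perron–Frobenius eigenvalue of $\mathsf{S}_\zeta$. If $$\chi(\mathscr{M}_\zeta)<\frac{\log\theta_1}{2},$$ then the substitution $\mathbb{Z}$-action $(X_\zeta,T,\mu)$ has pure singular spectrum.
   Context: A substitution is a map $\zeta:\mathcal{A}\to\mathcal{A}^+$ (nonempty words), extended to words by concatenation. The substitution space $X_\zeta$ is the set of $x\in\mathcal{A}^{\mathbb{Z}}$ such that every finite subword of $x$ appears as a subword of $\zeta^n(a)$ for some $a\in\mathcal{A}$, $n\in\mathbb{N}$; $T$ is the left shift restricted to $X_\zeta$, and $\mu$ is its unique invariant probability measure (primitive substitutions give uniquely ergodic systems). The substitution matrix $\mathsf{S}_\zeta$ is the $d\times d$ matrix with $\mathsf{S}_\zeta(i,j)$ = number of occurrences of $i$ in $\zeta(j)$; $\zeta$ is primitive if some power of $\mathsf{S}_\zeta$ is strictly positive, and non-periodic (aperiodic) if $X_\zeta$ is infinite. ''Pure singular spectrum'' means the maximal spectral type of the Koopman operator $f\mapsto f\circ T$ on $L^2(X_\zeta,\mu)$ is singular with respect to Lebesgue measure. Spectral cocycle: write $\zeta(b)=u^b_1\cdots u^b_{|\zeta(b)|}$. For $\xi=(\xi_0,\ldots,\xi_{d-1})\in\mathbb{R}^d$ let $\mathscr{M}_\zeta(\xi)$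 be the $d\times d$ complex matrix with entries $$[\mathscr{M}_\zeta(\xi)]_{b,c}=\sum_{j\le|\zeta(b)|,\ u^b_j=c}\exp\Big(-2\pi i\sum_{k=1}^{j-1}\xi_{u^b_k}\Big),\quad (b,c)\in\mathcal{A}^2;$$ it is $\mathbb{Z}^d$-periodic, so defined on $\mathbb{T}^d=\mathbb{R}^d/\mathbb{Z}^d$. Let $E_\zeta:\mathbb{T}^d\to\mathbb{T}^d$, $E_\zeta\xi=\mathsf{S}_\zeta^t\xi \pmod{\mathbb{Z}^d}$, and $\mathscr{M}_\zeta(\xi,n)=\mathscr{M}_\zeta(E_\zeta^{n-1}\xi)\cdots\mathscr{M}_\zeta(\xi)$. When $\mathsf{S}_\zeta$ has no eigenvalues that are roots of unity (as here), $E_\zeta$ is ergodic for Haar measure $m_d$ and the top Lyapunov exponent $\chi(\mathscr{M}_\zeta)=\lim_{n\to\infty}\frac1n\log\|\mathscr{M}_\zeta(\xi,n)\|$ exists and is constant for $m_d$-a.e. $\xi$ (any matrix norm). *)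

(* Defs.v *)
From HB Require Import structures.
From mathcomp Require Import all_boot all_order all_algebra.
From mathcomp Require Import all_classical all_reals all_analysis.
From mathcomp Require Import complex.

Set Implicit Arguments.
Unset Strict Implicit.
Unset Printing Implicit Defensive.

Import Order.TTheory GRing.Theory Num.Theory.
Local Open Scope classical_set_scope.
Local Open Scope ring_scope.

(* 'I_m.+1 is inhabited (by 0); needed so that A^Z is a pointedType,
   which MathComp-Analysis requires of measurable spaces. *)
HB.instance Definition _ (m : nat) := isPointed.Build 'I_m.+1 ord0.

(* A substitution is a map zeta : A -> A^+ ; nonemptiness of the images
   is a separate hypothesis (see [subst_nonempty]). *)
Definition substitution (d : nat) := 'I_d -> seq 'I_d.

Definition subst_nonempty d (zeta : substitution d) : Prop :=
  forall a : 'I_d, zeta a != [::].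

Definition subst_word d (zeta : substitution d) (w : seq 'I_d) : seq 'I_d :=
  flatten (map zeta w).

Definition subst_iter d (zeta : substitution d) (n : nat) (a : 'I_d) :=
  iter n (subst_word zeta) [:: a].

Definition subst_language d (zeta : substitution d) (u : seq 'I_d) : Prop :=
  exists (a : 'I_d) (n : nat), infix u (subst_iter zeta n a).

Definition subword_at d (x : int -> 'I_d) (i : int) (n : nat) : seq 'I_d :=
  [seq x (i + k%:Z) | k <- iota 0 n].

Definition subst_space d (zeta : substitution d) : set (int -> 'I_d) :=
  [set x | forall (i : int) (n : nat), subst_language zeta (subword_at x i n)].

Definition subst_aperiodic d (zeta : substitution d) : Prop :=
  ~ finite_set (subst_space zeta).

Definition subst_mx d (zeta : substitution d) : 'M[int]_d :=
  \matrix_(i, j) (count_mem i (zeta j))%:Z.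

Definition subst_primitive d (zeta : substitution d) : Prop :=
  exists k : nat, forall i j : 'I_d, 0 < (subst_mx zeta ^+ k) i j.

Definition PF_eigenvalue (R : realType) d (S : 'M[int]_d) (theta : R) : Prop :=
  [/\ 0 < theta,
      root (char_poly (map_mx (fun z : int => z%:~R : R) S)) theta
    & forall lambda : R[i],
        root (char_poly (map_mx (fun z : int => z%:~R : R[i]) S)) lambda ->
        Normc.normc lambda <= theta].

Definition expm2pi (R : realType) (t : R) : R[i] :=
  (cos (2 * pi * t) -i* sin (2 * pi * t))%C.

Definition spectral_mx (R : realType) d (zeta : substitution d)
    (xi : 'rV[R]_d) : 'M[R[i]]_d :=
  \matrix_(b, c)
    \sum_(j < size (zeta b) | nth b (zeta b) j == c)
       expm2pi (\sum_(k < j) xi 0 (nth b (zeta b) k)).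

(* E_zeta xi = S^t xi  (on row vectors: xi *m S); taken on R^d, which is
   harmless since M_zeta is Z^d-periodic. *)
Definition endo_E (R : realType) d (zeta : substitution d) (xi : 'rV[R]_d)
  : 'rV[R]_d := xi *m map_mx (fun z : int => z%:~R : R) (subst_mx zeta).

Fixpoint spectral_cocycle (R : realType) d (zeta : substitution d)
    (xi : 'rV[R]_d) (n : nat) : 'M[R[i]]_d :=
  match n with
  | 0 => 1%:M
  | n'.+1 => spectral_mx zeta (iter n' (endo_E zeta) xi)
               *m spectral_cocycle zeta xi n'
  end.

Definition cmx_norm (R : realType) d (A : 'M[R[i]]_d) : R :=
  \sum_(i < d) \sum_(j < d) Normc.normc (A i j).

Definition elog (R : realType) (x : R) : \bar R :=
  if x == 0 then -oo%E else (ln x)%:E.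

Definition lyap_seq (R : realType) d (zeta : substitution d) (xi : 'rV[R]_d)
  (n : nat) : \bar R :=
  (elog (cmx_norm (spectral_cocycle zeta xi n.+1)) * (n.+1%:R^-1)%:E)%E.

Definition leb_null (R : realType) d (A : set 'rV[R]_d) : Prop :=
  forall eps : R, 0 < eps ->
    exists (a b : nat -> 'rV[R]_d),
      (forall n i, a n 0 i <= b n 0 i) /\
      A `<=` \bigcup_n [set x : 'rV[R]_d | forall i, a n 0 i <= x 0 i <= b n 0 i] /\
      (\sum_(0 <= n <oo) (\prod_(i < d) (b n 0 i - a n 0 i))%:E < eps%:E)%E.

Definition top_lyapunov (R : realType) d (zeta : substitution d)
    (chi : \bar R) : Prop :=
  leb_null [set xi : 'rV[R]_d | ~ (lyap_seq zeta xi @ \oo --> chi)].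

Definition cylinders m : set (set (int -> 'I_m.+1)) :=
  [set C | exists (i : int) (w : seq 'I_m.+1),
     C = [set x | subword_at x i (size w) = w]].

(* A^Z with the sigma-algebra generated by cylinders (= Borel sets of the
   product topology) *)
Notation shift_space m := (g_sigma_algebraType (@cylinders m)).

Definition shiftn m (k : int) (x : shift_space m) : shift_space m :=
  fun j => x (j + k).

(* mu is a T-invariant Borel probability on A^Z giving full mass to
   X_zeta; for primitive zeta there is exactly one such mu. *)
Definition invariant_on_subst_space (R : realType) m (zeta : substitution m.+1)
    (mu : probability (shift_space m) R) : Prop :=
  (forall A : set (shift_space m), measurable A ->
     mu (shiftn 1 @^-1` A) = mu A) /\
  mu.-negligible (~` (subst_space zeta : set (shift_space m))).

(* a complex-valued function f = fr + i fi in L^2(mu) *)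
Definition L2c (R : realType) m (mu : probability (shift_space m) R)
    (fr fi : shift_space m -> R) : Prop :=
  [/\ measurable_fun setT fr, measurable_fun setT fi,
      mu.-integrable setT (fun x => (fr x ^+ 2)%:E)
    & mu.-integrable setT (fun x => (fi x ^+ 2)%:E)].

(* sigma is the spectral measure of f = fr + i fi for the Koopman operator
   U g = g o T: a finite positive Borel measure on the circle [0,1) with
   int e^{2 pi i k t} dsigma(t) = <U^k f, f> = int f(T^k x) conj(f(x)) dmu
   for all k in Z (real and imaginary parts written separately). *)
Definition spectral_measure_of (R : realType) m
    (mu : probability (shift_space m) R) (fr fi : shift_space m -> R)
    (sigma : {measure set (measurableTypeR R) -> \bar R}) : Prop :=
  [/\ (sigma setT < +oo)%E,
      sigma (~` `[0, 1[%classic) = 0%E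
    & forall k : int,
        Rintegral sigma setT (fun t => cos (2 * pi * k%:~R * t))
          = Rintegral mu setT
              (fun x => fr (shiftn k x) * fr x + fi (shiftn k x) * fi x)
     /\ Rintegral sigma setT (fun t => sin (2 * pi * k%:~R * t))
          = Rintegral mu setT
              (fun x => fi (shiftn k x) * fr x - fr (shiftn k x) * fi x)].

(* pure singular spectrum: the maximal spectral type is singular w.r.t.
   Lebesgue measure, i.e. every spectral measure sigma_f, f in L^2(mu),
   is concentrated on a Lebesgue-null Borel set. *)
Definition pure_singular_spectrum (R : realType) m
    (mu : probability (shift_space m) R) : Prop :=
  forall (fr fi : shift_space m -> R), L2c mu fr fi ->
  forall sigma : {measure set (measurableTypeR R) -> \bar R},
    spectral_measure_of mu fr fi sigma ->
    exists N : set R, [/\ measurable N, (@lebesgue_measure R N = 0)%E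
                        & sigma (~` N) = 0%E].

(* Main.v *)
Require Import Defs.
From HB Require Import structures.
From mathcomp Require Import all_boot all_order all_algebra.
From mathcomp Require Import all_classical all_reals all_analysis measurable_realfun.
From mathcomp Require Import complex.
From mathcomp Require Import ring lra zify.

(** For a function [f] of finitely many coordinates, the twisted Birkhoff sums
    [S_N f(w, x) = sum_(j < N) e(- j w) f(T^j x)] over the blocks [zeta^n(b)] are
    given, up to bounded errors, by the spectral cocycle at the diagonal point
    [w (1, ..., 1)].  The Lyapunov exponent only controls the cocycle at almost every
    point of the torus, but it can be used on the diagonal as follows.  For a suitable
    [m], the points where [|M(xi, m)| >= exp(c m)] lie in a small proportion of the cells
    of a grid.  By irreducibility an integer vector [k <> 0] satisfies [k . E^j(1, ..., 1) <> 0]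
    for all large [j], so the mean over [w] of a Fejer kernel at [E^j(w, ..., w)] is its
    mean over the torus, and Markov's inequality shows that for most [w] only a small
    proportion of the blocks of [m] iterates meet a bad cell.  Hence, off a set of [w] of small
    measure, [|S_N f| = o(sqrt N)] uniformly in [x], when [N] is the least length of the
    words [zeta^n(b)].  By Parseval and Chebyshev's inequality, [|S_N f|_2^2 = o(N)] off a
    small set of [w] extends to every [f] in L2.  As [|S_N f|_2^2] is the integral of a
    Fejer kernel against the spectral measure, the latter gives little mass to the
    complement of a set of small Lebesgue measure; Borel-Cantelli concludes. *)

Set Implicit Arguments.
Unset Strict Implicit.
Unset Printing Implicit Defensive.
Import Order.TTheory GRing.Theory Num.Theory.
Import numFieldNormedType.Exports.
Local Open Scope classical_set_scope.
Local Open Scope ring_scope.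

(** * Matrices with irreducible characteristic polynomial *)

(** The threshold [log theta1 / 2] is a square-root barrier: the words of level [k] have length at
    least of order [theta1^k], so a cocycle of size [rho^k] with [rho^2 < theta1] leaves room for
    losses polynomial in [k]. The diagonal is a null set of the torus, so almost-everywhere
    information has to be turned into a robust condition first. Over a fixed number [m] of iterates
    the cocycle is Lipschitz, and its bad set can be enlarged to finitely many cells, which
    trigonometric polynomials detect. Fixing [m] also keeps the frequencies finite in number, so
    that one threshold in [j] serves them all, and a crude bound on the bad blocks costs only a
    factor [L^(kap k)] with [kap] as small as wanted. No convergence for almost every [w] is sought:
    the exceptional set may change with the level. This is what makes the passage to L2 limits
    possible, and it suffices because a single level per [eps] already bounds the spectral
    measure. *)

Lemma krylov_span (F : fieldType) n (S : 'M[F]_n.+1) (k v : 'cV[F]_n.+1) :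
  irreducible_poly (char_poly S) -> k != 0 ->
  exists p : {poly F}, horner_mx S p *m k = v.
Proof.
move=> irrS k0.
pose K : 'M[F]_n.+1 := \matrix_(i < n.+1) (S ^+ i *m k)^T.
have KE (r : 'rV_n.+1) : r *m K = (horner_mx S (rVpoly r) *m k)^T.
  rewrite mulmx_sum_row /rVpoly poly_def rmorph_sum mulmx_suml linear_sum.
  apply: eq_bigr => i _; rewrite insubT => // ilt /=.
  rewrite linearZ rmorphXn /= horner_mx_X rowK -scalemxAl linearZ /=.
  by congr (r 0 _ *: _); apply: val_inj.
have Kunit : K \in unitmx.
  rewrite -row_free_unit -kermx_eq0; apply/eqP/row_matrixP => i; rewrite row0.
  set r := row i _; have rK : r *m K = 0 by rewrite -row_mul mulmx_ker row0.
  apply: contraNeq k0 => r0.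
  have q0 : rVpoly r != 0.
    by apply: contraNneq r0 => q0; rewrite -[r]rVpolyK q0 linear0.
  (* A vanishing combination of the [S^i k] reads [q(S) k = 0] with [q] nonzero of degree below that
     of the characteristic polynomial. By Bezout and Cayley-Hamilton [q(S)] is invertible, which
     forces [k = 0]. *)
  have : coprimep (char_poly S) (rVpoly r).
    rewrite irreducible_poly_coprime //; apply/negP => /dvdp_leq.
    by move=> /(_ q0); rewrite size_char_poly leqNgt ltnS size_poly.
  case/Bezout_coprimepP => -[a b] /= /eqpP [[c1 c2] /= /andP[_ c20]] ab.
  have := congr1 (fun p => horner_mx S p *m k) ab.
  rewrite /= !linearZ /= rmorphD !rmorphM /= Cayley_Hamilton mulr0 add0r rmorph1.
  have bk : horner_mx S b * horner_mx S (rVpoly r) *m k = 0.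
    rewrite -[_ * _]/(_ *m _) -mulmxA.
    by rewrite -[horner_mx S (rVpoly r) *m k]trmxK -KE rK trmx0 mulmx0.
  rewrite -!scalemxAl bk scaler0 mul1mx => /esym/eqP.
  by rewrite scaler_eq0 (negPf c20).
exists (rVpoly (v^T *m invmx K)).
by apply: trmx_inj; rewrite -KE mulmxKV.
Qed.

(** Birkhoff contraction by hand. With [U] and [V] the coordinate sums, entries at least [1] give
    [P (v - m u) >= V - m U] and [P (M u - v) >= M U - V]. These gains add up to [(M - m) U], so the
    larger one is at least [(M - m) (P u) / (2 H)], and it serves to raise [m] or to lower [M]. *)
Lemma contraction_step (F : realFieldType) n (P : 'M[F]_n) (H : F)
    (u v : 'cV[F]_n) (m M : F) :
  0 < H -> (forall i j, 1 <= P i j <= H) -> (forall i, 0 <= u i 0) ->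
  (forall i, m * u i 0 <= v i 0 <= M * u i 0) ->
  exists m' M', M' - m' = (1 - (2 * H)^-1) * (M - m) /\
    forall i, m' * (P *m u) i 0 <= (P *m v) i 0 <= M' * (P *m u) i 0.
Proof.
move=> H0 PH u0 muv.
pose U := \sum_i u i 0; pose V := \sum_i v i 0.
have lo i (z : 'cV[F]_n) : (forall j, 0 <= z j 0) ->
    \sum_j z j 0 <= (P *m z) i 0 <= H * \sum_j z j 0.
  move=> z0; rewrite mxE mulr_sumr.
  apply/andP; split; apply: ler_sum => j _.
    by rewrite ler_peMl // (andP (PH i j)).1.
  by rewrite ler_wpM2r // (andP (PH i j)).2.
have mul_lin (a b : F) i (x y : 'cV[F]_n) :
    (P *m (a *: x + b *: y)) i 0 = a * (P *m x) i 0 + b * (P *m y) i 0.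
  by rewrite mulmxDr -!scalemxAr !mxE.
have sum_lin (a b : F) (x y : 'cV[F]_n) :
    \sum_j (a *: x + b *: y) j 0 = a * \sum_j x j 0 + b * \sum_j y j 0.
  rewrite !mulr_sumr -big_split /=; apply: eq_bigr => j _; by rewrite !mxE.
have xlo i : V - m * U <= (P *m v) i 0 - m * (P *m u) i 0.
  have /(lo i) : forall j, 0 <= (1 *: v + (- m) *: u) j 0.
    by move=> j; rewrite !mxE; have := muv j; lra.
  by rewrite sum_lin mul_lin => /andP[]; rewrite /U /V; lra.
have ylo i : M * U - V <= M * (P *m u) i 0 - (P *m v) i 0.
  have /(lo i) : forall j, 0 <= (M *: u + (- 1) *: v) j 0.
    by move=> j; rewrite !mxE; have := muv j; lra.
  by rewrite sum_lin mul_lin => /andP[]; rewrite /U /V; lra.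
have ulo i : (P *m u) i 0 <= H * U by have /andP[] := lo i u u0.
have uge i : 0 <= (P *m u) i 0.
  by have /andP[+ _] := lo i u u0; apply: le_trans; apply: sumr_ge0.
have x0 : 0 <= V - m * U.
  by rewrite subr_ge0 mulr_sumr; apply: ler_sum => j _; have /andP[] := muv j.
have y0 : 0 <= M * U - V.
  by rewrite subr_ge0 mulr_sumr; apply: ler_sum => j _; have /andP[] := muv j.
have K0 : 0 < (2 * H)^-1 by rewrite invr_gt0 mulr_gt0.
have key i : (V - m * U) + (M * U - V) >= 2 * ((M - m) * (2 * H)^-1 * (P *m u) i 0) \/ (M - m) < 0.
  case: (ltP (M - m) 0) => [|Mm]; [by right | left].
  have -> : V - m * U + (M * U - V) = (M - m) * U by ring.
  have := ler_wpM2l (mulr_ge0 Mm (ltW K0)) (ulo i).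
  have -> : (M - m) / (2 * H) * (H * U) = (M - m) * U / 2.
    by field; rewrite gt_eqF.
  lra.
(* The case [M < m] forces [u = 0]; treating it avoids carrying [m <= M] through the iteration. *)
have [Mm|Mm] := ltP (M - m) 0.
  exists (m + (M - m) * (2 * H)^-1), M; split; first by ring.
  move=> i; rewrite mulrDl.
  have := mulr_ge0 (ltW K0) (uge i).
  have := xlo i; have := ylo i.
  have : (M - m) * ((2 * H)^-1 * (P *m u) i 0) <= 0.
    by rewrite mulr_le0_ge0 ?mulr_ge0 // ltW.
  rewrite mulrA; lra.
have [xy|xy] := leP (V - m * U) (M * U - V).
  exists m, (M - (M - m) * (2 * H)^-1); split; first by ring.
  move=> i; rewrite mulrBl; have [|] := key i; last by lra.
  have := xlo i; have := ylo i; lra.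
exists (m + (M - m) * (2 * H)^-1), M; split; first by ring.
move=> i; rewrite mulrDl; have [|] := key i; last by lra.
have := xlo i; have := ylo i; lra.
Qed.

Lemma contraction_iter (F : realFieldType) n (P : 'M[F]_n.+1) (H : F)
    (v : 'cV[F]_n.+1) :
  0 < H -> (forall i j, 1 <= P i j <= H) ->
  exists C : F, forall t, exists m M, M - m = (1 - (2 * H)^-1) ^+ t * C /\
    forall i, m * (P ^+ t *m const_mx 1 : 'cV_n.+1) i 0 <= (P ^+ t *m v) i 0
              <= M * (P ^+ t *m const_mx 1 : 'cV_n.+1) i 0.
Proof.
move=> H0 PH; pose C0 := \sum_i `|v i 0|; exists (2 * C0).
elim=> [|t [m [M [MmE IH]]]].
  exists (- C0), C0; split; first by rewrite expr0; ring.
  move=> i; rewrite expr0 !mul1mx mxE !mulr1 -ler_norml.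
  by rewrite /C0 (bigD1 i) //= lerDl sumr_ge0.
have u0 i : 0 <= (P ^+ t *m const_mx 1 : 'cV_n.+1) i 0.
  suff Pt j : forall k, 0 <= (P ^+ t) j k.
    by rewrite mxE sumr_ge0 // => j _; rewrite !mxE mulr1.
  elim: t {m M MmE IH} j => [|t IHt] j k; first by rewrite expr0 !mxE; case: eqP.
  rewrite exprS !mxE sumr_ge0 // => l _; rewrite mulr_ge0 //.
  by rewrite (le_trans ler01) // (andP (PH _ _)).1.
have [m' [M' [E B]]] := contraction_step H0 PH u0 IH.
exists m', M'; split; first by rewrite E MmE exprS mulrA.
by move=> i; have := B i; rewrite !mulmxA exprS.
Qed.

(** The majorant is again a polynomial in [S], so it commutes with the powers of [S], which the
    matrix of absolute values of [p(S)] need not do. *)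
Lemma horner_mx_norm_le (F : realFieldType) n (S : 'M[F]_n.+1) (p : {poly F}) :
  (forall i j, 0 <= S i j) ->
  exists q : {poly F}, forall i j, `|horner_mx S p i j| <= horner_mx S q i j.
Proof.
move=> S0; exists (\poly_(l < size p) `|p`_l|) => i j.
have SX l : forall i j, 0 <= (S ^+ l) i j.
  elim: l => [|l IHl] a b; first by rewrite expr0 !mxE; case: eqP.
  by rewrite exprS !mxE sumr_ge0 // => c _; rewrite mulr_ge0.
rewrite -{1}[p]coefK !poly_def !rmorph_sum !summxE.
apply: (le_trans (ler_norm_sum _ _ _)); apply: ler_sum => l _.
by rewrite /= !linearZ /= !rmorphXn /= !horner_mx_X !mxE normrM (ger0_norm (SX _ _ _)).
Qed.

(* Unless some [S^j k] has constant sign, [S^j k] is [o(S^j 1)] by contraction;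
   but [1] is a polynomial in [S] applied to [k]. *)
Lemma cyclic_iter_neq0 (F : archiRealFieldType) n (S : 'M[F]_n.+1) (p : nat)
    (H : F) (k : 'cV[F]_n.+1) :
  irreducible_poly (char_poly S) -> (forall i j, 0 <= S i j) ->
  (forall i j, 1 <= (S ^+ p) i j <= H) ->
  (forall j c, 0 < (const_mx 1 *m S ^+ j : 'rV_n.+1) 0 c) -> k != 0 ->
  exists j0, forall j, (j0 <= j)%N ->
    (const_mx 1 *m S ^+ j *m k : 'M[F]_1) 0 0 != 0.
Proof.
move=> irrS S0 PH col k0.
have H0 : 0 < H.
  by have /andP[a b] := PH 0 0; rewrite (lt_le_trans _ (le_trans a b)).
set P := S ^+ p in PH.
suff [t [s [s0 st]]] : exists t s, s != 0 /\ forall i, 0 < s * (P ^+ t *m k) i (0 : 'I_1).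
  (* A strict sign reached at time [p t] persists in the pairing, because the row
     [(1, ..., 1) S^(j - p t)] is positive. *)
  exists (p * t)%N => j ptj.
  suff : 0 < s * (const_mx 1 *m S ^+ j *m k : 'M[F]_1) 0 0.
    by apply: contraTneq => ->; rewrite mulr0 ltxx.
  rewrite -(subnK ptj) exprD exprM -/P -[_ * P ^+ t]/(_ *m _) mulmxA -mulmxA.
  rewrite mxE mulr_sumr; apply: (@lt_le_trans _ _
    ((const_mx 1 *m S ^+ (j - p * t)%N : 'rV_n.+1) 0 0 * (s * (P ^+ t *m k) 0 0))).
    by rewrite mulr_gt0.
  rewrite (bigD1 0) //= mulrCA lerDl sumr_ge0 // => i _.
  by rewrite mulrCA mulr_ge0 // ltW.
have [q qk] := krylov_span (const_mx 1) irrS k0.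
have [Q qQ] := horner_mx_norm_le q S0.
have [C0 HC] := contraction_iter k H0 PH.
pose D := \sum_i \sum_j horner_mx S Q i j.
have Q0 i j : 0 <= horner_mx S Q i j by apply: le_trans (qQ i j).
have comm r t : P ^+ t *m horner_mx S r = horner_mx S r *m P ^+ t.
  have E l : S ^+ l = horner_mx S 'X^l by rewrite rmorphXn /= horner_mx_X.
  by rewrite /P -exprM E !mulmxE -!rmorphM mulrC.
have PX t : forall i j, 0 <= (P ^+ t) i j.
  elim: t => [|t IHt] a b; first by rewrite expr0 !mxE; case: eqP.
  rewrite exprS !mxE sumr_ge0 // => c _; rewrite mulr_ge0 //.
  by rewrite (le_trans ler01) // (andP (PH _ _)).1.
pose u t : 'cV_n.+1 := P ^+ t *m const_mx 1.
have u0 t i : 0 < u t i 0.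
  elim: t i => [|t IHt] i; first by rewrite /u expr0 mul1mx mxE.
  rewrite /u exprS -[_ * _]/(_ *m _) -mulmxA mxE.
  apply: (lt_le_trans (IHt 0)); rewrite (bigD1 0) //= -[leLHS]addr0.
  apply: lerD; first by rewrite ler_peMl ?(andP (PH _ _)).1 // ltW.
  apply: sumr_ge0 => j _; rewrite mulr_ge0 //; last exact: ltW (IHt j).
  by rewrite (le_trans ler01) // (andP (PH _ _)).1.
have [//|no] := pselect (exists t s, s != 0 /\
  forall i, 0 < s * (P ^+ t *m k) i 0).
exfalso.
have uC t (i : 'I_n.+1) : 1 <= (1 - (2 * H)^-1) ^+ t * (C0 * D).
  (* Since no iterate of [k] has a strict constant sign, [m <= 0 <= M] and
     [|P^t k| <= (M - m) P^t 1]. Applying [q(S)], with [q(S) k = 1], gives [P^t 1 <= (M - m) Q(S)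
     P^t 1 <= (M - m) D P^t 1]. *)
  have [m [M [MmE B]]] := HC t.
  have m0 : m <= 0.
    rewrite leNgt; apply/negP => m0; apply: no; exists t, 1; split; first exact: oner_neq0.
    move=> j; rewrite mul1r; have /andP[+ _] := B j; apply: lt_le_trans.
    by rewrite mulr_gt0 // u0.
  have M0 : 0 <= M.
    rewrite leNgt; apply/negP => M0; apply: no; exists t, (-1).
    split; first by rewrite oppr_eq0 oner_neq0.
    move=> j; rewrite mulN1r oppr_gt0; have /andP[_] := B j => /le_lt_trans; apply.
    by rewrite nmulr_rlt0 // u0.
  have absB j : `|(P ^+ t *m k) j 0| <= (M - m) * u t j 0.
    rewrite ler_norml; have := B j; rewrite -/(u t).
    have := mulr_ge0 M0 (ltW (u0 t j)).
    have : m * u t j 0 <= 0 by rewrite mulr_le0_ge0 // ltW.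
    lra.
  have Mm0 : 0 <= M - m by lra.
  have : u t i 0 <= (M - m) * D * u t i 0.
    have E : u t i 0 = (horner_mx S q *m (P ^+ t *m k)) i 0.
      by rewrite mulmxA -comm -mulmxA qk.
    rewrite {1}E.
    apply: (@le_trans _ _ ((horner_mx S Q *m ((M - m) *: u t)) i 0)).
      rewrite (le_trans (ler_norm _)) // !mxE (le_trans (ler_norm_sum _ _ _)) //.
      apply: ler_sum => j _; rewrite normrM ler_pM //.
      by rewrite [leRHS]mxE absB.
    rewrite -scalemxAr mxE -mulrA ler_wpM2l //.
    rewrite /u mulmxA -comm -mulmxA mxE [X in _ <= _ * X]mxE mulr_sumr.
    apply: ler_sum => j _. rewrite [X in _ <= D * (_ * X)]mxE. rewrite mulr1 mulrC mxE.
    apply: ler_wpM2r; first exact: PX.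
    rewrite [D](bigD1 j) //=; apply: (@le_trans _ _ (\sum_l horner_mx S Q j l)).
      by apply: ler_sum => l _; rewrite mxE mulr1.
    by rewrite lerDl; apply: sumr_ge0 => l _; apply: sumr_ge0.
  by rewrite MmE -[leLHS]mul1r ler_pM2r // mulrA.
have H1 : 1 <= H by have /andP[a b] := PH 0 0; apply: le_trans a b.
have r0 : 0 <= 1 - (2 * H)^-1.
  by rewrite subr_ge0 invf_le1 ?mulr_gt0 //; lra.
have r1 : 1 - (2 * H)^-1 < 1 by rewrite gtrBl invr_gt0 mulr_gt0.
pose E := C0 * D.
have E0 : 0 < E by have := uC 0 0; rewrite expr0 mul1r; apply: lt_le_trans.
have : (1 - (2 * H)^-1) ^+ t @[t --> \oo] --> (0 : F).
  by apply: cvg_expr; rewrite ger0_norm.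
move=> /cvgrPdist_lt /(_ E^-1); rewrite invr_gt0 => /(_ E0) [t _ /(_ t (leqnn t))] /=.
rewrite sub0r normrN ger0_norm ?exprn_ge0 // => lt.
have := uC t 0; rewrite leNgt => /negP; apply.
by rewrite -/E -ltr_pdivlMr // div1r.
Qed.

(** * Lengths of iterated words *)

Definition iterlen d (zeta : substitution d) j c := size (subst_iter zeta j c).

(** The number of terms of the Birkhoff sums at level [j]: a factor of this length in a
    concatenation of level-[j] words meets at most two consecutive ones. *)
Definition minlen d (zeta : substitution d.+1) j :=
  iterlen zeta j [arg min_(c < ord0) iterlen zeta j c].

Section Words.
Variables (d : nat) (zeta : substitution d).
Implicit Types (u v w : seq 'I_d) (b c : 'I_d) (j n : nat).

Lemma subst_word_cat u v :
  subst_word zeta (u ++ v) = subst_word zeta u ++ subst_word zeta v.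
Proof. by rewrite /subst_word map_cat flatten_cat. Qed.

Lemma iter_subst_word_cat j u v : iter j (subst_word zeta) (u ++ v) =
  iter j (subst_word zeta) u ++ iter j (subst_word zeta) v.
Proof. by elim: j => //= j ->; rewrite subst_word_cat. Qed.

Lemma iter_subst_word_nil j : iter j (subst_word zeta) [::] = [::].
Proof. by elim: j => //= j ->. Qed.

Lemma subst_iterD j n c : subst_iter zeta (j + n) c =
  iter j (subst_word zeta) (subst_iter zeta n c).
Proof. by rewrite /subst_iter iterD. Qed.

Lemma subst_iter1 c : subst_iter zeta 1 c = zeta c.
Proof. by rewrite /subst_iter /= /subst_word /= cats0. Qed.

Lemma size_iter_subst_word j w : size (iter j (subst_word zeta) w) =
  (\sum_(b <- w) iterlen zeta j b)%N.
Proof.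
elim: w => [|b w IH]; first by rewrite iter_subst_word_nil big_nil.
by rewrite -cat1s iter_subst_word_cat size_cat IH big_cons.
Qed.

Lemma sum_seq_count (A : nmodType) (F : 'I_d -> A) w :
  \sum_(b <- w) F b = \sum_b F b *+ count_mem b w.
Proof.
elim: w => [|a w IH]; first by rewrite big_nil big1.
rewrite big_cons IH; under [RHS]eq_bigr do rewrite /= mulrnDr.
rewrite big_split /=; congr (_ + _).
rewrite (bigD1 a) //= eqxx mulr1n big1 ?addr0 // => b ba.
by rewrite eq_sym (negPf ba).
Qed.

Lemma subst_mxX j (a c : 'I_d) :
  (subst_mx zeta ^+ j) a c = (count_mem a (subst_iter zeta j c))%:Z.
Proof.
elim: j a c => [|j IH] a c; first by rewrite expr0 mxE /= addn0 eq_sym; case: eqP.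
rewrite exprS mxE /subst_iter /= -/(subst_iter zeta j c) /subst_word.
rewrite count_flatten -map_comp sumnE big_map.
rewrite -[RHS]natz natr_sum [RHS]sum_seq_count.
by apply: eq_bigr => b _; rewrite IH mxE natz -mulr_natr natz.
Qed.

Lemma iterlen_mx j c :
  (const_mx 1 *m subst_mx zeta ^+ j : 'rV[int]_d) 0 c = (iterlen zeta j c)%:Z.
Proof.
rewrite mxE -[RHS]natz /iterlen -sum1_size natr_sum [RHS]sum_seq_count.
by apply: eq_bigr => b _; rewrite mxE mul1r subst_mxX -[LHS]natz.
Qed.

Lemma iterlenS j c :
  iterlen zeta j.+1 c = (\sum_(b <- zeta c) iterlen zeta j b)%N.
Proof. by rewrite -size_iter_subst_word -subst_iter1 -subst_iterD addn1. Qed.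

(** Up to [2 pi], the coordinate [c] is the phase accumulated at frequency [w] while reading
    [zeta^j(c)]. This is why diagonal points govern twisted sums. *)
Lemma iter_endo_E (R : realType) (w : R) j :
  iter j (endo_E zeta) (const_mx w) = \row_c (w * (iterlen zeta j c)%:R).
Proof.
have -> : iter j (endo_E zeta) (const_mx w) =
    w *: map_mx (fun z : int => z%:~R : R) (const_mx 1 *m subst_mx zeta ^+ j).
  elim: j => [|j /= ->].
    by rewrite mulmx1; apply/rowP => c; rewrite !mxE mulr1.
  rewrite /endo_E -scalemxAl exprSr [in RHS]mulmxA; congr (w *: _).
  apply/rowP => c; rewrite !mxE rmorph_sum; apply: eq_bigr => i _.
  by rewrite rmorphM /= !mxE.
by apply/rowP => c; rewrite mxE [in LHS]mxE iterlen_mx mxE.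
Qed.

Hypothesis zeta_ne : subst_nonempty zeta.

Lemma iterlen_gt0 j c : (0 < iterlen zeta j c)%N.
Proof.
elim: j c => [|j IH] c //; rewrite iterlenS.
move: (zeta_ne c); case: (zeta c) => // b s _.
by rewrite big_cons addn_gt0 IH.
Qed.

End Words.

Section Lengths.
Variables (n : nat) (zeta : substitution n.+2).
Hypothesis zeta_ne : subst_nonempty zeta.
Hypothesis zeta_prim : subst_primitive zeta.

Lemma minlen_le j c : (minlen zeta j <= iterlen zeta j c)%N.
Proof. by rewrite /minlen; case: arg_minnP => // i _; apply. Qed.

Lemma minlen_attained j : exists c, minlen zeta j = iterlen zeta j c.
Proof. by rewrite /minlen; eexists. Qed.

Lemma minlen_gt0 j : (0 < minlen zeta j)%N.
Proof. exact: iterlen_gt0. Qed.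

Lemma primitive_letters : exists2 p, (0 < p)%N &
  forall b c, b \in subst_iter zeta p c.
Proof.
have [p Hp] := zeta_prim.
have letters b c : b \in subst_iter zeta p c.
  by have := Hp b c; rewrite subst_mxX -has_pred1 has_count.
(* [p = 0] is excluded by the two distinct letters [ord0] and [ord_max]. *)
exists p => //; case: p Hp letters => // Hp.
by move=> /(_ ord0 ord_max); rewrite inE.
Qed.

Lemma iterlenD i j c :
  iterlen zeta (i + j) c = (\sum_(b <- subst_iter zeta j c) iterlen zeta i b)%N.
Proof. by rewrite -size_iter_subst_word -subst_iterD. Qed.

Lemma iterlen_ge_mem i j b c : b \in subst_iter zeta j c ->
  (iterlen zeta i b <= iterlen zeta (i + j) c)%N.
Proof. by move=> bj; rewrite iterlenD (big_rem b) //= leq_addr. Qed.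

Lemma minlen_gt1 p : (forall b c, b \in subst_iter zeta p c) ->
  forall c, (1 < iterlen zeta p c)%N.
Proof.
move=> Hp c; rewrite /iterlen.
have := Hp ord0 c; have := Hp ord_max c.
case: (subst_iter zeta p c) => [|a [|]] //.
by rewrite !inE => /eqP <-.
Qed.

Lemma minlenD i j : (minlen zeta i * minlen zeta j <= minlen zeta (i + j))%N.
Proof.
have [c ->] := minlen_attained (i + j); rewrite iterlenD.
apply: (@leq_trans (minlen zeta i * iterlen zeta j c)).
  by rewrite leq_mul2l minlen_le orbT.
rewrite /iterlen -sum1_size big_distrr /= leq_sum // => b _.
by rewrite muln1 minlen_le.
Qed.

Lemma minlen_growth_gt1 (R : realType) :
  exists G C : R, [/\ 1 < G, 0 < C & forall j, C * G ^+ j <= (minlen zeta j)%:R].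
Proof.
have [p p0 Hp] := primitive_letters.
have p2 t : (2 ^ t <= minlen zeta (p * t))%N.
  elim: t => [|t IH]; first by rewrite muln0 minlen_gt0.
  rewrite mulnS; apply: leq_trans (minlenD _ _).
  rewrite expnS leq_mul //; have [c ->] := minlen_attained p.
  exact: minlen_gt1.
(* Lengths at least double every [p] steps; the constant [2^-1 = G^-p] pays for the remainder of [j]
   modulo [p]. *)
pose G : R := 2 `^ (p%:R^-1).
have G0 : 0 < G by rewrite powR_gt0.
have Gp : G ^+ p = 2.
  by rewrite /G -powR_mulrn ?powR_ge0 // -powRrM mulVf ?powRr1 // pnatr_eq0 -lt0n.
have G1 : 1 < G.
  rewrite -(ltr_pXn2r p0) ?nnegrE ?ler01 ?(ltW G0) // expr1n Gp; lra.
exists G, 2^-1; split => // j.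
apply: (@le_trans _ _ (2 ^+ (j %/ p))).
  rewrite -[X in X ^+ (_ %/ _)]Gp -exprM ler_pdivrMl // -[X in X * _]Gp -exprD.
  by rewrite ler_eXn2l // {1}(divn_eq j p) addnC leq_add // 1?mulnC // ltnW ?ltn_pmod.
rewrite -natrX ler_nat (leq_trans (p2 _)) //.
rewrite {2}(divn_eq j p) mulnC addnC.
by apply: leq_trans (minlenD _ _); rewrite leq_pmull ?minlen_gt0.
Qed.

(** At a coordinate [c] of largest modulus of a left eigenvector [v], the equation
    [theta^j v_c = (v S^j)_c] gives [theta^j <= |zeta^j(c)|]. Every [zeta^p(b)] contains [c], so
    each level-[j] word is at least as long as [zeta^(j-p)(c)], at the price of [theta^-p]. *)
Lemma minlen_growth_eigen (R : realType) (theta : R) : 1 < theta ->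
  root (char_poly (map_mx (fun z : int => z%:~R : R) (subst_mx zeta))) theta ->
  exists2 C : R, 0 < C & forall j, C * theta ^+ j <= (minlen zeta j)%:R.
Proof.
move=> th1; have th0 : 0 < theta by apply: lt_trans th1.
rewrite -eigenvalue_root_char => /eigenvalueP [v vS v0].
set S := map_mx _ _ in vS.
have vSj j : v *m S ^+ j = theta ^+ j *: v.
  elim: j => [|j IH]; first by rewrite mulmx1 scale1r.
  by rewrite exprSr mulmxA IH -scalemxAl vS scalerA -exprSr.
have SjE j a c : (S ^+ j) a c = (count_mem a (subst_iter zeta j c))%:R.
  rewrite -[RHS]/((count_mem a (subst_iter zeta j c))%:Z%:~R) -subst_mxX.
  have -> : S ^+ j = map_mx (fun z : int => z%:~R : R) (subst_mx zeta ^+ j).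
    elim: j => [|j IH]; first by apply/matrixP => x y; rewrite !mxE; case: eqP.
    rewrite !exprS IH; apply/matrixP => x y; rewrite !mxE rmorph_sum.
    by apply: eq_bigr => z _; rewrite rmorphM /= !mxE.
  by rewrite mxE.
have [c _ cmax] : exists2 c, true & forall b, `|v 0 b| <= `|v 0 c|.
  by case: (@arg_maxP _ _ _ ord0 xpredT (fun b => `|v 0 b|)) => // c _ H; exists c => // b; apply: H.
have vc : 0 < `|v 0 c|.
  rewrite lt_def normr_ge0 andbT; apply: contraNneq v0 => vc0.
  by apply/eqP/rowP => b; rewrite mxE; apply/eqP; rewrite -normr_le0 -vc0.
have up j : theta ^+ j <= (iterlen zeta j c)%:R.
  rewrite -(ler_pM2r vc) -[X in X * _ <= _](ger0_norm (exprn_ge0 _ (ltW th0))).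
  have -> : `|theta ^+ j| * `|v 0 c| = `|(v *m S ^+ j) 0 c|.
    by rewrite vSj mxE normrM.
  rewrite mxE (le_trans (ler_norm_sum _ _ _)) //.
  rewrite /iterlen -sum1_size natr_sum [in leRHS]sum_seq_count mulr_suml.
  apply: ler_sum => b _; rewrite SjE normrM normr_nat [leLHS]mulrC.
  by rewrite -[1%:R *+ _]/(_%:R) ler_wpM2l.
have [p p0 Hp] := primitive_letters.
exists (theta ^- p); first by rewrite invr_gt0 exprn_gt0.
move=> j; rewrite ler_pdivrMl ?exprn_gt0 //.
have [pj|/ltnW jp] := leqP p j; last first.
  apply: (@le_trans _ _ (theta ^+ p)); first by rewrite ler_eXn2l.
  by rewrite ler_peMr ?exprn_ge0 ?(ltW th0) // ler1n minlen_gt0.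
rewrite -{1}(subnKC pj) exprD ler_wpM2l ?exprn_ge0 ?(ltW th0) //.
apply: (le_trans (up _)); rewrite ler_nat.
have [b ->] := minlen_attained j.
by rewrite -{2}(subnK pj); apply: iterlen_ge_mem.
Qed.

(** Allowing [G] above [theta] covers [theta <= 1] by the doubling argument; a number below
    [ln theta / 2] is also below [ln G / 2]. *)
Lemma minlen_growth (R : realType) (theta : R) :
  PF_eigenvalue (subst_mx zeta) theta ->
  exists G C : R, [/\ 1 < G, theta <= G, 0 < C &
    forall j, C * G ^+ j <= (minlen zeta j)%:R].
Proof.
case=> th0 rt _; have [th1|th1] := ltP 1 theta.
  by have [C C0 HC] := minlen_growth_eigen th1 rt; exists theta, C.
have [G [C [G1 C0 HC]]] := minlen_growth_gt1 R.
by exists G, C; split=> //; apply: le_trans th1 (ltW G1).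
Qed.

(** The sum is the frequency in [w] of the character [k] along the curve of the points
    [E^j(w, ..., w)]; once it is nonzero, the character has mean zero on that curve. *)
Lemma lengths_independent (k : 'I_n.+2 -> int) :
  irreducible_poly (char_poly (map_mx (fun z : int => z%:~R : rat) (subst_mx zeta))) ->
  (exists c, k c != 0) ->
  exists j0, forall j, (j0 <= j)%N ->
    \sum_c (iterlen zeta j c)%:Z * k c != 0.
Proof.
move=> irr [c kc]; set S := map_mx _ _ in irr.
have SX j : S ^+ j = map_mx (fun z : int => z%:~R : rat) (subst_mx zeta ^+ j).
  elim: j => [|j IH]; first by apply/matrixP => x y; rewrite !mxE; case: eqP.
  rewrite !exprS IH; apply/matrixP => x y; rewrite !mxE rmorph_sum.
  by apply: eq_bigr => z _; rewrite rmorphM /= !mxE.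
have colE j b : (const_mx 1 *m S ^+ j : 'rV_n.+2) 0 b = (iterlen zeta j b)%:R.
  rewrite -[RHS]/((iterlen zeta j b)%:Z%:~R) -iterlen_mx SX !mxE rmorph_sum.
  by apply: eq_bigr => z _; rewrite !mxE !mul1r.
pose kq : 'cV[rat]_n.+2 := \col_c (k c)%:~R.
have kq0 : kq != 0.
  by apply: contraNneq kc => /colP /(_ c); rewrite !mxE => /eqP; rewrite intr_eq0.
have [p Hp] := zeta_prim.
pose H : rat := \sum_i \sum_j (S ^+ p) i j.
have SXn i j : 0 <= (S ^+ p) i j.
  by rewrite SX mxE subst_mxX ler0z.
have [i j|i j|j b||j0 Hj0] := @cyclic_iter_neq0 rat n.+1 S p H kq irr.
- by rewrite mxE mxE ler0z.
- apply/andP; split; first by rewrite SX mxE -[1]/(1%:~R) ler_int; exact: Hp.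
  rewrite /H (bigD1 i) //= (bigD1 j) //= -addrA lerDl addr_ge0 ?sumr_ge0 //.
  by move=> a _; rewrite sumr_ge0.
- by rewrite colE ltr0n iterlen_gt0.
- exact: kq0.
exists j0 => j /Hj0; apply: contraNneq => Hs.
rewrite mxE.
have -> : \sum_b (const_mx 1 *m S ^+ j : 'rV_n.+2) 0 b * kq b 0 =
   (\sum_b (iterlen zeta j b)%:Z * k b)%:~R.
  rewrite [RHS]rmorph_sum; apply: eq_bigr => b _.
  by rewrite colE mxE rmorphM.
by rewrite Hs.
Qed.

End Lengths.

(** * Integrals of trigonometric polynomials *)

Section HasIntegral.
Context d (T : measurableType d) (R : realType).
Variable mu : {measure set T -> \bar R}.
Variables (D : set T) (mD : measurable D).
Implicit Types (f g : T -> R) (a b v w : R).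

(** Bundling integrability with a real value lets integrals of finite trigonometric sums be computed
    term by term. *)
Definition has_integral f v :=
  mu.-integrable D (EFin \o f) /\ (\int[mu]_(x in D) (f x)%:E = v%:E)%E.

Lemma has_integral_ext f g v : f =1 g -> has_integral f v -> has_integral g v.
Proof. by move=> /funext <-. Qed.

Lemma integrable_has_integral f : mu.-integrable D (EFin \o f) ->
  has_integral f (Rintegral mu D f).
Proof. by move=> fi; split => //; rewrite fineK // integrable_fin_num. Qed.

Lemma has_integral_Rintegral f v : has_integral f v -> Rintegral mu D f = v.
Proof. by case=> _ E; rewrite /Rintegral E. Qed.

Lemma has_integral0 : has_integral (fun=> 0) 0.
Proof. by split; [exact: integrable0 | rewrite integral0]. Qed.

Lemma has_integralD f g v w : has_integral f v -> has_integral g w ->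
  has_integral (fun x => f x + g x) (v + w).
Proof.
move=> [fi fv] [gi gw]; split.
  rewrite (_ : EFin \o _ = (EFin \o f) \+ (EFin \o g))%E; last exact/funext.
  exact: integrableD.
rewrite /comp; under eq_integral do rewrite EFinD.
by rewrite integralD // fv gw.
Qed.

Lemma has_integralZ a f v : has_integral f v ->
  has_integral (fun x => a * f x) (a * v).
Proof.
move=> [fi fv]; split.
  rewrite (_ : EFin \o _ = (fun x => a%:E * (EFin \o f) x)%E); last exact/funext.
  exact: integrableZl.
by under eq_integral do rewrite EFinM; rewrite integralZl // fv.
Qed.

Lemma has_integral_sum (I : Type) (r : seq I) (P : pred I) (f : I -> T -> R)
    (v : I -> R) : (forall i, P i -> has_integral (f i) (v i)) ->
  has_integral (fun x => \sum_(i <- r | P i) f i x) (\sum_(i <- r | P i) v i).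
Proof.
move=> fv; elim: r => [|i r IH].
  by rewrite big_nil; apply: has_integral_ext has_integral0 => x; rewrite big_nil.
rewrite big_cons; case: ifPn => [Pi|/negPf Pi].
  by apply: has_integral_ext (has_integralD (fv i Pi) IH) => x; rewrite big_cons Pi.
by apply: has_integral_ext IH => x; rewrite big_cons Pi.
Qed.

Lemma has_integral_le f g v w : has_integral f v -> has_integral g w ->
  (forall x, f x <= g x) -> v <= w.
Proof.
move=> [fi fv] [gi gw] fg; rewrite -lee_fin -fv -gw.
by apply: le_integral => // x _; rewrite lee_fin.
Qed.

Lemma has_integral_ge0 f v : has_integral f v -> (forall x, 0 <= f x) -> 0 <= v.
Proof. by move=> fv f0; apply: has_integral_le has_integral0 fv f0. Qed.

Lemma has_integral_markov f v l : has_integral f v -> (forall x, 0 <= f x) ->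
  0 < l -> (mu (D `&` [set x | l <= f x]%R) <= (v / l)%:E)%E.
Proof.
move=> [fi fv] f0 l0; have /integrableP[mf _] := fi.
have := @le_integral_comp_abse _ _ _ mu D mD (EFin \o f) l id (@measurable_id _ _ _).
move=> /(_ (fun r h => h)) /(_ (fun _ _ _ _ h => h)) /(_ mf l0) /=.
under eq_integral do rewrite ger0_norm //.
have -> : [set x | (l%:E <= `|(f x)%:E|)%E] = [set x | l <= f x].
  by apply/seteqP; split => x /=; rewrite lee_fin ger0_norm.
by rewrite fv EFinM lee_pdivlMr // muleC.
Qed.

End HasIntegral.

Section Trig.
Variable R : realType.
Implicit Types (t b : R).

Lemma sqr_sum_cos_sin (I : Type) (r : seq I) (th : I -> R) :
  (\sum_(i <- r) cos (th i)) ^+ 2 + (\sum_(i <- r) sin (th i)) ^+ 2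
  = \sum_(i <- r) \sum_(j <- r) cos (th i - th j).
Proof.
rewrite !expr2 !mulr_suml -big_split /=; apply: eq_bigr => i _.
by rewrite !mulr_sumr -big_split; apply: eq_bigr => j _; rewrite cosB.
Qed.

Lemma cos_pi4_sqr : cos (pi / 4 : R) ^+ 2 = 2^-1.
Proof.
have : cos (pi / 2 : R) = 0 by exact: cos_pihalf.
have -> : (pi / 2 : R) = (pi / 4) *+ 2 by rewrite mulr2n; field.
rewrite cos_mulr2n; lra.
Qed.

Lemma cos_ge_pi4 t : `|t| <= pi / 4 -> cos (pi / 4) <= cos t.
Proof.
move=> tp; rewrite -[cos t]cos_norm; have p0 := pi_gt0 R.
have t_in : `|t| \in `[0, pi] by rewrite in_itv /= normr_ge0 /=; lra.
have p_in : pi / 4 \in `[0, (pi : R)] by rewrite in_itv /=; apply/andP; split; lra.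
by rewrite leNgt ltr_cos // -leNgt.
Qed.

(** At angles within [pi / 4] of zero the terms cannot cancel, and [cos (pi / 4) ^+ 2 = 1 / 2]. The
    radii [1 / (8 N)] and [1 / (8 d N)] used for the kernels keep all phases in this range. *)
Lemma cos_sin_sum_ge (I : Type) (r : seq I) (th : I -> R) :
  (forall i, `|th i| <= pi / 4) ->
  (size r)%:R ^+ 2 / 2 <=
  (\sum_(i <- r) cos (th i)) ^+ 2 + (\sum_(i <- r) sin (th i)) ^+ 2.
Proof.
move=> th4; have c0 : 0 <= cos (pi / 4 : R).
  by apply: cos_ge0_pihalf; have := pi_gt0 R; lra.
apply: (@le_trans _ _ ((\sum_(i <- r) cos (th i)) ^+ 2)); last by rewrite lerDl sqr_ge0.
rewrite -cos_pi4_sqr -exprMn ler_pXn2r ?nnegrE ?mulr_ge0 //.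
  rewrite mulr_natl -[X in _ *+ X]sum1_size -sumrMnr.
  by under eq_bigr do rewrite mulr1n; apply: ler_sum => i _; exact: cos_ge_pi4.
by apply: sumr_ge0 => i _; rewrite (le_trans c0) // cos_ge_pi4.
Qed.

Lemma cos_periodz t (k : int) : cos (t + 2 * pi * k%:~R) = cos t.
Proof.
have H m s : cos (s + 2 * pi * m%:R) = cos s :> R.
  elim: m => [|m IH]; first by rewrite mulr0 addr0.
  rewrite -[m.+1%:R]natr1 mulrDr mulr1 addrA -[RHS]IH -[RHS]cosD2pi.
  by rewrite [pi *+ 2]mulr2n; congr cos; ring.
case: k => m; first exact: H.
by rewrite NegzE mulrNz mulrN -(H m.+1) subrK.
Qed.

Lemma sin_periodz t (k : int) : sin (t + 2 * pi * k%:~R) = sin t.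
Proof.
by rewrite -!cosBpihalf -[RHS](cos_periodz _ k); congr cos; ring.
Qed.

Local Notation leb := (@lebesgue_measure R).

Lemma has_integral_cos (a : int) b :
  has_integral leb `[0, 1] (fun w => cos (2 * pi * a%:~R * w - b))
    (if a == 0 then cos b else 0).
Proof.
have cts : continuous (fun w : R => cos (2 * pi * a%:~R * w - b)).
  move=> w; apply: (@continuous_comp _ _ _ (fun w : R => 2 * pi * a%:~R * w - b) cos).
    apply: continuousB; last exact: cst_continuous.
    by apply: continuousM; [exact: cst_continuous | exact: cvg_id].
  exact: continuous_cos.
split.
  apply: continuous_compact_integrable; first exact: segment_compact.
  exact: continuous_subspaceT.
have [a0|a0] := eqVneq a 0.
  rewrite (eq_integral (cst (cos b)%:E)); last first.
    by move=> w _; rewrite a0 mulr0 mul0r sub0r cosN.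
  rewrite integral_cst //= lebesgue_measure_itv /= lte_fin ltr01.
by rewrite -EFinB subr0 mule1.
set A := 2 * pi * a%:~R.
have A0 : A != 0 by rewrite mulf_neq0 ?intr_eq0 // mulf_neq0 ?pnatr_eq0 // gt_eqF ?pi_gt0.
pose F w := A^-1 * sin (A * w - b).
have dF (w : R) : is_derive w (1 : R) F (cos (A * w - b)).
  have -> : cos (A * w - b) = A^-1 *: (cos (A * w - b) * A).
    by rewrite /GRing.scale /= mulrCA mulVf // mulr1.
  apply: is_deriveZ; apply: (@is_derive1_comp R sin (fun w => A * w - b)).
  have := @is_deriveB R R R (fun w => A *: w) (cst b) w 1 A 0.
  rewrite subr0; apply.
  by have := is_deriveZ A (is_derive_id w 1); rewrite /GRing.scale /= mulr1.
have FT := @continuous_FTC2 R (fun w => cos (A * w - b)) F 0 1 ltr01.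
rewrite FT.
- rewrite /F -EFinB; congr EFin; rewrite mulr1 mulr0 -mulrBr.
  have -> : A - b = (0 - b) + 2 * pi * a%:~R by rewrite /A; ring.
  by rewrite sin_periodz subrr mulr0.
- exact: continuous_subspaceT.
- have cF : continuous F.
    by move=> w; apply/differentiable_continuous/derivable1_diffP; case: (dF w).
  split; first by move=> w _; case: (dF w).
    by apply: cvg_at_right_filter; exact: cF.
  by apply: cvg_at_left_filter; exact: cF.
- by move=> w _; rewrite derive1E; case: (dF w).
Qed.

End Trig.

(** * Lebesgue measure on the cube and null sets *)

Section CubeMeasure.
Variable R : realType.
Local Notation leb := (@lebesgue_measure R).
Local Notation Rm := (measurableTypeR R).

Definition in_box n (A : 'I_n -> set R) : set (n.-tuple Rm) :=
  [set t | forall i, A i (tnth t i)].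

Lemma measurable_in_box n (A : 'I_n -> set R) :
  (forall i, measurable (A i)) -> measurable (in_box A).
Proof.
move=> mA; rewrite (_ : in_box A = \bigcap_(i in [set: 'I_n])
    ((@tnth n R ^~ i) @^-1` A i)).
  apply: fin_bigcap_measurable; first exact: finite_finset.
  by move=> i _; have := @measurable_tnth _ Rm n i measurableT _ (mA i); rewrite setTI.
apply/seteqP; split => t /= H i; first by move=> _; exact: H.
exact: H.
Qed.

(** [leb_null] speaks only of covers by boxes, whereas a limsup argument requires a countably
    additive measure. Only its values on boxes have to be known, so an iterated product of uniform
    laws will do. *)
Lemma cube_measure_exists n :
  exists P : probability (n.-tuple Rm) R, forall A : 'I_n -> set R,
    (forall i, measurable (A i)) ->
    P (in_box A) = (\prod_(i < n) (uniform_prob (@ltr01 R) (A i)))%E.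
Proof.
elim: n => [|n [P HP]].
  pose P : probability (0.-tuple Rm) R := \d_ ([tuple] : 0.-tuple Rm).
  exists P => A mA.
  by rewrite big_ord0 /P /= diracE mem_set // => -[].
pose f (p : Rm * n.-tuple Rm) : n.+1.-tuple Rm := [the n.+1.-tuple Rm of p.1 :: p.2].
have mf : measurable_fun setT f by apply: measurable_cons.
pose fm : {mfun (Rm * n.-tuple Rm)%type >-> n.+1.-tuple Rm} :=
  HB.pack f (isMeasurableFun.Build _ _ _ _ f mf).
pose Q : probability (Rm * n.-tuple Rm)%type R := (uniform_prob (@ltr01 R) \x P)%E.
exists (distribution Q fm) => A mA.
rewrite /distribution /pushforward /=.
have -> : f @^-1` in_box A = A ord0 `*` in_box (fun i => A (lift ord0 i)).
  apply/seteqP; split => -[x t] /=.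
    by move=> H; split; [exact: (H ord0) | move=> i; have := H (lift ord0 i); rewrite /= tnthS].
  by move=> [H0 H] i; case: (unliftP ord0 i) => [j ->|->] //=; rewrite tnthS; apply: H.
rewrite /Q /= product_measure1E; [|exact: mA|by apply: measurable_in_box].
by rewrite big_ord_recl; congr (_ * _)%E; apply: HP.
Qed.

Lemma uniform_prob_itv (a b : R) : 0 <= a -> a <= b -> b <= 1 ->
  uniform_prob (@ltr01 R) `[a, b[ = (b - a)%:E.
Proof.
move=> a0 ab b1; rewrite /uniform_prob (eq_integral (cst 1%E)).
  rewrite integral_cst // mul1e.
  rewrite [LHS](@lebesgue_measure_itv R `[a, b[) /= lte_fin.
  by move: ab; rewrite le_eqVlt => /predU1P[->|-> //]; rewrite ltxx subrr.
move=> x; rewrite inE /= ?in_itv /= => /andP[ax xb].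
rewrite /uniform_pdf ?in_itv /= (le_trans a0 ax) (le_trans (ltW xb) b1) /=.
by rewrite subr0 invr1.
Qed.

Lemma uniform_prob_le (A : set R) : measurable A ->
  (uniform_prob (@ltr01 R) A <= leb A)%E.
Proof.
move=> mA; rewrite -[leRHS]mul1e -integral_cst //; apply: ge0_le_integral => //.
- by move=> x _; rewrite lee_fin uniform_pdf_ge0.
- have mU := measurable_uniform_pdf (0 : R) 1; apply: (@measurable_funS _ _ Rm _ setT) => //.
  by apply/measurable_EFinP.
- by move=> x _; rewrite lee_fin /uniform_pdf; case: ifP => _; rewrite ?subr0 ?invr1.
Qed.


Definition cell (d G : nat) (q : {ffun 'I_d -> 'I_G}) : set 'rV[R]_d :=
  [set xi | forall i, (q i)%:R / G%:R <= xi 0 i < (q i).+1%:R / G%:R].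

Definition cells_meeting d G (A : set 'rV[R]_d) : {set {ffun 'I_d -> 'I_G}} :=
  [set q | `[< exists2 xi, cell q xi & A xi >]].

Definition row_of_tuple d (t : d.-tuple R) : 'rV[R]_d := \row_i tnth t i.

Definition lipschitz_row d (F : 'rV[R]_d -> R) :=
  exists2 K : R, 0 <= K & forall (xi xi' : 'rV[R]_d) (e : R), (forall i, `|xi 0 i - xi' 0 i| <= e) ->
    `|F xi - F xi'| <= K * e.

(* If too many cells met the sets [b' m <= F m] for every [m], the unions of these
   cells, on which [b m <= F m], would have a limsup of positive measure. *)
Lemma null_limsup_few_cells d (Z : set 'rV[R]_d) (F : nat -> 'rV[R]_d -> R)
    (b b' : nat -> R) (h : nat) (del : R) :
  leb_null Z -> (forall xi, ~ Z xi -> \forall m \near \oo, F m xi < b m) ->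
  (forall m, b m < b' m) -> (forall m, lipschitz_row (F m)) ->
  (0 < h)%N -> 0 < del ->
  exists m N, (0 < N)%N /\
    (#|cells_meeting (h * N) [set xi | b' m <= F m xi]|%:R
       <= del * (h * N)%:R ^+ d).
Proof.
move=> Z0 Fb bb' lipF h0 del0.
have [P HP] := cube_measure_exists d.
have cellP G (q : {ffun 'I_d -> 'I_G}) :
    P (@row_of_tuple d @^-1` cell q) = ((G%:R ^- d)%:E).
  have -> : @row_of_tuple d @^-1` cell q =
      in_box (fun i => `[(q i)%:R / G%:R, (q i).+1%:R / G%:R[%classic).
    apply/seteqP; split => t H i; have := H i; rewrite /= ?mxE ?in_itv //=.
  rewrite HP; last by move=> i; apply: measurable_itv.
  rewrite (eq_bigr (fun=> (G%:R^-1)%:E)).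
    by rewrite prodEFin prodr_const card_ord exprVn.
  move=> i _; have G0 : 0 < G%:R :> R by rewrite ltr0n (leq_ltn_trans _ (ltn_ord (q i))).
  rewrite uniform_prob_itv; first by rewrite -mulrBl -natrB // subSnn mul1r.
  - by rewrite divr_ge0.
  - by rewrite ler_pM2r ?invr_gt0 // ler_nat.
  - by rewrite ler_pdivrMr // mul1r ler_nat.
have mcell G (q : {ffun 'I_d -> 'I_G}) : measurable (@row_of_tuple d @^-1` cell q : set (d.-tuple Rm)).
  rewrite (_ : _ @^-1` _ = in_box (fun i => `[(q i)%:R / G%:R, (q i).+1%:R / G%:R[%classic)).
    by apply: measurable_in_box => i; apply: measurable_itv.
  by apply/seteqP; split => t H i; have := H i; rewrite /= ?mxE ?in_itv //=.
(* The grid is chosen so fine that [F m] varies by at most the slack [b' m - b m] inside a cell. *)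
have NP m : exists N, (0 < N)%N /\ forall (xi xi' : 'rV[R]_d),
    (forall i, `|xi 0 i - xi' 0 i| <= (h * N)%:R^-1) -> `|F m xi - F m xi'| <= b' m - b m.
  have [K K0 HK] := lipF m; have bb := bb' m; rewrite -subr_gt0 in bb.
  exists (Num.bound (K / (b' m - b m))).+1; split => // xi xi' H; apply: (le_trans (HK _ _ _ H)).
  rewrite ler_pdivrMr ?ltr0n ?muln_gt0 ?h0 // -ler_pdivrMl // mulrC.
  apply: le_trans (ltW (archi_boundP _)) _; first by rewrite divr_ge0 // ltW.
  by rewrite ler_nat (leq_trans (leqnSn _)) // leq_pmull.
pose N m := sval (cid (NP m)).
have N0 m : (0 < N m)%N by rewrite /N; case: cid => ? /= [].
have NF m (xi xi' : 'rV[R]_d) : (forall i, `|xi 0 i - xi' 0 i| <= (h * N m)%:R^-1) ->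
    `|F m xi - F m xi'| <= b' m - b m by rewrite /N; case: cid => ? /= [_]; apply.
pose Q m := cells_meeting (h * N m) [set xi | b' m <= F m xi].
pose D m : set (d.-tuple Rm) := \bigcup_(q in [set` enum (Q m)]) (@row_of_tuple d @^-1` cell q).
have mD m : measurable (D m).
  by apply: fin_bigcup_measurable; [exact: finite_finset | move=> q _; apply: mcell].
have PD m : P (D m) = (#|Q m|%:R / (h * N m)%:R ^+ d)%:E.
  rewrite measure_fin_bigcup; last first.
  - by move=> q _; apply: mcell.
  - move=> q q' _ _ [t [tq tq']]; apply/ffunP => i; apply: val_inj => /=.
    have := tq i; have := tq' i; rewrite mxE.
    have G0 : 0 < (h * N m)%:R :> R by rewrite ltr0n muln_gt0 h0 N0.
    rewrite !ler_pdivrMr // !ltr_pdivlMr // => /andP[a1 a2] /andP[a3 a4].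
    have := le_lt_trans a1 a4; have := le_lt_trans a3 a2.
    by rewrite !ltr_nat !ltnS => x y; apply/eqP; rewrite eqn_leq x y.
  - exact: finite_finset.
  rewrite -fsbig_seq ?enum_uniq // (eq_bigr (fun=> ((h * N m)%:R ^- d)%:E)); last by move=> q _; exact: cellP.
  rewrite sumEFin big_const_seq count_predT -cardE iter_addr addr0.
  by rewrite mulr_natl.
have DZ t : lim_sup_set D t -> Z (row_of_tuple t).
  move=> Dt; apply: contrapT => /Fb [m0 _ Hm0].
  have [m /= m0m] := Dt m0 I; case=> q; rewrite /= mem_enum inE => /asboolP[xi xiq bxi] tq.
  have := Hm0 m m0m; rewrite ltNge => /negP; apply.
  have G0 : 0 < (h * N m)%:R :> R by rewrite ltr0n muln_gt0 h0 N0.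
  have : `|F m xi - F m (row_of_tuple t)| <= b' m - b m.
    apply: NF => i; have := xiq i; have := tq i.
    rewrite -[(q i).+1%:R]natr1 mulrDl mul1r ler_norml => /andP[a1 a2] /andP[a3 a4].
    by apply/andP; split; lra.
  move: bxi => /= bxi; rewrite ler_norml => /andP[_]; lra.
(* The limsup lies over [Z], and boxes covering [Z] bound its measure because the uniform law is at
   most Lebesgue measure on each factor, even for boxes that leave the cube. *)
have Pl e : 0 < e -> (P (lim_sup_set D) <= e%:E)%E.
  move=> e0; have [a [bx [ab [cover vol]]]] := Z0 e e0.
  have mlim : measurable (lim_sup_set D).
    apply: bigcap_measurable => // k _; apply: bigcup_measurable => j _; exact: mD.
  pose B j := in_box (fun i => `[a j 0 i, bx j 0 i]%classic).
  have mB j : measurable (B j) by apply: measurable_in_box => i; apply: measurable_itv.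
  apply: (@le_trans _ _ (\sum_(0 <= j <oo) P (B j))%E).
    apply: measure_sigma_subadditive => // t /DZ /cover [j _ /= Hj].
    exists j => // i; rewrite /= in_itv /=; have := Hj i; by rewrite mxE.
  apply: le_trans (ltW vol); apply: lee_nneseries => // j _.
  rewrite HP; last by move=> i; apply: measurable_itv.
  rewrite -prodEFin.
  have [] : (0 <= \prod_(i < d) uniform_prob (@ltr01 R) `[a j 0%R i, bx j 0%R i]%classic)%E /\
    (\prod_(i < d) uniform_prob (@ltr01 R) `[a j 0%R i, bx j 0%R i]%classic
     <= \prod_(i < d) (bx j 0%R i - a j 0%R i)%R%:E)%E; last by [].
  elim/big_ind2: _ => [//|x1 x2 y1 y2 [x0 x12] [y0 y12]|i _].
    by rewrite mule_ge0 // lee_pmul.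
  split; first exact: measure_ge0.
  apply: (le_trans (uniform_prob_le _)); first exact: measurable_itv.
  rewrite lebesgue_measure_itv /= lte_fin; case: ifP => // _.
  by rewrite lee_fin subr_ge0.
(* Continuity from above: the unions of the tails decrease to the limsup, so one of them, and with
   it some [D m], has measure below [del]. *)
have := lim_sup_set_cvg P D mD.
have -> : (P (\bigcup_(k >= 0) D k) < +oo)%E.
  apply: (le_lt_trans (probability_le1 _ _)); last exact: ltry.
  by apply: bigcup_measurable => k _; exact: mD.
move=> /(_ isT) cvgP.
have lt_del : (P (lim_sup_set D) < del%:E)%E.
  by apply: (le_lt_trans (Pl (del / 2) _)); rewrite ?lte_fin ?divr_gt0 //; lra.
have [m _ /(_ m (leqnn m)) /= Hm] := cvgP _ (open_ereal_lt' lt_del).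
exists m, (N m); split; first exact: N0.
rewrite -ler_pdivrMr ?exprn_gt0 ?ltr0n ?muln_gt0 ?h0 ?N0 // -lee_fin -PD.
apply: (le_trans _ (ltW Hm)); apply: le_measure; rewrite ?inE //.
  by apply: bigcup_measurable => k _; exact: mD.
by move=> t Dt; exists m => /=.
Qed.
End CubeMeasure.

(** * Regularity of the spectral cocycle *)

Section ComplexNorm.
Variable R : realType.
Implicit Types (x y : R[i]).
Local Notation nc := (@Normc.normc R).

Lemma normc_triangle x y : nc (x + y) <= nc x + nc y.
Proof. exact: le_normcD. Qed.

Lemma normc_ge0 x : 0 <= nc x.
Proof. by case: x => a b; rewrite sqrtr_ge0. Qed.

Lemma normc_opp x : nc (- x) = nc x.
Proof. exact: normcN. Qed.

Lemma normc_sum (I : Type) (r : seq I) (P : pred I) (f : I -> R[i]) :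
  nc (\sum_(i <- r | P i) f i) <= \sum_(i <- r | P i) nc (f i).
Proof.
elim/big_ind2: _ => [|x a y b xa yb|//]; first by rewrite Normc.normc0.
by apply: (le_trans (normc_triangle _ _)); apply: lerD.
Qed.

Lemma normc_le_abs (a b : R) : nc (a +i* b)%C <= `|a| + `|b|.
Proof.
rewrite /= -[leRHS]ger0_norm ?addr_ge0 // -sqrtr_sqr ler_wsqrtr // sqrrD !real_normK ?num_real //.
have := mulr_ge0 (normr_ge0 a) (normr_ge0 b); rewrite -mulr_natl; lra.
Qed.

Lemma normc_sub_le x y : `|nc x - nc y| <= nc (x - y).
Proof.
rewrite ler_norml; apply/andP; split.
  have := normc_triangle x (y - x); rewrite addrC subrK -(normc_opp (y - x)) opprB; lra.
by have := normc_triangle (x - y) y; rewrite subrK; lra.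
Qed.

Lemma expm2piD (s t : R) : expm2pi (s + t) = expm2pi s * expm2pi t.
Proof.
rewrite /expm2pi mulrDr cosD sinD; apply/eqP; rewrite eq_complex /=.
by apply/andP; split; apply/eqP; ring.
Qed.

Lemma normc_expm2pi (t : R) : nc (expm2pi t) = 1.
Proof. by rewrite /expm2pi /= sqrrN cos2Dsin2 sqrtr1. Qed.

Lemma expm2pi0 : expm2pi (0 : R) = 1.
Proof. by rewrite /expm2pi mulr0 cos0 sin0 oppr0. Qed.

Lemma expm2pi_int (t : R) (z : int) : expm2pi (t + z%:~R) = expm2pi t.
Proof. by rewrite /expm2pi mulrDr cos_periodz sin_periodz. Qed.

Lemma lipschitz_of_derive1 (f df : R -> R) (s t : R) :
  (forall x : R, is_derive x (1 : R) f (df x)) -> (forall x : R, `|df x| <= 1) ->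
  `|f s - f t| <= `|s - t|.
Proof.
move=> fd df1; wlog st : s t / s <= t.
  by move=> H; have [/H //|/ltW/H] := leP s t; rewrite distrC [leRHS]distrC.
have cf : {within `[s, t], continuous f}.
  apply/continuous_subspaceT => x.
  by apply/differentiable_continuous/derivable1_diffP; case: (fd x).
have [c _ E] := @MVT_segment R f df s t st (fun u _ => fd u) cf.
by rewrite distrC E normrM [leRHS]distrC ler_piMl.
Qed.

Lemma normc_expm2pi_sub (s t : R) :
  nc (expm2pi s - expm2pi t) <= 4 * pi * `|s - t|.
Proof.
have -> : expm2pi s - expm2pi t = ((cos (2 * pi * s) - cos (2 * pi * t))
    +i* (sin (2 * pi * t) - sin (2 * pi * s)))%C.
  by rewrite /expm2pi; apply/eqP; rewrite eq_complex /= eqxx /= opprK addrC.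
apply: (le_trans (normc_le_abs _ _)).
have H1 := @lipschitz_of_derive1 cos (fun u => - sin u) (2 * pi * s) (2 * pi * t)
  (fun u => is_derive_cos u).
have H2 := @lipschitz_of_derive1 sin cos (2 * pi * t) (2 * pi * s)
  (fun u => is_derive_sin u) (@cos_max R).
have {}H1 := H1 (fun u => eq_ind_r (fun z => z <= 1) (sin_max u) (normrN (sin u))).
have E : `|2 * pi * s - 2 * pi * t| = 2 * pi * `|s - t|.
  by rewrite -mulrBr normrM ger0_norm // mulr_ge0 // pi_ge0.
have E' : `|2 * pi * t - 2 * pi * s| = 2 * pi * `|s - t| by rewrite distrC.
by rewrite E in H1; rewrite E' in H2; have := lerD H1 H2; lra.
Qed.

End ComplexNorm.

Section CmxNorm.
Variables (R : realType) (d : nat).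
Implicit Types A B : 'M[R[i]]_d.
Local Notation nc := (@Normc.normc R).

Lemma cmx_norm_ge0 A : 0 <= cmx_norm A.
Proof. by apply: sumr_ge0 => i _; apply: sumr_ge0 => j _; exact: normc_ge0. Qed.

Lemma cmx_normM A B : cmx_norm (A *m B) <= cmx_norm A * cmx_norm B.
Proof.
rewrite /cmx_norm mulr_suml; apply: ler_sum => i _.
rewrite (@le_trans _ _ (\sum_j \sum_k nc (A i k) * nc (B k j))) //.
  apply: ler_sum => j _; rewrite mxE (le_trans (normc_sum _ _ _)) //.
  by apply: ler_sum => k _; rewrite Normc.normcM.
rewrite exchange_big /= mulr_suml; apply: ler_sum => k _.
rewrite -mulr_sumr ler_wpM2l ?normc_ge0 //.
rewrite [leRHS](bigD1 k) //= lerDl; apply: sumr_ge0 => l _.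
by apply: sumr_ge0 => j _; exact: normc_ge0.
Qed.

End CmxNorm.

Section CocycleRegularity.
Variables (R : realType) (n : nat) (zeta : substitution n.+1).
Local Notation nc := (@Normc.normc R).
Local Notation V := 'rV[R]_n.+1.
Implicit Types (xi : V).

(** Boundedness is carried along for the sake of products, which are Lipschitz when the factors are
    also bounded; [e] bounds the sup distance. *)
Definition bounded_lipschitz (f : V -> R[i]) := exists2 K : R, 0 <= K &
  forall (xi xi' : V) (e : R), (forall i, `|xi 0 i - xi' 0 i| <= e) ->
  nc (f xi) <= K /\ nc (f xi - f xi') <= K * e.

Lemma dist_row_ge0 xi xi' (e : R) : (forall i, `|xi 0 i - xi' 0 i| <= e) -> 0 <= e.
Proof. by move=> /(_ ord0); apply: le_trans. Qed.

Lemma bounded_lipschitz_cst c : bounded_lipschitz (fun=> c).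
Proof.
exists (nc c) => [|xi xi' e /dist_row_ge0 e0]; first exact: normc_ge0.
by rewrite subrr Normc.normc0 lexx mulr_ge0 ?normc_ge0.
Qed.

Lemma bounded_lipschitzD f g : bounded_lipschitz f -> bounded_lipschitz g ->
  bounded_lipschitz (fun xi => f xi + g xi).
Proof.
move=> [K K0 Kf] [L L0 Lg]; exists (K + L) => [|xi xi' e H]; first exact: addr_ge0.
have [f1 f2] := Kf _ _ _ H; have [g1 g2] := Lg _ _ _ H; split.
  by apply: (le_trans (normc_triangle _ _)); apply: lerD.
by rewrite opprD addrACA mulrDl (le_trans (normc_triangle _ _)) // lerD.
Qed.

Lemma bounded_lipschitzM f g : bounded_lipschitz f -> bounded_lipschitz g ->
  bounded_lipschitz (fun xi => f xi * g xi).
Proof.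
move=> [K K0 Kf] [L L0 Lg]; exists (K * L *+ 2) => [|xi xi' e H].
  by rewrite mulrn_wge0 // mulr_ge0.
have e0 := dist_row_ge0 H.
have [f1 f2] := Kf _ _ _ H; have [g1 g2] := Lg _ _ _ H; split.
  rewrite Normc.normcM mulr2n (@le_trans _ _ (K * L)) //.
    by rewrite ler_pM // normc_ge0.
  by rewrite lerDl mulr_ge0.
(* The bound on [g xi'] is read off at distance [0] from [xi'] to itself. *)
have [g3 _] := Lg xi' xi' 0 (fun i => eq_ind_r (fun z => `|z| <= 0) (eq_ind_r (fun z => z <= 0) (lexx 0) (normr0 R)) (subrr _)).
have -> : f xi * g xi - f xi' * g xi' = f xi * (g xi - g xi') + (f xi - f xi') * g xi'.
  by rewrite mulrBr mulrBl addrA subrK.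
apply: (le_trans (normc_triangle _ _)); rewrite !Normc.normcM mulr2n mulrDl.
apply: lerD; first by rewrite -mulrA ler_pM ?normc_ge0.
by rewrite mulrAC ler_pM ?normc_ge0.
Qed.

Lemma bounded_lipschitz_sum (I : Type) (r : seq I) (P : pred I) (f : I -> V -> R[i]) :
  (forall i, P i -> bounded_lipschitz (f i)) ->
  bounded_lipschitz (fun xi => \sum_(i <- r | P i) f i xi).
Proof.
move=> Hf; elim: r => [|i r IH].
  under eq_fun do rewrite big_nil; exact: bounded_lipschitz_cst.
case Pi : (P i); last by under eq_fun do rewrite big_cons Pi.
under eq_fun do rewrite big_cons Pi.
by apply: bounded_lipschitzD => //; apply: Hf.
Qed.

Lemma bounded_lipschitz_endo_E f : bounded_lipschitz f ->
  bounded_lipschitz (fun xi => f (endo_E zeta xi)).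
Proof.
move=> [K K0 Kf].
pose C : R := \sum_i \sum_j `|(subst_mx zeta i j)%:~R|.
have C0 : 0 <= C by apply: sumr_ge0 => i _; apply: sumr_ge0.
exists (K * C + K) => [|xi xi' e H]; first by rewrite addr_ge0 ?mulr_ge0.
have e0 := dist_row_ge0 H.
have E i : `|endo_E zeta xi 0 i - endo_E zeta xi' 0 i| <= C * e.
  rewrite /endo_E !mxE -sumrB (le_trans (ler_norm_sum _ _ _)) // mulr_suml.
  apply: ler_sum => j _; rewrite mxE -mulrBl normrM mulrC ler_pM //.
  by rewrite (bigD1 i) //= lerDl sumr_ge0.
have [f1 f2] := Kf _ _ _ E; split.
  by rewrite (le_trans f1) // lerDr mulr_ge0.
by rewrite (le_trans f2) // mulrDl mulrA lerDl mulr_ge0.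
Qed.

Lemma bounded_lipschitz_expm2pi (I : Type) (r : seq I) (g : I -> 'I_n.+1) :
  bounded_lipschitz (fun xi => expm2pi (\sum_(k <- r) xi 0 (g k))).
Proof.
elim: r => [|k r IH].
  under eq_fun do rewrite big_nil; exact: bounded_lipschitz_cst.
under eq_fun do rewrite big_cons expm2piD.
apply: bounded_lipschitzM IH; exists (4 * pi + 1).
  by rewrite addr_ge0 // mulr_ge0 // pi_ge0.
move=> xi xi' e H; have p0 : 0 <= 4 * pi :> R by rewrite mulr_ge0 // pi_ge0.
split; first by rewrite normc_expm2pi lerDr.
apply: (le_trans (normc_expm2pi_sub _ _)).
by rewrite ler_pM // lerDl.
Qed.

Lemma bounded_lipschitz_cocycle m (a b : 'I_n.+1) :
  bounded_lipschitz (fun xi => spectral_cocycle zeta xi m a b).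
Proof.
elim: m a b => [|m IH] a b; first exact: bounded_lipschitz_cst.
rewrite (_ : (fun xi => _) = fun xi => \sum_c spectral_mx zeta (iter m (endo_E zeta) xi) a c
    * spectral_cocycle zeta xi m c b); last by apply/funext => xi; rewrite /= mxE.
apply: bounded_lipschitz_sum => c _; apply: bounded_lipschitzM (IH c b).
have base : bounded_lipschitz (fun xi => spectral_mx zeta xi a c).
  rewrite (_ : (fun xi => _) = fun xi => \sum_(j < size (zeta a) | nth a (zeta a) j == c)
       expm2pi (\sum_(k < j) xi 0 (nth a (zeta a) k))); last by apply/funext => xi; rewrite mxE.
  by apply: bounded_lipschitz_sum => j _; apply: bounded_lipschitz_expm2pi.
elim: m {IH} => [//|m IHm].
rewrite (_ : (fun xi => _) = fun xi => spectral_mx zeta (iter m (endo_E zeta) (endo_E zeta xi)) a c).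
  exact: (bounded_lipschitz_endo_E IHm).
by apply/funext => xi; rewrite -iterSr.
Qed.

Lemma cmx_norm_spectral_mx_bounded : exists2 L : R, 1 <= L &
  forall xi, cmx_norm (spectral_mx zeta xi) <= L.
Proof.
exists (1 + \sum_(a < n.+1) \sum_(c < n.+1) (size (zeta a))%:R).
  by rewrite lerDl sumr_ge0 // => a _; rewrite sumr_ge0.
move=> xi; rewrite -[leLHS]add0r lerD //; apply: ler_sum => a _; apply: ler_sum => c _.
rewrite mxE (le_trans (normc_sum _ _ _)) //.
under eq_bigr do rewrite normc_expm2pi.
by rewrite big_mkcond /= -[X in _ <= X%:R]card_ord -sum1_card natr_sum; apply: ler_sum => j _; case: ifP.
Qed.

Lemma lipschitz_cmx_norm_cocycle m :
  lipschitz_row (fun xi => cmx_norm (spectral_cocycle zeta xi m)).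
Proof.
pose K a b := s2val (cid2 (@bounded_lipschitz_cocycle m a b)).
exists (\sum_a \sum_b K a b).
  by apply: sumr_ge0 => a _; apply: sumr_ge0 => b _; rewrite /K; case: cid2.
move=> xi xi' e H; rewrite /cmx_norm -sumrB mulr_suml (le_trans (ler_norm_sum _ _ _)) //.
apply: ler_sum => a _; rewrite -sumrB mulr_suml (le_trans (ler_norm_sum _ _ _)) //.
apply: ler_sum => b _; rewrite (le_trans (normc_sub_le _ _)) //.
by rewrite /K; case: cid2 => k /= _ /(_ _ _ _ H) [].
Qed.

Lemma spectral_cocycle_periodic m xi (z : 'rV[int]_n.+1) :
  spectral_cocycle zeta (xi + map_mx (fun z : int => z%:~R : R) z) m =
  spectral_cocycle zeta xi m.
Proof.
have perE xi' (y : 'rV[int]_n.+1) : endo_E zeta (xi' + map_mx (fun z : int => z%:~R : R) y)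
    = endo_E zeta xi' + map_mx (fun z : int => z%:~R : R) (y *m subst_mx zeta).
  rewrite /endo_E mulmxDl; congr (_ + _); apply/rowP => c; rewrite !mxE rmorph_sum.
  by apply: eq_bigr => i _; rewrite rmorphM /= !mxE.
have perEi k : exists y : 'rV[int]_n.+1,
    iter k (endo_E zeta) (xi + map_mx (fun z : int => z%:~R : R) z) =
    iter k (endo_E zeta) xi + map_mx (fun z : int => z%:~R : R) y.
  elim: k => [|k [y /= ->]]; first by exists z.
  by rewrite perE; exists (y *m subst_mx zeta).
elim: m => //= m ->; congr (_ *m _); have [y ->] := perEi m.
apply/matrixP => a c; rewrite !mxE; apply: eq_bigr => j _.
set w := iter m _ _; rewrite -(expm2pi_int (\sum_(k < j) w 0 (nth a (zeta a) k))
  (\sum_(k < j) y 0 (nth a (zeta a) k))).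
congr expm2pi; rewrite rmorph_sum -big_split; apply: eq_bigr => k _.
by rewrite !mxE.
Qed.

End CocycleRegularity.

(** The rate [c] is lowered to some [c0] still above [chi], so that the gap between [exp (c0 m)] and
    [exp (c m)] absorbs the oscillation inside a cell. The grid has [h N] cells per side: with
    [h = 8 d], a cell has the width [1 / (8 d N)] at which a kernel with [N] frequencies per
    coordinate is still large. *)
Lemma lyapunov_few_cells (R : realType) n (zeta : substitution n.+1)
    (chi : \bar R) (c : R) (h : nat) (del : R) :
  top_lyapunov zeta chi -> (chi < c%:E)%E -> (0 < h)%N -> 0 < del ->
  exists m N, [/\ (0 < m)%N, (0 < N)%N &
   exists Q : {set {ffun 'I_n.+1 -> 'I_(h * N)}},
    #|Q|%:R <= del * (h * N)%:R ^+ n.+1 /\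
    forall xi : 'rV[R]_n.+1,
      expR (c * m%:R) <= cmx_norm (spectral_cocycle zeta xi m) ->
      exists2 q, q \in Q & exists z : 'I_n.+1 -> int, forall i,
        `|xi 0 i - (z i)%:~R - (q i)%:R / (h * N)%:R| <= (h * N)%:R^-1].
Proof.
move=> chiP chic h0 del0.
have [c0 chic0 c0c] : exists2 c0 : R, (chi < c0%:E)%E & c0 < c.
  case: chi chic {chiP} => [r| |] //; last by exists (c - 1); rewrite ?ltNyr //; lra.
  by rewrite lte_fin => rc; exists ((r + c) / 2); rewrite ?lte_fin; lra.
pose F m (xi : 'rV[R]_n.+1) := cmx_norm (spectral_cocycle zeta xi m.+1).
have [| |m [N [N0 HQ]]] := @null_limsup_few_cells R n.+1 _ F (fun m => expR (c0 * m.+1%:R))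
  (fun m => expR (c * m.+1%:R)) h del chiP _ _ (fun m => lipschitz_cmx_norm_cocycle R zeta m.+1) h0 del0.
- move=> xi /contrapT H; have [m0 _ Hm0] := H _ (open_ereal_lt' chic0).
  exists m0 => // m /= /Hm0 /=.
  (* When the norm vanishes, [elog] is [-oo] and the bound by a positive exponential is
     immediate. *)
  rewrite /lyap_seq /elog -/(F m xi); case: eqP => [-> _|/eqP F0]; first exact: expR_gt0.
  rewrite -EFinM lte_fin ltr_pdivrMr ?ltr0n //.
  rewrite -(ltr_expR (ln _)) lnK //.
  by rewrite posrE lt_def F0 cmx_norm_ge0.
- by move=> m; rewrite ltr_expR ltr_pM2r // ltr0n.
exists m.+1, N; split => //; eexists; split; first exact: HQ.
move=> xi Fxi; pose z := \row_i Num.floor (xi 0 i).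
pose xi' := xi - map_mx (fun z : int => z%:~R : R) z.
have xi'E i : xi' 0 i = xi 0 i - (Num.floor (xi 0 i))%:~R by rewrite !mxE.
have xi'01 i : 0 <= xi' 0 i < 1.
  have /andP[] := floor_itv (xi 0 i); rewrite xi'E intrD; lra.
have G0 : 0 < (h * N)%:R :> R by rewrite ltr0n muln_gt0 h0 N0.
have Gxi i : (Num.truncn ((h * N)%:R * xi' ord0 i)%R < h * N)%N.
  have /andP[a b] := xi'01 i.
  rewrite -(ltr_nat R); apply: le_lt_trans (_ : (h * N)%:R * xi' 0 i < _).
    by have /andP[] := truncn_itv (mulr_ge0 (ltW G0) a).
  by rewrite gtr_pMr.
pose q : {ffun 'I_n.+1 -> 'I_(h * N)} := [ffun i => Ordinal (Gxi i)].
have cq : cell q xi'.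
  move=> i; have /andP[a b] := xi'01 i; rewrite ffunE /=.
  by rewrite ler_pdivrMr // ltr_pdivlMr // [xi' 0 i * _]mulrC truncn_itv // mulr_ge0 // ltW.
exists q.
  rewrite inE; apply/asboolP; exists xi' => //=.
  by rewrite /F -(spectral_cocycle_periodic zeta m.+1 xi' z) /xi' subrK.
exists (fun i => Num.floor (xi 0 i)) => i; rewrite -xi'E.
have := cq i; rewrite -natr1 mulrDl mul1r ler_norml => /andP[a b].
by apply/andP; split; have := invr_ge0 (h * N)%:R; rewrite ltW //; lra.
Qed.

(** * Growth of the cocycle along the diagonal line *)

Lemma sum_ltn J j0 : (\sum_(j < J) (j < j0) = minn J j0)%N.
Proof. by elim: J => [|J IH]; rewrite ?big_ord0 ?min0n // big_ord_recr /= IH; lia. Qed.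

Section TorusKernel.
Variables (R : realType) (n : nat) (zeta : substitution n.+2) (N : nat).
Local Notation leb := (@lebesgue_measure R).
Local Notation V := 'rV[R]_n.+2.
Local Notation freq := {ffun 'I_n.+2 -> 'I_N}.
Implicit Types (xi : V) (a : 'I_n.+2 -> R) (s t : freq).

(* The product Fejer kernel [|sum_(s in [0, N)^d) e(s . (xi - a))|^2]: it is of order
   [N^(2d)] within [1/(8dN)] of [a] modulo [Z^d], while its mean along the curve
   [w |-> E^j (w, ..., w)] is only [N^d]. *)
Definition torus_phase a xi s : R := 2 * pi * \sum_i (s i)%:R * (xi 0 i - a i).

Definition torus_kernel a xi : R :=
  (\sum_(s : freq) cos (torus_phase a xi s)) ^+ 2
  + (\sum_(s : freq) sin (torus_phase a xi s)) ^+ 2.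

Lemma torus_kernel_ge0 a xi : 0 <= torus_kernel a xi.
Proof. by rewrite addr_ge0 ?sqr_ge0. Qed.

Lemma card_freq : #|freq|%:R = N%:R ^+ n.+2 :> R.
Proof. by rewrite card_ffun !card_ord natrX. Qed.

Lemma torus_kernel_ge a xi (z : 'I_n.+2 -> int) : (0 < N)%N ->
  (forall i, `|xi 0 i - (z i)%:~R - a i| <= ((8 * n.+2) * N)%:R^-1) ->
  N%:R ^+ n.+2 ^+ 2 / 2 <= torus_kernel a xi.
Proof.
move=> N0 H; pose xi' : V := \row_i (xi 0 i - (z i)%:~R).
have E s : torus_phase a xi s =
    torus_phase a xi' s + 2 * pi * (\sum_i (s i)%:Z * z i)%:~R.
  rewrite /torus_phase -mulrDr rmorph_sum -big_split; congr (_ * _) => /=.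
  by apply: eq_bigr => i _; rewrite mxE rmorphM /=; ring.
rewrite /torus_kernel; under eq_bigr do rewrite E cos_periodz.
under [X in _ + X ^+ 2]eq_bigr do rewrite E sin_periodz.
rewrite -card_freq cardE enumT.
apply: cos_sin_sum_ge => s.
rewrite /torus_phase normrM ger0_norm ?mulr_ge0 ?pi_ge0 //.
have N0' : 0 < N%:R :> R by rewrite ltr0n.
(* Each of the [d] coordinates contributes at most [N / (8 d N)], in all [1 / 8]; the factor [2 pi]
   turns this into [pi / 4]. *)
suff : `|\sum_i (s i)%:R * (xi' 0 i - a i)| <= 8^-1.
  by move=> le8; have := ler_wpM2l (pi_ge0 R) le8; lra.
rewrite (le_trans (ler_norm_sum _ _ _)) //.
apply: (@le_trans _ _ (\sum_(i < n.+2) N%:R * ((8 * n.+2) * N)%:R^-1)).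
  apply: ler_sum => i _; rewrite normrM ler_pM //.
    by rewrite normr_nat ler_nat ltnW.
  by have := H i; rewrite mxE.
rewrite sumr_const card_ord -mulr_natl !natrM.
by rewrite le_eqVlt; apply/orP; left; apply/eqP; field; rewrite gt_eqF //= pnatr_eq0.
Qed.

Hypothesis zeta_ne : subst_nonempty zeta.
Hypothesis zeta_prim : subst_primitive zeta.
Hypothesis zeta_irr :
  irreducible_poly (char_poly (map_mx (fun z : int => z%:~R : rat) (subst_mx zeta))).

(** A kernel involves finitely many pairs of frequencies, so the thresholds found for the single
    differences have a maximum. *)
Lemma frequencies_independent : exists j0, forall j, (j0 <= j)%N ->
  forall s t, s != t ->
    \sum_c (iterlen zeta j c)%:Z * ((s c)%:Z - (t c)%:Z) != 0.
Proof.
have H (p : freq * freq) : exists j0, p.1 != p.2 -> forall j, (j0 <= j)%N ->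
    \sum_c (iterlen zeta j c)%:Z * ((p.1 c)%:Z - (p.2 c)%:Z) != 0.
  have [|st] := eqVneq p.1 p.2; first by exists 0%N.
  have [c stc] : exists c, (p.1 c)%:Z - (p.2 c)%:Z != 0.
    apply: contrapT => /forallNP H; move/eqP: st; apply; apply/ffunP => c.
    have := H c; move/negP; rewrite negbK subr_eq0 => /eqP [] ?; exact: val_inj.
  have [j0 Hj0] := @lengths_independent n zeta zeta_ne zeta_prim
    (fun c => (p.1 c)%:Z - (p.2 c)%:Z) zeta_irr (ex_intro _ c stc).
  by exists j0.
pose j0 p := sval (cid (H p)).
exists (\max_p j0 p)%N => j jge s t st.
have : (j0 (s, t) <= j)%N by apply: leq_trans jge; exact: leq_bigmax.
by rewrite /j0; case: cid => j1 /= /(_ st); apply.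
Qed.

(** In the double sum over [s] and [t] the off-diagonal terms are cosines of nonzero integer
    frequency in [w] and integrate to zero; each of the [N^d] diagonal terms gives [1]. *)
Lemma torus_kernel_mean j a :
  (forall s t, s != t ->
    \sum_c (iterlen zeta j c)%:Z * ((s c)%:Z - (t c)%:Z) != 0) ->
  has_integral leb `[0, 1]
    (fun w => torus_kernel a (iter j (endo_E zeta) (const_mx w)))
    (N%:R ^+ n.+2).
Proof.
move=> ind.
pose A s t : int := \sum_c (iterlen zeta j c)%:Z * ((s c)%:Z - (t c)%:Z).
pose B s t : R := 2 * pi * \sum_c ((s c)%:R - (t c)%:R) * a c.
have -> : (N%:R ^+ n.+2 : R) =
    \sum_(s : freq) \sum_(t : freq) (if A s t == 0 then cos (B s t) else 0).
  rewrite -card_freq -sum1_card natr_sum; apply: eq_bigr => s _.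
  rewrite (bigD1 s) //= big1 ?addr0; last first.
    by move=> t ts; rewrite eq_sym in ts; rewrite (negPf (ind s t ts)).
  rewrite [A s s]big1 ?eqxx; last by move=> c _; rewrite subrr mulr0.
  rewrite [B s s](_ : _ = 0) ?cos0 //.
  by rewrite /B big1 ?mulr0 // => c _; rewrite subrr mul0r.
have Kw : (fun w => \sum_(s : freq) \sum_(t : freq)
      cos (2 * pi * (A s t)%:~R * w - B s t)) =1
    (fun w => torus_kernel a (iter j (endo_E zeta) (const_mx w))).
  move=> w; rewrite /torus_kernel sqr_sum_cos_sin; apply: eq_bigr => s _.
  apply: eq_bigr => t _; congr cos; rewrite /torus_phase /A /B -mulrBr -sumrB.
  rewrite -mulrA -mulrBr; congr (_ * _).
  rewrite rmorph_sum mulr_suml -sumrB; apply: eq_bigr => c _.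
  by rewrite iter_endo_E mxE rmorphM rmorphB /=; ring.
apply: (@has_integral_ext _ (measurableTypeR R) R leb _ _ _ _ Kw).
apply: has_integral_sum => // s _; apply: has_integral_sum => // t _.
exact: has_integral_cos.
Qed.

End TorusKernel.

(** * Scarcity of bad blocks on the diagonal *)

Section BadBlocks.
Variables (R : realType) (n : nat) (zeta : substitution n.+2).
Local Notation leb := (@lebesgue_measure R).
Local Notation d := n.+2.
Hypothesis zeta_ne : subst_nonempty zeta.
Hypothesis zeta_prim : subst_primitive zeta.
Hypothesis zeta_irr :
  irreducible_poly (char_poly (map_mx (fun z : int => z%:~R : rat) (subst_mx zeta))).

Local Notation orbit w j := (iter j (endo_E zeta) (const_mx w)).

Definition bad_block (c : R) m w j :=
  expR (c * m%:R) <= cmx_norm (spectral_cocycle zeta (orbit w (j * m)%N) m).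

Lemma few_bad_blocks (chi : \bar R) (c kap eps : R) :
  top_lyapunov zeta chi -> (chi < c%:E)%E -> 0 < kap -> 0 < eps ->
  exists m J0, (0 < m)%N /\ forall J, (J0 <= J)%N ->
    exists Bad : set R, [/\ measurable Bad, (leb Bad <= eps%:E)%E &
      forall w, 0 <= w <= 1 -> ~ Bad w ->
        \sum_(j < J) (bad_block c m w j : nat)%:R <= kap * J%:R].
Proof.
move=> chiP chic kap0 eps0.
have h0 : (0 < 8 * d)%N by [].
(* At most [del (8 d N)^d] kernels, each of mean [N^d] and weighted by [2 / N^(2 d)], have total
   mean at most [2 del (8 d)^d = kap eps / 2] for each [j]. Markov's inequality at level [kap J / 2]
   then discards measure at most [eps]. *)
pose del : R := kap * eps / (4 * (8 * d)%:R ^+ d).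
have hd0 : 0 < (8 * d)%:R ^+ d :> R by rewrite exprn_gt0 // ltr0n.
have del0 : 0 < del by rewrite divr_gt0 // mulr_gt0.
have [m [N [m0 N0 [Q [Qc Qcov]]]]] := lyapunov_few_cells chiP chic h0 del0.
have [j0 Hj0] := frequencies_independent N zeta_ne zeta_prim zeta_irr.
(* Half of the allowance [kap J] is reserved for the indices [j < j0], where the frequencies may
   coincide; hence [J >= 2 j0 / kap]. *)
exists m, (Num.bound (2 * j0%:R / kap)).+1; split=> // J HJ.
have J0 : 0 < J%:R :> R by rewrite ltr0n (leq_trans _ HJ).
have j0J : j0%:R <= kap * J%:R / 2.
  have : 2 * j0%:R / kap <= J%:R.
    apply: le_trans (ltW (archi_boundP _)) _; first by rewrite divr_ge0 // ?mulr_ge0 // ltW.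
    by rewrite ler_nat (leq_trans (leqnSn _)).
  by rewrite ler_pdivrMr // mulrC; lra.
have N0' : 0 < N%:R :> R by rewrite ltr0n.
pose a (q : {ffun 'I_d -> 'I_((8 * d) * N)}) i : R := (q i)%:R / (8 * d * N)%:R.
(* The weight [2 / N^(2 d)] makes every bad block with [j >= j0] count for at least [1] in [h w]. *)
pose h w : R := \sum_(j < J | (j0 <= j)%N) \sum_(q in Q)
  2 / N%:R ^+ d ^+ 2 * torus_kernel N (a q) (orbit w (j * m)%N).
have C0 : 0 <= 2 / N%:R ^+ d ^+ 2 :> R by rewrite divr_ge0 // !exprn_ge0 // ltW.
have h_ge0 w : 0 <= h w.
  apply: sumr_ge0 => j _; apply: sumr_ge0 => q _; rewrite mulr_ge0 //.
  exact: torus_kernel_ge0.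
have hint : has_integral leb `[0, 1] h
    (\sum_(j < J | (j0 <= j)%N) \sum_(q in Q) 2 / N%:R ^+ d ^+ 2 * N%:R ^+ d).
  apply: has_integral_sum => // j jj0; apply: has_integral_sum => // q _.
  apply: has_integralZ => //; apply: torus_kernel_mean => s t st.
  by apply: Hj0 st; rewrite (leq_trans jj0) // leq_pmulr.
set v := \sum_(j < J | _) _ in hint.
have v_le : v <= eps * (kap * J%:R / 2).
  apply: (@le_trans _ _ (\sum_(j < J) kap * eps / 2)).
    rewrite /v big_mkcond; apply: ler_sum => j _.
    case: ifP => _; last by rewrite !mulr_ge0 // ltW.
    rewrite sumr_const -[leLHS]mulr_natl.
    have -> : 2 / N%:R ^+ d ^+ 2 * N%:R ^+ d = 2 / N%:R ^+ d :> R.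
      by field; rewrite expf_neq0 // gt_eqF.
    rewrite mulrA ler_pdivrMr ?exprn_gt0 //.
    have -> : kap * eps / 2 * N%:R ^+ d = del * ((8 * d) * N)%:R ^+ d * 2.
      rewrite natrM exprMn /del; field.
      by rewrite expf_neq0 // gt_eqF // ltr0n.
    by rewrite ler_pM2r.
  rewrite sumr_const card_ord -[X in X <= _]mulr_natr; lra.
have th0 : 0 < kap * J%:R / 2 by rewrite divr_gt0 ?mulr_gt0.
pose Bad : set R := `[0, 1]%classic `&` [set w | kap * J%:R / 2 <= h w].
exists Bad; split.
- have [/integrableP[mh _] _] := hint.
  have /measurable_EFinP {}mh := mh.
  rewrite /Bad; have := mh (measurable_itv _) _ (measurable_itv `[kap * J%:R / 2, +oo[).
  by rewrite preimage_itvcy.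
- apply: (le_trans (has_integral_markov _ hint h_ge0 th0)) => //.
  by rewrite lee_fin ler_pdivrMr.
move=> w w01 wB.
have hw : h w < kap * J%:R / 2.
  by rewrite ltNge; apply/negP => hw; apply: wB; split => //=; rewrite in_itv.
apply: (@le_trans _ _ (\sum_(j < J) ((j < j0)%N : nat)%:R + h w)); last first.
  have -> : kap * J%:R = kap * J%:R / 2 + kap * J%:R / 2 by lra.
  apply: lerD (ltW hw); apply: le_trans j0J.
  by rewrite -natr_sum ler_nat sum_ltn geq_minr.
rewrite /h [X in _ <= _ + X]big_mkcond -big_split /=; apply: ler_sum => j _.
have [jj0|jj0] := ltnP j j0; first by rewrite /= addr0 ler_nat leq_b1.
rewrite /= add0r; case bj : (bad_block _ _ _ _); last first.
  by apply: sumr_ge0 => q _; rewrite mulr_ge0 // torus_kernel_ge0.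
have [q qQ [z Hz]] := Qcov _ bj.
rewrite (bigD1 q) //= -[leLHS]addr0; apply: lerD; last first.
  by apply: sumr_ge0 => q' _; rewrite mulr_ge0 // torus_kernel_ge0.
have := ler_wpM2l C0 (torus_kernel_ge N0 Hz).
apply: le_trans; rewrite le_eqVlt; apply/orP; left; apply/eqP; field.
by rewrite expf_neq0 // gt_eqF.
Qed.

Lemma spectral_cocycleD (xi : 'rV[R]_d) k l : spectral_cocycle zeta xi (k + l) =
  spectral_cocycle zeta (iter k (endo_E zeta) xi) l *m spectral_cocycle zeta xi k.
Proof.
elim: l => [|l IH]; first by rewrite addn0 mul1mx.
by rewrite addnS /= IH mulmxA -iterD addnC.
Qed.

End BadBlocks.

Section Growth.
Variables (R : realType) (n : nat) (zeta : substitution n.+2).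
Local Notation leb := (@lebesgue_measure R).
Local Notation d := n.+2.
Hypothesis zeta_ne : subst_nonempty zeta.
Hypothesis zeta_prim : subst_primitive zeta.
Hypothesis zeta_irr :
  irreducible_poly (char_poly (map_mx (fun z : int => z%:~R : rat) (subst_mx zeta))).

Local Notation orbit w j := (iter j (endo_E zeta) (const_mx w)).

(* Along a good orbit a proportion at most [kap] of the blocks of length [m]
   is bad, so the growth per step is at most [expR c * LL `^ kap] with [LL] a bound on
   one factor. *)
Lemma cocycle_growth (chi : \bar R) (G : R) :
  top_lyapunov zeta chi -> 1 < G -> (chi < (ln G / 2)%:E)%E ->
  exists rho : R, [/\ 1 <= rho, rho ^+ 2 < G & forall eps, 0 < eps ->
    exists (A : R) k0, 0 < A /\ forall k, (k0 <= k)%N ->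
      exists Bad : set R, [/\ measurable Bad, (leb Bad <= eps%:E)%E &
        forall w, 0 <= w <= 1 -> ~ Bad w -> forall i l, (i + l <= k)%N ->
          cmx_norm (spectral_cocycle zeta (orbit w i) l) <= A * rho ^+ k]].
Proof.
move=> chiP G1 chiG.
have g1 (x y z t : R) : x * y * (z * t) = z * y * (x * t) by ring.
have g2 (u v x y z : R) : u * v ^+ 2 * z * (x * y) = v * (u * x * (y * z)) * v by ring.
have lnG : 0 < ln G by apply: ln_gt0.
(* With [c > 0] the factor [expR (c m)] is at least [1]: bad blocks may carry it too, and stretches
   shorter than [k] cost at most [expR (c k)]. *)
have [c [chic c0 cG]] : exists c : R, [/\ (chi < c%:E)%E, 0 < c & c < ln G / 2].
  case: chi chiG {chiP} => [r| |] //; last by exists (ln G / 4); rewrite ltNyr; split=> //; lra.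
  rewrite lte_fin => rG; exists (Num.max ((r + ln G / 2) / 2) (ln G / 4)).
  split; [rewrite lte_fin lt_max | rewrite lt_max | rewrite gt_max].
  - by apply/orP; left; lra.
  - by apply/orP; right; lra.
  - by apply/andP; split; lra.
have [L L1 HL] := cmx_norm_spectral_mx_bounded R zeta.
have L0 : 0 < L by lra.
pose D : R := cmx_norm (1%:M : 'M[R[i]]_d) + 1.
have D1 : 1 <= D by rewrite lerDr cmx_norm_ge0.
have D0 : 0 < D by lra.
pose LL := D * L.
have LL1 : 1 <= LL by rewrite (le_trans D1) // ler_peMr // ltW.
have LL0 : 0 < LL by lra.
have lnL : 0 <= ln LL by apply: ln_ge0.
(* This makes [kap * ln LL] smaller than the gap [ln G / 2 - c], whence [rho ^+ 2 < G]; the [+ 1]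
   guards against [ln LL = 0]. *)
pose kap : R := (ln G / 2 - c) / (2 * (ln LL + 1)).
have kap0 : 0 < kap by rewrite divr_gt0 ?mulr_gt0 //; lra.
have kL0 := mulr_ge0 (ltW kap0) lnL.
pose rho := expR (c + kap * ln LL).
have rho1 : 1 <= rho by rewrite -expR0 ler_expR; lra.
exists rho; split=> //.
  have G0 : 0 < G by lra.
  rewrite -[ltRHS](@lnK _ G) // /rho -expRM_natl ltr_expR.
  have : kap * ln LL < ln G / 2 - c.
    rewrite /kap mulrAC ltr_pdivrMr; last by rewrite mulr_gt0 //; lra.
    by rewrite ltr_pM2l; lra.
  lra.
move=> eps eps0.
have [m [J0 [m0 HJ]]] := few_bad_blocks zeta_ne zeta_prim zeta_irr chiP chic kap0 eps0.
have crude xi l : cmx_norm (spectral_cocycle zeta xi l) <= D * L ^+ l.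
  elim: l => [|l IH]; first by rewrite expr0 mulr1 lerDl.
  rewrite exprS mulrCA (le_trans (cmx_normM _ _)) //.
  by rewrite ler_pM // cmx_norm_ge0.
pose W := LL ^+ m.
have W1 : 1 <= W by rewrite exprn_ege1.
have W0 : 0 < W by lra.
have crudem xi l : (l <= m)%N -> cmx_norm (spectral_cocycle zeta xi l) <= W.
  move=> lm; apply: (le_trans (crude _ _)); rewrite /W /LL exprMn.
  apply: ler_pM; [exact: ltW | by rewrite exprn_ge0 // ltW | | by rewrite ler_weXn2l].
  by rewrite -[leLHS]expr1 ler_weXn2l.
(* [D] bounds the identity matrix from which the product of blocks starts, [W ^+ 2] pays for the
   incomplete blocks at both ends, and the exponential pays for rounding up, as [m J <= k + m]. *)
pose A := D * W ^+ 2 * expR (kap * m%:R * ln LL).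
have E1 : 1 <= expR (kap * m%:R * ln LL).
  by rewrite -expR0 ler_expR mulrAC mulr_ge0.
have A0 : 0 < A by rewrite !mulr_gt0 ?expR_gt0 // exprn_gt0.
exists A, (J0 * m)%N; split => // k kJ0; pose J := (k %/ m).+1.
have [|Bad [mBad BadE HBad]] := HJ J; first by rewrite /J leqW // leq_divRL.
exists Bad; split => // w w01 wB; have {HBad} := HBad w w01 wB => sumbad.
pose nb a b := (\sum_(a <= j < a + b) bad_block zeta c m w j)%N.
have blk a b : cmx_norm (spectral_cocycle zeta (orbit w (a * m)%N) (b * m)%N)
    <= D * expR (c * m%:R) ^+ b * W ^+ nb a b.
  elim: b => [|b IH].
    by rewrite mul0n /nb addn0 big_geq // !expr0 !mulr1 lerDl.
  rewrite mulSnr spectral_cocycleD -iterD -mulnDl.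
  apply: (le_trans (cmx_normM _ _)).
  have step : cmx_norm (spectral_cocycle zeta (orbit w ((b + a) * m)%N) m) <=
      expR (c * m%:R) * W ^+ bad_block zeta c m w (a + b).
    rewrite [(a + b)%N]addnC; case bad : (bad_block _ _ _ _).
      rewrite expr1 (le_trans (crudem _ _ (leqnn m))) // ler_peMl ?(ltW W0) //.
      by rewrite -expR0 ler_expR mulr_ge0 // ltW.
    by rewrite expr0 mulr1 ltW // ltNge; apply/negP; rewrite /bad_block in bad; rewrite bad.
  have -> : nb a b.+1 = (bad_block zeta c m w (a + b) + nb a b)%N.
    by rewrite /nb addnS big_nat_recr ?leq_addr //= addnC.
  rewrite exprD exprS.
  rewrite [D * _]mulrCA mulrACA.
  by rewrite ler_pM // cmx_norm_ge0.
move=> i l ilk.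
have Ark : A <= A * rho ^+ k by rewrite ler_peMr ?(ltW A0) // exprn_ege1.
(* The times from [i] to [i + l] split into a head of length [r0] reaching the multiple [a m], then
   [b] whole blocks and a tail of length [r1 < m]. If [l < r0], the crude bound alone suffices. *)
pose a := (i %/ m).+1; pose r0 := (a * m - i)%N.
have iam : (i < a * m)%N by rewrite /a mulSnr {1}(divn_eq i m) ltn_add2l ltn_pmod.
have r0m : (r0 <= m)%N by rewrite /r0 /a leq_subLR mulSnr leq_add2r leq_trunc_div.
have WA : W <= A.
  rewrite /A (_ : D * W ^+ 2 * _ = W * (D * (W * expR (kap * m%:R * ln LL)))); last by ring.
  by rewrite ler_peMr ?(ltW W0) // !mulr_ege1.
have [lr0|r0l] := ltnP l r0.
  by apply: (le_trans (crudem _ _ (leq_trans (ltnW lr0) r0m))); apply: le_trans WA Ark.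
pose b := ((l - r0) %/ m)%N; pose r1 := ((l - r0) %% m)%N.
have lE : l = (r0 + (b * m + r1))%N by rewrite -divn_eq subnKC.
have iE : (i + r0 = a * m)%N by rewrite /r0 subnKC // ltnW.
have abJ : (a + b <= J)%N.
  rewrite /J -(leq_pmul2r m0) (leq_trans _ (ltnW (ltn_ceil k m0))) //.
  by rewrite mulnDl -iE; apply: leq_trans ilk; rewrite lE -!addnA !leq_add2l leq_addr.
have nbJ : (nb a b)%:R <= kap * J%:R :> R.
  apply: le_trans sumbad; rewrite -natr_sum ler_nat /nb.
  rewrite -(big_mkord xpredT (fun j => bad_block zeta c m w j : nat)).
  have aJ : (a <= J)%N by apply: leq_trans abJ; rewrite leq_addr.
  rewrite (@big_cat_nat _ _ _ a 0 J) //= (@big_cat_nat _ _ _ (a + b) a J) ?leq_addr //=.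
  by rewrite addnCA leq_addr.
have mk : (m * J <= k + m)%N by rewrite /J mulnS addnC leq_add2r mulnC leq_trunc_div.
have bmk : (m * b <= k)%N by apply: leq_trans ilk; rewrite lE mulnC addnA addnC -addnA leq_addr.
have Wnb : W ^+ nb a b <= expR (kap * ln LL * k%:R) * expR (kap * m%:R * ln LL).
  have LLE : LL = expR (ln LL) by rewrite lnK.
  rewrite /W -exprM {1}LLE -expRM_natl -expRD ler_expR.
  rewrite natrM mulrAC.
  apply: (le_trans (ler_wpM2l _ nbJ)); first by rewrite mulr_ge0.
  rewrite [kap * m%:R * _]mulrAC -mulrDr -natrD.
  rewrite g1 -natrM.
  by rewrite ler_wpM2l // ler_nat.
have cb : expR (c * m%:R) ^+ b <= expR (c * k%:R).
  rewrite -expRM_natr ler_expR -mulrA -natrM; rewrite ler_wpM2l ?(ltW c0) //.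
  by rewrite ler_nat.
rewrite lE spectral_cocycleD -iterD addnC iE.
apply: (le_trans (cmx_normM _ _)).
rewrite spectral_cocycleD.
have H1 := crudem (orbit w i) r0 r0m.
have H2 := crudem (iter (b * m) (endo_E zeta) (orbit w (a * m)%N)) r1
  (ltnW (ltn_pmod _ m0)).
have -> : A * rho ^+ k = (W * (D * expR (c * k%:R) *
   (expR (kap * ln LL * k%:R) * expR (kap * m%:R * ln LL)))) * W.
  by rewrite /A /rho -expRM_natr (mulrDl c) expRD g2.
rewrite ler_pM ?cmx_norm_ge0 //.
apply: (le_trans (cmx_normM _ _)); rewrite ler_pM ?cmx_norm_ge0 //.
apply: (le_trans (blk a b)).
rewrite ler_pM ?exprn_ge0 ?mulr_ge0 ?exprn_ge0 ?expR_ge0 ?(ltW D0) ?(ltW W0) //.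
  exact: ltW.
by rewrite ler_wpM2l ?(ltW D0).
Qed.
End Growth.

(** * Twisted Birkhoff sums of words *)

Lemma sum_geq k m : (\sum_(i < k) (m <= i) = k - m)%N.
Proof. by elim: k => [|k IH]; rewrite ?big_ord0 ?big_ord_recr /= ?IH; lia. Qed.

Section WordSums.
Variables (R : realType) (n : nat) (zeta : substitution n.+1).
Variables (phi : seq 'I_n.+1 -> R) (B : R) (r : nat).
Hypothesis phiB : forall u, `|phi u| <= B.
Variable w : R.
Implicit Types (u v s : seq 'I_n.+1) (a b c : 'I_n.+1).
Local Notation nc := (@Normc.normc R).
Local Notation e k := (expm2pi (k%:R * w)).

(** Windows running off the end of [u] are truncated rather than dropped. As [phi] is bounded on all
    words, appending letters changes at most [r] terms, each by at most [2 B]. *)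
Definition word_sum u : R[i] :=
  \sum_(i < size u) e i * (phi (take r (drop i u)))%:C%C.

Lemma phi_bound_ge0 : 0 <= B.
Proof. exact: le_trans (phiB [::]). Qed.

Lemma normc_real (x : R) : nc x%:C%C = `|x|.
Proof. by rewrite /= expr0n /= addr0 sqrtr_sqr. Qed.

Lemma word_sum_nil : word_sum [::] = 0.
Proof. by rewrite /word_sum big_ord0. Qed.

Lemma word_sum_cat_head u v :
  nc (\sum_(i < size u) e i * (phi (take r (drop i (u ++ v))))%:C%C - word_sum u)
    <= 2 * B * r%:R.
Proof.
rewrite /word_sum -sumrB (le_trans (normc_sum _ _ _)) //.
apply: (@le_trans _ _ (\sum_(i < size u) if (size u < i + r)%N then 2 * B else 0)).
  apply: ler_sum => i _; rewrite -mulrBr Normc.normcM normc_expm2pi mul1r -rmorphB.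
  rewrite normc_real; case: ifP => [_|/negbT].
    apply: (le_trans (ler_normB _ _)).
    by rewrite mulr_natl mulr2n lerD.
  rewrite -leqNgt => ir; rewrite drop_cat ltn_ord take_cat size_drop.
  have [_|] := ltnP r (size u - i); first by rewrite subrr normr0.
  move=> ri; have -> : (r - (size u - i) = 0)%N by apply/eqP; rewrite subn_eq0 leq_subRL ?(ltnW (ltn_ord i)).
  rewrite take0 cats0 (_ : take r _ = drop i u) ?subrr ?normr0 //.
  by rewrite take_oversize // size_drop.
rewrite -big_mkcond /= sumr_const -[leLHS]mulr_natr ler_wpM2l //.
  by rewrite mulr_ge0 // phi_bound_ge0.
rewrite ler_nat; have : (#|[pred i : 'I_(size u) | (size u < i + r)%N]| <= r)%N; last by [].
rewrite -sum1_card big_mkcond /=.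
apply: (@leq_trans (\sum_(i < size u) (size u - r <= i : nat))).
  by apply: leq_sum => i _; case: ifP => // /ltnW; rewrite leq_subLR addnC => ->.
rewrite -(big_mkord xpredT (fun i => (size u - r <= i)%N : nat)).
by rewrite big_mkord sum_geq; lia.
Qed.

Lemma word_sum_cat u v :
  nc (word_sum (u ++ v) - (word_sum u + e (size u) * word_sum v)) <= 2 * B * r%:R.
Proof.
have -> : word_sum (u ++ v) =
    \sum_(i < size u) e i * (phi (take r (drop i (u ++ v))))%:C%C +
    e (size u) * word_sum v.
  rewrite {1}/word_sum size_cat big_split_ord /=; congr (_ + _).
  rewrite /word_sum mulr_sumr; apply: eq_bigr => i _.
  by rewrite mulrA -expm2piD -mulrDl -natrD drop_cat ltnNge leq_addr addKn.
rewrite opprD addrACA subrr addr0.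
exact: word_sum_cat_head.
Qed.

Local Notation K := (2 * B * r%:R).

Lemma cat_error_ge0 : 0 <= K.
Proof. by rewrite !mulr_ge0 // phi_bound_ge0. Qed.

Lemma word_sum_cat_le u v (x y : R) : nc (word_sum u) <= x -> nc (word_sum v) <= y ->
  nc (word_sum (u ++ v)) <= x + y + K.
Proof.
move=> ux vy; rewrite -[word_sum (u ++ v)](subrK (word_sum u + e (size u) * word_sum v)).
rewrite addrC (le_trans (normc_triangle _ _)) // lerD //; last exact: word_sum_cat.
rewrite (le_trans (normc_triangle _ _)) // lerD //.
by rewrite Normc.normcM normc_expm2pi mul1r.
Qed.

Lemma word_sum_suffix_le u v (x y : R) : nc (word_sum u) <= x ->
  nc (word_sum (u ++ v)) <= y -> nc (word_sum v) <= x + y + K.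
Proof.
move=> ux uvy.
have -> : nc (word_sum v) = nc (e (size u) * word_sum v).
  by rewrite Normc.normcM normc_expm2pi mul1r.
have -> : e (size u) * word_sum v = - word_sum u + (word_sum (u ++ v) +
   (- (word_sum (u ++ v) - (word_sum u + e (size u) * word_sum v)))).
  by rewrite opprB [X in _ + X]addrC subrK addrA addNr add0r.
rewrite -addrA (le_trans (normc_triangle _ _)) // lerD ?normc_opp //.
rewrite (le_trans (normc_triangle _ _)) // lerD ?normc_opp //.
exact: word_sum_cat.
Qed.

Section Blocks.
Variables (W : 'I_n.+1 -> seq 'I_n.+1) (X Y : R).
Hypothesis WX : forall a, nc (word_sum (W a)) <= X.
Hypothesis WY : forall a t, nc (word_sum (take t (W a))) <= Y.

Lemma word_sum_take_blocks s t :
  nc (word_sum (take t (flatten (map W s)))) <= (size s)%:R * (X + K) + Y.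
Proof.
have X0 : 0 <= X by exact: le_trans (normc_ge0 _) (WX ord0).
have Y0 : 0 <= Y by exact: le_trans (normc_ge0 _) (WY ord0 0).
elim: s t => [|a s IH] t; first by rewrite /= word_sum_nil Normc.normc0 mul0r add0r.
rewrite /= take_cat; case: ltnP => _.
  by rewrite (le_trans (WY _ _)) // lerDr mulr_ge0 // addr_ge0 // cat_error_ge0.
rewrite (le_trans (word_sum_cat_le (WX a) (IH _))) // -[(size s).+1%:R]natr1; lra.
Qed.

(** Let [p] be what precedes [u] in the first block met. As [u] is no longer than any block,
    [p ++ u] is a prefix of at most two blocks, and the sum over [u] is, up to [K], a difference of
    sums over prefixes. *)
Lemma word_sum_infix_blocks s u : infix u (flatten (map W s)) ->
  (forall a, size u <= size (W a))%N ->
  nc (word_sum u) <= 2 * (X + K) + 2 * Y + K.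
Proof.
move=> /infixP[p [q E]] uW; elim: s p E => [|a s IH] p /= E.
  have u0 : u = [::] by case: p E => // ; case: (u).
  rewrite u0 word_sum_nil Normc.normc0.
  have X0 : 0 <= X by exact: le_trans (normc_ge0 _) (WX ord0).
  have Y0 : 0 <= Y by exact: le_trans (normc_ge0 _) (WY ord0 0).
  have := cat_error_ge0; lra.
have [pW|Wp] := ltnP (size p) (size (W a)); last first.
  apply: (IH (drop (size (W a)) p)).
  have := congr1 (drop (size (W a))) E; rewrite drop_size_cat // => ->.
  by rewrite drop_cat ltn_neqAle Wp andbT; case: eqP => // ->; rewrite subnn drop0 drop_size.
have pY : nc (word_sum p) <= Y.
  have <- : take (size p) (W a) = p; last exact: WY.
  by rewrite -(@takel_cat _ _ (W a) (flatten (map W s))) 1?ltnW // E take_size_cat.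
have X0 : 0 <= X by exact: le_trans (normc_ge0 _) (WX ord0).
have K0 := cat_error_ge0.
suff puY : nc (word_sum (p ++ u)) <= 2 * (X + K) + Y.
  by apply: (le_trans (word_sum_suffix_le pY puY)); lra.
have puE : p ++ u = take (size p + size u) (W a ++ flatten (map W s)).
  by rewrite E catA take_size_cat // size_cat.
case: s E IH puE => [|b s] E IH puE.
  by rewrite puE /= cats0 (le_trans (WY _ _)) //; lra.
have -> : p ++ u = take (size p + size u) (flatten (map W [:: a; b])).
  rewrite puE /= cats0 catA takel_cat // size_cat.
  by apply: leq_add; [exact: ltnW | exact: uW].
exact: word_sum_take_blocks.
Qed.
End Blocks.

Let sz : nat := (\max_b size (zeta b))%N.
Local Notation blk j := (fun a => subst_iter zeta j a).

Lemma subst_iterS_blocks j a :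
  subst_iter zeta j.+1 a = flatten (map (blk j) (zeta a)).
Proof.
rewrite -[j.+1]addn1 subst_iterD subst_iter1; elim: (zeta a) => [|b s IH].
  exact: iter_subst_word_nil.
by rewrite -cat1s iter_subst_word_cat IH.
Qed.

Lemma subst_iterD_blocks j k a :
  subst_iter zeta (j + k) a = flatten (map (blk j) (subst_iter zeta k a)).
Proof.
rewrite subst_iterD; elim: (subst_iter zeta k a) => [|b s IH].
  exact: iter_subst_word_nil.
by rewrite -cat1s iter_subst_word_cat IH.
Qed.

(** Dumont-Thomas decomposition: a prefix of [zeta^(j+1)(a)] consists of at most [|zeta(a)|] whole
    words of level [j] and a prefix of one more, so each level costs [sz (X + K)]. *)
Lemma word_sum_prefix_le (X : R) m :
  (forall j a, (j <= m)%N -> nc (word_sum (subst_iter zeta j a)) <= X) ->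
  forall j a t, (j <= m)%N ->
  nc (word_sum (take t (subst_iter zeta j a))) <= X + m%:R * (sz%:R * (X + K)).
Proof.
move=> HX; have X0 : 0 <= X by apply: le_trans (normc_ge0 _) (HX 0%N ord0 _).
have XK : 0 <= X + K by rewrite addr_ge0 // cat_error_ge0.
suff H j a t : (j <= m)%N ->
    nc (word_sum (take t (subst_iter zeta j a))) <= X + j%:R * (sz%:R * (X + K)).
  move=> j a t jm; apply: (le_trans (H j a t jm)).
  by rewrite lerD2l ler_wpM2r ?ler_nat // mulr_ge0.
elim: j a t => [|j IH] a t jm.
  rewrite mul0r addr0; case: t => [|t]; first by rewrite take0 word_sum_nil Normc.normc0.
  by rewrite take_oversize //; apply: HX.
rewrite subst_iterS_blocks.
have HW b : nc (word_sum (subst_iter zeta j b)) <= X by apply: HX; exact: ltnW.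
have HY b t' := IH b t' (ltnW jm).
apply: (le_trans (word_sum_take_blocks HW HY _ _)).
have : (size (zeta a))%:R * (X + K) <= sz%:R * (X + K).
  by rewrite ler_wpM2r // ler_nat; exact: leq_bigmax.
rewrite -[j.+1%:R]natr1 [(_ + 1) * _]mulrDl mul1r; lra.
Qed.

(** If [k > m], the word [zeta^k(a)] is cut into words of level [m]; otherwise [u] is a difference
    of two prefixes of [zeta^k(a)]. *)
Lemma word_sum_language_le (X : R) m u :
  (forall j a, (j <= m)%N -> nc (word_sum (subst_iter zeta j a)) <= X) ->
  subst_language zeta u -> (size u <= minlen zeta m)%N ->
  nc (word_sum u) <= 2 * (X + K) + 2 * (X + m%:R * (sz%:R * (X + K))) + K.
Proof.
move=> HX [a [k uk]] um.
have X0 : 0 <= X by apply: le_trans (normc_ge0 _) (HX 0%N ord0 _).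
have K0 := cat_error_ge0.
have HY := word_sum_prefix_le HX.
have [km|mk] := leqP k m; last first.
  have E : k = (m + (k - m))%N by rewrite subnKC // ltnW.
  rewrite E subst_iterD_blocks in uk.
  apply: (word_sum_infix_blocks _ _ uk) => [b|b t|b].
  - exact: HX.
  - exact: HY.
  - by apply: (leq_trans um); rewrite /minlen; case: arg_minnP => // i _; apply.
have [p [q E]] := infixP uk.
have pY : nc (word_sum p) <= X + m%:R * (sz%:R * (X + K)).
  by have := HY k a (size p) km; rewrite E take_size_cat.
have puY : nc (word_sum (p ++ u)) <= X + m%:R * (sz%:R * (X + K)).
  by have := HY k a (size (p ++ u)) km; rewrite E catA take_size_cat.
by apply: (le_trans (word_sum_suffix_le pY puY)); lra.
Qed.

Definition vec_norm (v : 'cV[R[i]]_n.+1) : R := \sum_b nc (v b 0).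

Lemma vec_normD (v v' : 'cV[R[i]]_n.+1) : vec_norm (v + v') <= vec_norm v + vec_norm v'.
Proof.
by rewrite /vec_norm -big_split; apply: ler_sum => b _; rewrite mxE normc_triangle.
Qed.

Lemma vec_normM (A : 'M[R[i]]_n.+1) (v : 'cV[R[i]]_n.+1) : vec_norm (A *m v) <= cmx_norm A * vec_norm v.
Proof.
rewrite /vec_norm /cmx_norm mulr_suml; apply: ler_sum => b _; rewrite mxE.
rewrite (le_trans (normc_sum _ _ _)) // mulr_suml; apply: ler_sum => c _.
rewrite Normc.normcM ler_wpM2l ?normc_ge0 // (bigD1 c) //= lerDl.
by apply: sumr_ge0 => a _; exact: normc_ge0.
Qed.

Lemma vec_norm_sum (I : Type) (s : seq I) (P : pred I) (v : I -> 'cV[R[i]]_n.+1) :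
  vec_norm (\sum_(i <- s | P i) v i) <= \sum_(i <- s | P i) vec_norm (v i).
Proof.
elim/big_ind2: _ => [|x a y b xa yb|//]; last exact: le_trans (vec_normD _ _) (lerD xa yb).
by rewrite /vec_norm big1 // => b _; rewrite mxE Normc.normc0.
Qed.

Local Notation orbit j := (iter j (endo_E zeta) (const_mx w)).

Definition block_sums j : 'cV[R[i]]_n.+1 := \col_b word_sum (subst_iter zeta j b).

(* [P_(j+1) = M(E^j xi) P_j + O(1)]: the spectral cocycle renormalizes the sums over
   the words [zeta^j(b)], up to the windows that overlap two blocks. *)
Definition block_error j := block_sums j.+1 - spectral_mx zeta (orbit j) *m block_sums j.

Lemma word_sum_blocks j s b :
  nc (word_sum (flatten (map (blk j) s)) -
    \sum_(i < size s) expm2pi (\sum_(k < i) orbit j 0 (nth b s k))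
       * word_sum (subst_iter zeta j (nth b s i))) <= (size s)%:R * K.
Proof.
elim: s => [|a s IH]; first by rewrite big_ord0 /= word_sum_nil subrr Normc.normc0 mul0r.
rewrite /= big_ord_recl big_ord0 expm2pi0 mul1r /=.
set T := \sum_(i < size s) _ in IH.
have -> : \sum_(i < size s) expm2pi (\sum_(k < lift ord0 i) orbit j 0 (nth b (a :: s) k)) *
    word_sum (subst_iter zeta j (nth b s i)) = e (size (subst_iter zeta j a)) * T.
  rewrite mulr_sumr; apply: eq_bigr => i _; rewrite mulrA -expm2piD /=.
  rewrite big_ord_recl /= iter_endo_E.
  by congr (expm2pi (_ + _) * _); rewrite mxE mulrC.
set u := subst_iter zeta j a; set v := flatten _ in IH *.
rewrite -[(size s).+1%:R]natr1 mulrDl mul1r.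
have -> : word_sum (u ++ v) - (word_sum u + e (size u) * T) =
    (word_sum (u ++ v) - (word_sum u + e (size u) * word_sum v)) + e (size u) * (word_sum v - T).
  rewrite mulrBr; move: (word_sum (u ++ v)) (word_sum u) (_ * T) (_ * word_sum v).
  by move=> x y t z; rewrite !opprD !addrA subrK.
rewrite (le_trans (normc_triangle _ _)) // [leRHS]addrC lerD //; first exact: word_sum_cat.
by rewrite Normc.normcM normc_expm2pi mul1r.
Qed.

Lemma block_error_le j : vec_norm (block_error j) <= n.+1%:R * (sz%:R * K).
Proof.
apply: (@le_trans _ _ (\sum_(b < n.+1) sz%:R * K)); last first.
  by rewrite sumr_const card_ord [leRHS]mulr_natl.
apply: ler_sum => b _.
have -> : block_error j b 0 = word_sum (flatten (map (blk j) (zeta b))) -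
    \sum_(i < size (zeta b)) expm2pi (\sum_(k < i) orbit j 0 (nth b (zeta b) k))
       * word_sum (subst_iter zeta j (nth b (zeta b) i)).
  rewrite 3!mxE subst_iterS_blocks; congr (_ - _); rewrite mxE.
  under eq_bigr do rewrite 2!mxE mulr_suml.
  rewrite (exchange_big_dep xpredT) //=; apply: eq_bigr => i _.
  rewrite (big_pred1 (nth b (zeta b) i)) //=.
apply: (le_trans (word_sum_blocks _ _ _)).
by rewrite ler_wpM2r ?cat_error_ge0 // ler_nat; exact: leq_bigmax.
Qed.

(** Discrete Duhamel formula. The error made at level [k] is transported by the cocycle started at
    time [k + 1], which is why growth has to be controlled from every starting time. *)
Lemma block_sums_expand l : block_sums l =
  spectral_cocycle zeta (const_mx w) l *m block_sums 0 +
  \sum_(k < l) spectral_cocycle zeta (orbit k.+1) (l - k.+1) *m block_error k.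
Proof.
elim: l => [|l IH]; first by rewrite big_ord0 mul1mx addr0.
have -> : block_sums l.+1 = spectral_mx zeta (orbit l) *m block_sums l + block_error l.
  by rewrite addrC /block_error subrK.
rewrite IH mulmxDr mulmxA big_ord_recr /= subnn mul1mx -addrA.
congr (_ + (_ + _)); rewrite mulmx_sumr; apply: eq_bigr => k _.
rewrite mulmxA subSn //; congr (_ *m _) => /=; congr (spectral_mx _ _ *m _).
by rewrite -iterS -iterD subnK.
Qed.

Lemma block_sums_le (A : R) m : 0 <= A ->
  (forall i l, (i + l <= m)%N -> cmx_norm (spectral_cocycle zeta (orbit i) l) <= A) ->
  forall j a, (j <= m)%N -> nc (word_sum (subst_iter zeta j a)) <=
    A * (n.+1%:R * (B + m%:R * (sz%:R * K))).
Proof.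
move=> A0 HA j a jm.
have B0 := phi_bound_ge0.
apply: (@le_trans _ _ (vec_norm (block_sums j))).
  rewrite /vec_norm (bigD1 a) //= mxE lerDl; apply: sumr_ge0 => b _; exact: normc_ge0.
rewrite block_sums_expand (le_trans (vec_normD _ _)) // mulrDr mulrDr lerD //.
  rewrite (le_trans (vec_normM _ _)) // ler_pM ?cmx_norm_ge0 //.
  - by apply: sumr_ge0 => b _; exact: normc_ge0.
  - by apply: (HA 0%N).
  apply: (@le_trans _ _ (\sum_(b < n.+1) B)); last first.
    by rewrite sumr_const card_ord [leRHS]mulr_natl.
  apply: ler_sum => b _; rewrite mxE /word_sum /subst_iter /= big_ord1.
  by rewrite Normc.normcM normc_expm2pi mul1r normc_real.
rewrite (le_trans (vec_norm_sum _ _ _)) //.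
apply: (@le_trans _ _ (\sum_(k < j) A * (n.+1%:R * (sz%:R * K)))).
  apply: ler_sum => k _; rewrite (le_trans (vec_normM _ _)) // ler_pM ?cmx_norm_ge0 //.
  - by apply: sumr_ge0 => b _; exact: normc_ge0.
  - by apply: HA; rewrite subnKC.
  - exact: block_error_le.
have c0 : 0 <= A * (n.+1%:R * (sz%:R * K)) by rewrite !mulr_ge0 // cat_error_ge0.
rewrite sumr_const card_ord -[leLHS]mulr_natl.
apply: (@le_trans _ _ (m%:R * (A * (n.+1%:R * (sz%:R * K))))).
  by rewrite ler_wpM2r // ler_nat.
by rewrite mulrCA [n.+1%:R * (m%:R * _)]mulrCA.
Qed.

End WordSums.

Lemma subword_atD d (x : int -> 'I_d) i k l :
  subword_at x i (k + l) = subword_at x i k ++ subword_at x (i + k%:Z) l.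
Proof.
rewrite /subword_at iotaD map_cat add0n; congr (_ ++ _).
rewrite -[X in iota X l]addn0 iotaDl -map_comp; apply: eq_map => j /=.
by rewrite PoszD addrA.
Qed.

Lemma size_subword_at d (x : int -> 'I_d) i k : size (subword_at x i k) = k.
Proof. by rewrite size_map size_iota. Qed.

Lemma take_drop_subword_at d (x : int -> 'I_d) i k l r : (l <= k)%N ->
  take r (drop l (subword_at x i (k + r))) = subword_at x (i + l%:Z) r.
Proof.
move=> lk; rewrite -(subnKC lk) -addnA subword_atD drop_size_cat ?size_subword_at //.
by rewrite addnC subword_atD take_size_cat ?size_subword_at.
Qed.

Lemma normc_sum_expm2pi (R : realType) N (a : 'I_N -> R) w :
  Normc.normc (\sum_(j < N) expm2pi (j%:R * w) * (a j)%:C%C) ^+ 2 =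
  (\sum_(j < N) a j * cos (2 * pi * w * j%:R)) ^+ 2 +
  (\sum_(j < N) a j * sin (2 * pi * w * j%:R)) ^+ 2.
Proof.
have -> : \sum_(j < N) expm2pi (j%:R * w) * (a j)%:C%C =
  ((\sum_(j < N) a j * cos (2 * pi * w * j%:R)) -i*
   (\sum_(j < N) a j * sin (2 * pi * w * j%:R)))%C.
  elim/big_ind3: _ => [|x1 x2 x3 y1 y2 y3 -> ->|j _].
  - by rewrite oppr0.
  - by apply/eqP; rewrite eq_complex /= opprD !eqxx.
  rewrite /expm2pi; have -> : 2 * pi * (j%:R * w) = 2 * pi * w * j%:R by ring.
  by apply/eqP; rewrite eq_complex /=; apply/andP; split; apply/eqP; ring.
by rewrite /= sqr_sqrtr ?sqrrN // addr_ge0 ?sqr_ge0.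
Qed.

(** One factor [m + 1] comes from the accumulated errors of the Duhamel formula, the other from the
    levels of the prefix decomposition; [C] is uniform in [w], [A], [m] and [x]. *)
Lemma orbit_sum_bound (R : realType) n (zeta : substitution n.+1)
    (phi : seq 'I_n.+1 -> R) (B : R) (r : nat) : (forall u, `|phi u| <= B) ->
  exists2 C, 0 <= C & forall w A m, 1 <= A ->
    (forall i l, (i + l <= m)%N ->
      cmx_norm (spectral_cocycle zeta (iter i (endo_E zeta) (const_mx w)) l) <= A) ->
    forall x i0, subst_space zeta x ->
      Normc.normc (\sum_(j < minlen zeta m)
        expm2pi (j%:R * w) * (phi (subword_at x (i0 + j%:Z) r))%:C%C)
      <= C * (A * m.+1%:R ^+ 2).
Proof.
move=> phiB.
pose K := 2 * B * r%:R; pose sz : R := ((\max_b size (zeta b))%N)%:R.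
pose c1 := n.+1%:R * (B + sz * K).
have B0 : 0 <= B := phi_bound_ge0 phiB.
have K0 : 0 <= K by exact: cat_error_ge0 phiB.
have sz0 : 0 <= sz by [].
have c10 : 0 <= c1 by rewrite mulr_ge0 // addr_ge0 // mulr_ge0.
have szc0 : 0 <= sz * (c1 + K) by rewrite mulr_ge0 // addr_ge0.
exists (4 * c1 + 4 * K + 2 * (sz * (c1 + K))); first by rewrite !addr_ge0 // mulr_ge0.
move=> w A m A1 HA x i0 xX.
have A0 : 0 <= A by lra.
pose M : R := m.+1%:R.
have M1 : 1 <= M by rewrite ler1n.
have mM : m%:R <= M by rewrite ler_nat.
pose X := A * (n.+1%:R * (B + m%:R * (sz * K))).
have XE : X <= A * M * c1.
  rewrite /X /c1 -mulrA ler_wpM2l // [leRHS]mulrCA ler_wpM2l // mulrDr lerD //.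
    by rewrite ler_peMl.
  by rewrite ler_wpM2r // mulr_ge0.
have AM1 : 1 <= A * M by apply: mulr_ege1.
have AMM : A * M <= A * M ^+ 2 by rewrite expr2 mulrA ler_peMr //; lra.
have HX j a : (j <= m)%N -> Normc.normc (word_sum phi r w (subst_iter zeta j a)) <= X.
  by move=> jm; apply: block_sums_le.
have XK : X + K <= A * M * (c1 + K) by rewrite mulrDr lerD // ler_peMl.
have X0 : 0 <= X.
  by rewrite !mulr_ge0 // addr_ge0 // !mulr_ge0.
pose u := subword_at x i0 (minlen zeta m).
have su : size u = minlen zeta m by exact: size_subword_at.
have ule : Normc.normc (word_sum phi r w u) <=
    2 * (X + K) + 2 * (X + m%:R * (sz * (X + K))) + K.
  by apply: (word_sum_language_le phiB HX); [exact: xX | rewrite su].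
have mX : m%:R * (sz * (X + K)) <= A * M ^+ 2 * (sz * (c1 + K)).
  apply: (@le_trans _ _ (M * (sz * (A * M * (c1 + K))))).
    apply: ler_pM => //; first by rewrite mulr_ge0 // addr_ge0.
    by rewrite ler_wpM2l.
  by rewrite le_eqVlt; apply/orP; left; apply/eqP; ring.
have head := word_sum_cat_head r phiB w u (subword_at x (i0 + (minlen zeta m)%:Z) r).
rewrite -subword_atD su in head.
set s := \sum_(i < _) _ in head.
have -> : \sum_(j < minlen zeta m)
    expm2pi (j%:R * w) * (phi (subword_at x (i0 + j%:Z) r))%:C%C = s.
  by apply: eq_bigr => j _; rewrite take_drop_subword_at // ltnW.
rewrite -(subrK (word_sum phi r w u) s) (le_trans (normc_triangle _ _)) //.
apply: (le_trans (lerD head ule)); rewrite -/K -/M.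
have t1 := ler_wpM2r c10 AMM; have t2 := ler_wpM2r K0 AMM.
have t3 : K <= A * M * K by rewrite ler_peMl.
clear -XE t1 t2 t3 mX; move: (X) (A * M ^+ 2) (A * M) (sz * _) (m%:R * _) XE t1 t2 t3 mX.
by clearbody K c1; clear => x0 y z s' q; lra.
Qed.

(** * Twisted sums in L2 *)

Section Koopman.
Variables (R : realType) (m : nat) (mu : probability (shift_space m) R).
Local Notation X := (shift_space m).
Local Notation leb := (@lebesgue_measure R).
Hypothesis mu_inv : forall A : set X, measurable A ->
  mu (shiftn 1 @^-1` A) = mu A.
Implicit Types f g : X -> R.

Lemma shiftnD (j k : int) (x : X) : shiftn j (shiftn k x) = shiftn (j + k) x.
Proof. by apply/funext => i; rewrite /shiftn addrA. Qed.

Lemma shiftn0 (x : X) : shiftn 0 x = x.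
Proof. by apply/funext => i; rewrite /shiftn addr0. Qed.

Lemma subword_at_shiftn (k i : int) l (x : X) :
  subword_at (shiftn k x) i l = subword_at x (i + k) l.
Proof. by apply: eq_map => j; rewrite /shiftn addrAC. Qed.

Lemma measurable_shiftn (k : int) : measurable_fun setT (@shiftn m k).
Proof.
apply: (@measurability _ _ X X setT (@shiftn m k) (@cylinders m)) => //.
move=> _ [_ [i [w ->] <-]]; rewrite setTI; apply: sub_sigma_algebra.
by exists (i + k), w; apply/seteqP; split => x /=; rewrite subword_at_shiftn.
Qed.

Lemma measure_shiftn (k : int) (A : set X) : measurable A ->
  mu (shiftn k @^-1` A) = mu A.
Proof.
have mpre j B : measurable B -> measurable (@shiftn m j @^-1` B).
  by move=> mB; rewrite -[X in measurable X]setTI; exact: measurable_shiftn.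
have nonneg (j : nat) B : measurable B -> mu (shiftn j @^-1` B) = mu B.
  elim: j B => [|j IH] B mB.
    by congr (mu _); apply/seteqP; split => x /=; rewrite shiftn0.
  rewrite -[RHS](IH B mB) -[RHS]mu_inv; last exact: mpre.
  by congr (mu _); apply/seteqP; split => x /=; rewrite shiftnD -PoszD addn1.
case: k => k mA; first exact: nonneg.
rewrite -[LHS](nonneg k.+1); last exact: mpre.
by congr (mu _); apply/seteqP; split => x /=; rewrite shiftnD NegzE addNr shiftn0.
Qed.

Lemma has_integral_shiftn f (k : int) v : has_integral mu setT f v ->
  has_integral mu setT (fun x => f (shiftn k x)) v.
Proof.
move=> [fi fv]; have mk := measurable_shiftn k.
have /integrableP[mf foo] := fi.
have eqP A : measurable A -> pushforward mu (@shiftn m k) A = mu A.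
  by move=> mA; rewrite /pushforward measure_shiftn.
have fTi : mu.-integrable setT (EFin \o (fun x => f (shiftn k x))).
  apply/integrableP; split; first exact: measurableT_comp mf mk.
  move: foo; rewrite -(@eq_measure_integral _ _ _ _ mu (pushforward mu (@shiftn m k))) //.
    by rewrite ge0_integral_pushforward //; exact: measurableT_comp.
  by move=> A mA _; exact: eqP.
split=> //; rewrite -fv.
transitivity (\int[pushforward mu (@shiftn m k)]_x (f x)%:E)%E.
  by rewrite integral_pushforward.
by apply: eq_measure_integral => A mA _; exact: eqP.
Qed.

Definition L2r f := measurable_fun setT f /\
  mu.-integrable setT (EFin \o (fun x => f x ^+ 2)).

Lemma L2r_bounded (f : X -> R) (B : R) : measurable_fun setT f ->
  (forall x, `|f x| <= B) -> L2r f.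
Proof.
move=> mf fB; split => //.
apply: (@le_integrable _ _ _ _ _ measurableT _ (EFin \o cst (B ^+ 2))).
- by apply/measurable_EFinP; exact: measurable_funX.
- move=> x _ /=; rewrite lee_fin !ger0_norm ?sqr_ge0 //.
  by rewrite -(real_normK (num_real (f x))) ler_pXn2r ?nnegrE ?(le_trans _ (fB x)).
- exact: finite_measure_integrable_cst.
Qed.

Lemma L2r_mul_integrable f g : L2r f -> L2r g ->
  mu.-integrable setT (EFin \o (fun x => f x * g x)).
Proof.
move=> [mf fi] [mg gi].
have := integrableD measurableT fi gi; apply: le_integrable => //.
  by apply/measurable_EFinP; exact: measurable_funM.
move=> x _ /=; rewrite lee_fin [leRHS]ger0_norm ?addr_ge0 ?sqr_ge0 //.
by rewrite ler_norml; have := sqr_ge0 (f x - g x); have := sqr_ge0 (f x + g x); nra.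
Qed.

Lemma L2rD f g : L2r f -> L2r g -> L2r (fun x => f x + g x).
Proof.
move=> [mf fi] [mg gi]; split; first exact: measurable_funD.
have fgi := L2r_mul_integrable (conj mf fi) (conj mg gi).
have ii h := @integrable_has_integral _ _ R mu setT measurableT h.
have [+ _] := has_integralD measurableT (has_integralD measurableT (ii _ fi) (ii _ gi))
  (has_integralZ measurableT 2 (ii _ fgi)).
by congr (integrable _ _ _); apply/funext => x /=; congr EFin; ring.
Qed.

Lemma L2rZ (c : R) f : L2r f -> L2r (fun x => c * f x).
Proof.
move=> [mf fi]; split; first exact: measurable_funM.
have [+ _] := has_integralZ measurableT (c ^+ 2) (integrable_has_integral measurableT fi).
by congr (integrable _ _ _); apply/funext => x /=; rewrite exprMn.
Qed.

Lemma L2r_shiftn f (k : int) : L2r f -> L2r (fun x => f (shiftn k x)).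
Proof.
move=> [mf fi]; split; first exact: measurableT_comp mf (measurable_shiftn k).
by have [] := has_integral_shiftn k (integrable_has_integral measurableT fi).
Qed.

Definition autocorr f (j k : nat) : R :=
  Rintegral mu setT (fun x => f (shiftn j x) * f (shiftn k x)).

(* [\int |sum_(j < N) e(- j w) f(T^j x)|^2 dmu(x)]. *)
Definition spectral_energy N f (w : R) : R := \sum_(j < N) \sum_(k < N)
  autocorr f j k * cos (2 * pi * w * j%:R - 2 * pi * w * k%:R).

(** The squared modulus [|S_N f(w, x)|^2] for a real function [f]. *)
Definition twisted N f (w : R) (x : X) : R :=
  (\sum_(j < N) f (shiftn (j : nat) x) * cos (2 * pi * w * j%:R)) ^+ 2 +
  (\sum_(j < N) f (shiftn (j : nat) x) * sin (2 * pi * w * j%:R)) ^+ 2.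

Lemma twisted_ge0 N f w x : 0 <= twisted N f w x.
Proof. by rewrite addr_ge0 ?sqr_ge0. Qed.

Lemma twisted_has_integral N f w : L2r f ->
  has_integral mu setT (twisted N f w) (spectral_energy N f w).
Proof.
move=> fL; apply: (@has_integral_ext _ _ _ _ _
  (fun x => \sum_(j < N) \sum_(k < N) cos (2 * pi * w * j%:R - 2 * pi * w * k%:R) *
    (f (shiftn (j : nat) x) * f (shiftn (k : nat) x)))).
  move=> x; rewrite /twisted !expr2 !mulr_suml -big_split /=; apply: eq_bigr => j _.
  rewrite !mulr_sumr -big_split /=; apply: eq_bigr => k _.
  by rewrite cosB; ring.
apply: has_integral_sum => // j _; apply: has_integral_sum => // k _.
rewrite [autocorr f j k * _]mulrC; apply: has_integralZ => //.
apply: integrable_has_integral => //.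
exact: L2r_mul_integrable (L2r_shiftn j fL) (L2r_shiftn k fL).
Qed.

Lemma spectral_energy_ge0 N f w : L2r f -> 0 <= spectral_energy N f w.
Proof.
move=> fL; apply: (has_integral_ge0 _ (twisted_has_integral N w fL)) => // x.
exact: twisted_ge0.
Qed.

Lemma spectral_energyD N f g w : L2r f -> L2r g ->
  spectral_energy N (fun x => f x + g x) w <= 2 * spectral_energy N f w + 2 * spectral_energy N g w.
Proof.
move=> fL gL.
have H := has_integralD measurableT (has_integralZ measurableT 2 (twisted_has_integral N w fL))
   (has_integralZ measurableT 2 (twisted_has_integral N w gL)).
apply: (has_integral_le _ (twisted_has_integral N w (L2rD fL gL)) H) => // x.
have sq (a b : R) : (a + b) ^+ 2 <= 2 * a ^+ 2 + 2 * b ^+ 2.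
  by have := sqr_ge0 (a - b); rewrite sqrrB sqrrD; lra.
rewrite /twisted; under eq_bigr do rewrite mulrDl.
under [X in _ + X ^+ 2]eq_bigr do rewrite mulrDl.
rewrite !big_split /=; set a1 := \sum_(i < N) _; set a2 := \sum_(i < N) _.
set b1 := \sum_(i < N) _; set b2 := \sum_(i < N) _.
by have := sq a1 a2; have := sq b1 b2; lra.
Qed.

Lemma spectral_energyZ N (c : R) f w : L2r f -> spectral_energy N (fun x => c * f x) w = c ^+ 2 * spectral_energy N f w.
Proof.
move=> fL; have [_ H1] := twisted_has_integral N w (L2rZ c fL).
have [_ H2] := has_integralZ measurableT (c ^+ 2) (twisted_has_integral N w fL).
apply: EFin_inj; rewrite -H1 -H2; apply: eq_integral => x _; congr EFin.
rewrite /twisted; under eq_bigr do rewrite -mulrA.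
under [X in _ + X ^+ 2]eq_bigr do rewrite -mulrA.
by rewrite -!mulr_sumr; ring.
Qed.

Lemma autocorr_diag f v (j : nat) : has_integral mu setT (fun x => f x ^+ 2) v -> autocorr f j j = v.
Proof. by move=> /(has_integral_shiftn j) /has_integral_Rintegral. Qed.

(** The terms of nonzero frequency [j - k] integrate to zero over [w], and the [N] diagonal
    autocorrelations all equal [v] by invariance. *)
Lemma spectral_energy_mean N f v : has_integral mu setT (fun x => f x ^+ 2) v ->
  has_integral leb `[0, 1] (spectral_energy N f) (N%:R * v).
Proof.
move=> fv.
have -> : N%:R * v = \sum_(j < N) \sum_(k < N) autocorr f j k *
    (if (j : nat)%:Z - (k : nat)%:Z == 0 then cos 0 else 0).
  rewrite -[N in LHS]card_ord -sum1_card natr_sum mulr_suml; apply: eq_bigr => j _.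
  rewrite (bigD1 j) //= subrr eqxx cos0 mulr1 mul1r (autocorr_diag _ fv).
  rewrite big1 ?addr0 // => k kj; rewrite subr_eq0 eqz_nat.
  by rewrite eq_sym -val_eqE /= in kj; rewrite (negPf kj) mulr0.
have E : (fun w : R => \sum_(j < N) \sum_(k < N) autocorr f j k *
   cos (2 * pi * ((j : nat)%:Z - (k : nat)%:Z)%:~R * w - 0)) =1 spectral_energy N f.
  move=> w; apply: eq_bigr => j _; apply: eq_bigr => k _.
  by congr (_ * cos _); rewrite intrB; ring.
apply: (@has_integral_ext _ (measurableTypeR R) R leb _ _ _ _ E).
apply: has_integral_sum => // j _; apply: has_integral_sum => // k _.
apply: has_integralZ => //; exact: has_integral_cos.
Qed.

End Koopman.

Lemma poly4_geometric (R : realType) (K q eps : R) : 0 <= K -> 0 < q -> q < 1 -> 0 < eps ->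
  exists k0, forall k, (k0 <= k)%N -> K * k.+1%:R ^+ 4 * q ^+ k <= eps.
Proof.
move=> K0 q0 q1 eps0.
(* [(1 + s)^4 <= 1 + 15 s < q^-1], so [k^4] is beaten by Bernoulli's inequality. *)
have iq1 : 0 < q^-1 - 1 by rewrite subr_gt0 invf_gt1.
pose s := Num.min 1 ((q^-1 - 1) / 16).
have s0 : 0 < s by rewrite lt_min ltr01 divr_gt0.
have s1 : s <= 1 by rewrite ge_min lexx.
have sq : 16 * s <= q^-1 - 1.
  by have : s <= (q^-1 - 1) / 16; [rewrite ge_min lexx orbT | lra].
have bern k : s * k.+1%:R <= (1 + s) ^+ k.
  suff H : 1 + k%:R * s <= (1 + s) ^+ k by apply: le_trans H; rewrite -natr1; nra.
  elim: k => [|k IH]; first by rewrite expr0 mul0r addr0.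
  rewrite exprS -natr1; have k0 : 0 <= k%:R :> R by [].
  have := ler_wpM2l (ltW (ltr_wpDl ler01 s0)) IH.
  have : 0 <= k%:R * s * s by rewrite !mulr_ge0 // ltW.
  rewrite addrC; nra.
pose p := q * (1 + s) ^+ 4.
have p0 : 0 < p by rewrite mulr_gt0 // exprn_gt0 //; lra.
have p1 : p < 1.
  have s4 : (1 + s) ^+ 4 < q^-1.
    have s2 : s ^+ 2 <= s by rewrite expr2 ler_piMl // ltW.
    have s3 : s ^+ 3 <= s by rewrite exprS ler_piMr ?(ltW s0) // exprn_ile1 // ltW.
    have s4 : s ^+ 4 <= s by rewrite exprS ler_piMr ?(ltW s0) // exprn_ile1 // ltW.
    have -> : (1 + s) ^+ 4 = 1 + 4 * s + 6 * s ^+ 2 + 4 * s ^+ 3 + s ^+ 4 by ring.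
    lra.
  by rewrite /p mulrC -ltr_pdivlMr // div1r.
have bound k : K * k.+1%:R ^+ 4 * q ^+ k <= K * s ^- 4 * p ^+ k.
  rewrite -(mulrA K) -(mulrA K) ler_wpM2l // /p exprMn [leRHS]mulrCA [leLHS]mulrC.
  rewrite ler_wpM2l ?exprn_ge0 ?(ltW q0) // [leRHS]mulrC ler_pdivlMr ?exprn_gt0 //.
  by rewrite -exprMn -exprM mulnC exprM ler_pXn2r ?nnegrE ?mulr_ge0 ?exprn_ge0 ?(ltW s0) // 1?mulrC ?bern //; lra.
have : p ^+ k @[k --> \oo] --> (0 : R) by apply: cvg_expr; rewrite gtr0_norm.
pose K' := K * s ^- 4 + 1.
have K'0 : 0 < K' by rewrite ltr_wpDl // mulr_ge0 // invr_ge0 exprn_ge0 // ltW.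
move=> /cvgrPdist_lt /(_ (eps / K')); rewrite divr_gt0 // => /(_ isT) [k0 _ Hk0].
exists k0 => k kk0; apply: (le_trans (bound k)).
have := Hk0 k kk0; rewrite /= sub0r normrN ger0_norm ?exprn_ge0 ?(ltW p0) // => /ltW pk.
have pk0 : 0 <= p ^+ k by rewrite exprn_ge0 // ltW.
apply: (@le_trans _ _ (K' * p ^+ k)); first by rewrite ler_wpM2r // lerDl.
by rewrite mulrC -ler_pdivlMr.
Qed.

(** * Energies of order o(N) outside small sets of frequencies *)

Section Asymptotic.
Variables (R : realType) (m : nat) (mu : probability (shift_space m) R).
Local Notation X := (shift_space m).
Local Notation leb := (@lebesgue_measure R).
Hypothesis mu_inv : forall A : set X, measurable A ->
  mu (shiftn 1 @^-1` A) = mu A.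
Variable Nk : nat -> nat.
Hypothesis Nk0 : forall k, (0 < Nk k)%N.
Implicit Types f g : X -> R.

(** The set [Bad] depends on [k]: in an L2 approximation, Chebyshev's inequality produces a new
    exceptional set at each level. *)
Definition asymp_small f := forall eps, 0 < eps -> exists k0, forall k, (k0 <= k)%N ->
  exists Bad : set R, [/\ measurable Bad, (leb Bad <= eps%:E)%E &
    forall w, 0 <= w <= 1 -> ~ Bad w -> spectral_energy mu (Nk k) f w <= eps * (Nk k)%:R].

Lemma asymp_smallD f g : L2r mu f -> L2r mu g -> asymp_small f -> asymp_small g ->
  asymp_small (fun x => f x + g x).
Proof.
move=> fL gL fs gs eps eps0; have eps4 : 0 < eps / 4 by lra.
have [kf Hf] := fs _ eps4; have [kg Hg] := gs _ eps4.
exists (maxn kf kg) => k; rewrite geq_max => /andP[kkf kkg].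
have [Bf [mBf lBf HBf]] := Hf k kkf; have [Bg [mBg lBg HBg]] := Hg k kkg.
exists (Bf `|` Bg); split; first exact: measurableU.
  apply: (le_trans (measureU2 _ _ _)) => //.
  apply: (le_trans (leeD lBf lBg)); rewrite -EFinD lee_fin; lra.
move=> w w01 /not_orP[wf wg]; apply: (le_trans (spectral_energyD mu_inv _ _ fL gL)).
by have := HBf w w01 wf; have := HBg w w01 wg; lra.
Qed.

Lemma asymp_smallZ (c : R) f : L2r mu f -> asymp_small f ->
  asymp_small (fun x => c * f x).
Proof.
move=> fL fs eps eps0; have c1 : 0 < c ^+ 2 + 1 by rewrite ltr_wpDl // sqr_ge0.
have [k0 Hk0] := fs _ (divr_gt0 eps0 c1); exists k0 => k /Hk0 [Bad [mB lB HB]].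
have le1 : eps / (c ^+ 2 + 1) <= eps.
  by rewrite ler_pdivrMr // ler_peMr ?(ltW eps0) // lerDr sqr_ge0.
exists Bad; split => //; first by apply: (le_trans lB); rewrite lee_fin.
move=> w w01 wB; rewrite (spectral_energyZ mu_inv) //.
apply: (@le_trans _ _ (c ^+ 2 * (eps / (c ^+ 2 + 1) * (Nk k)%:R))).
  by rewrite ler_wpM2l ?sqr_ge0 // HB.
rewrite mulrA ler_wpM2r // mulrCA ler_piMr ?(ltW eps0) //.
by rewrite ler_pdivrMr // mul1r lerDl.
Qed.

(* The mean over [w] of the energy of [f - g] is [N * |f - g|_2^2] by Parseval. *)
Lemma asymp_small_lim f : L2r mu f ->
  (forall del, 0 < del -> exists g v, [/\ L2r mu g, asymp_small g, v <= del &
    has_integral mu setT (fun x => (f x - g x) ^+ 2) v]) ->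
  asymp_small f.
Proof.
move=> fL H eps eps0; have eps4 : 0 < eps / 4 by lra.
(* Markov's inequality at level [eps N / 4] discards measure [4 v / eps <= eps / 2], and the two
   energies of at most [eps N / 4], doubled, add up to [eps N]. *)
have [|g [v [gL gs vle gv]]] := H (eps ^+ 2 / 8); first by rewrite divr_gt0 ?exprn_gt0.
have [k0 Hk0] := gs _ eps4; exists k0 => k /Hk0 [Bad [mB lB HB]].
pose h x := f x - g x.
have hL : L2r mu h.
  by have := L2rD fL (L2rZ (-1) gL); congr L2r; apply/funext => x; rewrite mulN1r.
have N0 : 0 < (Nk k)%:R :> R by rewrite ltr0n.
have hmean := spectral_energy_mean mu_inv (Nk k) gv.
have th0 : 0 < eps / 4 * (Nk k)%:R by rewrite mulr_gt0.
have mk := @has_integral_markov _ (measurableTypeR R) R leb _ (measurable_itv `[0, 1]) _ _ _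
  hmean (fun w => spectral_energy_ge0 mu_inv (Nk k) w hL) th0.
pose Bad2 : set R := `[0, 1]%classic `&` [set w | eps / 4 * (Nk k)%:R <= spectral_energy mu (Nk k) h w].
have mB2 : measurable Bad2.
  have [/integrableP[mh _] _] := hmean; have /measurable_EFinP {}mh := mh.
  have := mh (measurable_itv _) _ (measurable_itv `[eps / 4 * (Nk k)%:R, +oo[).
  by rewrite preimage_itvcy.
exists (Bad `|` Bad2); split; first exact: measurableU.
  apply: (le_trans (measureU2 _ _ _)) => //.
  apply: (le_trans (leeD lB mk)); rewrite -EFinD lee_fin.
  have -> : (Nk k)%:R * v / (eps / 4 * (Nk k)%:R) = 4 * v / eps.
    by field; rewrite !gt_eqF.
  have : 4 * v / eps <= eps / 2; last by lra.
  by rewrite ler_pdivrMr //; have := vle; rewrite expr2; lra.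
move=> w w01 /not_orP[wB wB2].
have hw : spectral_energy mu (Nk k) h w < eps / 4 * (Nk k)%:R.
  by rewrite ltNge; apply/negP => hw; apply: wB2; split => //=; rewrite in_itv.
have -> : f = (fun x => g x + h x) by apply/funext => x; rewrite /h addrC subrK.
apply: (le_trans (spectral_energyD mu_inv _ _ gL hL)).
by have := HB w w01 wB; lra.
Qed.

End Asymptotic.

(** * Functions of finitely many coordinates *)

Section LocalFunctions.
Variables (R : realType) (n : nat) (zeta : substitution n.+2).
Variable mu : probability (shift_space n.+1) R.
Local Notation X := (shift_space n.+1).
Local Notation leb := (@lebesgue_measure R).
Local Notation d := n.+2.

Lemma measurable_local (P : set (seq 'I_d)) (i : int) r :
  measurable ([set x | P (subword_at x i r)] : set X).
Proof.
have -> : [set x | P (subword_at x i r)] =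
    \bigcup_(u in [set u : r.-tuple 'I_d | P u]) ([set x | subword_at x i r = u] : set X).
  apply/seteqP; split => x /=; last by case=> u Pu ->.
  move=> Px; have su : size (subword_at x i r) == r by rewrite size_subword_at.
  by exists (Tuple su).
apply: fin_bigcup_measurable; first exact: finite_finset.
move=> u _; apply: sub_sigma_algebra; exists i, u.
by apply/seteqP; split => x /=; rewrite size_tuple.
Qed.

Lemma measurable_local_fun (phi : seq 'I_d -> R) (i : int) r :
  measurable_fun setT (fun x : X => phi (subword_at x i r)).
Proof.
move=> _ Y mY; rewrite setTI; exact: (measurable_local (phi @^-1` Y)).
Qed.

Hypothesis zeta_ne : subst_nonempty zeta.
Hypothesis zeta_prim : subst_primitive zeta.
Hypothesis zeta_irr :
  irreducible_poly (char_poly (map_mx (fun z : int => z%:~R : rat) (subst_mx zeta))).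
Hypothesis mu_full : mu.-negligible (~` (subst_space zeta : set X)).

Lemma local_asymp_small (chi : \bar R) (theta : R) (phi : seq 'I_d -> R) (B : R) (i0 : int) r :
  (forall u, `|phi u| <= B) ->
  PF_eigenvalue (subst_mx zeta) theta ->
  top_lyapunov zeta chi -> (chi < (ln theta / 2)%:E)%E ->
  (forall A : set X, measurable A -> mu (shiftn 1 @^-1` A) = mu A) ->
  asymp_small mu (minlen zeta) (fun x => phi (subword_at x i0 r)).
Proof.
move=> phiB PF chiP chith mu_inv.
have [G [c [G1 thG c0 HG]]] := minlen_growth zeta_ne zeta_prim PF.
have G0 : 0 < G by lra.
have sqr4 (a b x y : R) : (a * (b * x * y ^+ 2)) ^+ 2 = (a * b) ^+ 2 * y ^+ 4 * x ^+ 2 by ring.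
have th0 : 0 < theta by case: PF.
have chiG : (chi < (ln G / 2)%:E)%E.
  by apply: (lt_le_trans chith); rewrite lee_fin ler_pM2r // ler_ln // posrE.
have [rho [rho1 rhoG Hrho]] := cocycle_growth zeta_ne zeta_prim zeta_irr chiP G1 chiG.
have [C C0 HC] := orbit_sum_bound zeta r phiB.
have fL : L2r mu (fun x => phi (subword_at x i0 r)).
  by apply: (@L2r_bounded _ _ _ _ B) => //; exact: measurable_local_fun.
move=> eps eps0; have [A [k1 [A0 Hk1]]] := Hrho eps eps0.
have rho0 : 0 < rho by lra.
(* [T ^+ 2] is a constant times [(k + 1)^4 q^k G^k], while [minlen zeta k >= c G^k], so [q < 1]
   beats the polynomial loss. [A + 1] replaces [A] because the bound on orbit sums asks for a
   constant at least [1]. *)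
pose q := rho ^+ 2 / G.
have q0 : 0 < q by rewrite divr_gt0 // exprn_gt0.
have q1 : q < 1 by rewrite ltr_pdivrMr // mul1r.
have [k2 Hk2] := @poly4_geometric R ((C * (A + 1)) ^+ 2) q (eps * c)
  (sqr_ge0 _) q0 q1 (mulr_gt0 eps0 c0).
exists (maxn k1 k2) => k; rewrite geq_max => /andP[/Hk1 [Bad [mB lB HB]] /Hk2 kpoly].
exists Bad; split=> // w w01 wB.
pose T := C * ((A + 1) * rho ^+ k * k.+1%:R ^+ 2).
have T0 : 0 <= T by rewrite !mulr_ge0 ?exprn_ge0 //; lra.
have bound x : subst_space zeta x ->
    twisted (minlen zeta k) (fun x => phi (subword_at x i0 r)) w x <= T ^+ 2.
  move=> xX; rewrite /twisted -(normc_sum_expm2pi (fun j : 'I_(minlen zeta k) => phi (subword_at (shiftn (j : nat) x) i0 r))).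
  rewrite ler_pXn2r ?nnegrE ?normc_ge0 //.
  under eq_bigr do rewrite subword_at_shiftn.
  apply: HC => //.
    by rewrite mulr_ege1 // ?exprn_ege1 //; lra.
  move=> i l il; apply: (le_trans (HB w w01 wB i l il)).
  by rewrite ler_wpM2r ?exprn_ge0 ?(ltW rho0) //; lra.
have GT : spectral_energy mu (minlen zeta k) (fun x => phi (subword_at x i0 r)) w <= T ^+ 2.
  have [ti tE] := twisted_has_integral mu_inv (minlen zeta k) w fL.
  have /integrableP[mt _] := ti.
  rewrite -lee_fin -tE.
  have -> : ((T ^+ 2)%:E = \int[mu]_x (cst (T ^+ 2)%:E x))%E.
    rewrite integral_cst // -[LHS]mule1; congr (_ * _)%E.
    by apply/esym; exact: probability_setT.
  (* The pointwise bound holds on the substitution space, hence almost everywhere. *)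
  apply: ae_ge0_le_integral => //.
  - by move=> x _; rewrite lee_fin twisted_ge0.
  - by move=> x _; rewrite lee_fin sqr_ge0.
  case: mu_full => Z [mZ Z0 ZX]; exists Z; split => // x /= Hx; apply: ZX => /= xX.
  by apply: Hx => _; rewrite lee_fin bound.
apply: (le_trans GT).
have : eps * (c * G ^+ k) <= eps * (minlen zeta k)%:R by rewrite ler_wpM2l ?HG // ltW.
apply: le_trans.
have -> : T ^+ 2 = (C * (A + 1)) ^+ 2 * k.+1%:R ^+ 4 * q ^+ k * G ^+ k.
  by rewrite -[RHS]mulrA -exprMn divfK ?gt_eqF // -exprM mulnC exprM /T sqr4.
by rewrite [leRHS]mulrA ler_pM2r // exprn_gt0.
Qed.

End LocalFunctions.

(** * Approximation of measurable sets by finite-coordinate sets *)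

Section FiniteCoordinates.
Variables (R : realType) (m : nat) (mu : probability (shift_space m) R).
Local Notation X := (shift_space m).
Implicit Types A B : set X.

Definition finite_coord A := exists M : nat, forall x y : X,
  (forall j : int, (`|j| <= M)%N -> x j = y j) -> A x -> A y.

(** The symmetric difference, phrased through equivalence so that inclusions between such sets
    become propositional tautologies. *)
Definition neq_set A B : set X := [set x | ~ (A x <-> B x)].

Definition approximable A := measurable A /\ forall eps : R, 0 < eps ->
  exists B, [/\ finite_coord B, measurable B & (mu (neq_set A B) <= eps%:E)%E].

Lemma measurable_neq_set A B : measurable A -> measurable B -> measurable (neq_set A B).
Proof.
move=> mA mB; have -> : neq_set A B = (A `\` B) `|` (B `\` A).
  apply/seteqP; split => x /=; rewrite /neq_set /=; last by tauto.
  by have [a|a] := pselect (A x); have [b|b] := pselect (B x); tauto.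
by apply: measurableU; apply: measurableD.
Qed.

Lemma finite_coord_subword A : finite_coord A -> exists M : nat,
  exists P : set (seq 'I_m.+1),
    A = [set x | P (subword_at x (- M%:Z) (M + M).+1)].
Proof.
move=> [M HM]; exists M, [set u | exists2 x, A x & subword_at x (- M%:Z) (M + M).+1 = u].
apply/seteqP; split => [x Ax|x [y Ay E]]; first by exists x.
apply: HM Ay => j jM; have jM' : (- M%:Z <= j <= M%:Z) by lia.
have [k kE kM] : exists2 k : nat, j = - M%:Z + k%:Z & (k < (M + M).+1)%N.
  by exists (absz (j + M%:Z)); lia.
have := congr1 (fun u => nth ord0 u k) E.
by rewrite !(nth_map 0%N) ?size_iota // !nth_iota // add0n kE.
Qed.

Lemma finite_coordC A : finite_coord A -> finite_coord (~` A).
Proof.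
by move=> [M HM]; exists M => x y xy nA Ay; apply: nA; apply: HM Ay => j /xy.
Qed.

Lemma finite_coordU A B : finite_coord A -> finite_coord B -> finite_coord (A `|` B).
Proof.
move=> [M HM] [N HN]; exists (maxn M N) => x y xy [Ax|Bx]; [left|right].
  by apply: HM Ax => j jM; apply: xy; rewrite leq_max jM.
by apply: HN Bx => j jM; apply: xy; rewrite leq_max jM orbT.
Qed.

Lemma approximable_cylinder A : cylinders A -> approximable A.
Proof.
move=> Ac; have mA : measurable A by apply: sub_sigma_algebra.
split => // eps eps0; exists A; split => //.
  case: Ac => i [w ->]; exists (`|i| + size w)%N => x y xy /= E.
  rewrite -[RHS]E /subword_at; apply/eq_in_map => k; rewrite mem_iota /= add0n => kw.
  by apply/esym/xy; lia.
rewrite (_ : neq_set A A = set0) ?measure0 ?lee_fin ?ltW //.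
by apply/seteqP; split => x //=; rewrite /neq_set /=; tauto.
Qed.

Lemma approximableC A : approximable A -> approximable (~` A).
Proof.
move=> [mA HA]; split; first exact: measurableC.
move=> eps /HA [B [fB mB AB]]; exists (~` B); split.
- exact: finite_coordC.
- exact: measurableC.
rewrite (_ : neq_set _ _ = neq_set A B) //; apply/seteqP; rewrite /neq_set.
by split => x /=; have := pselect (A x); have := pselect (B x); tauto.
Qed.

Lemma measure_subset_neq_setU_le A B C D eps del : measurable A -> measurable B -> measurable C ->
  measurable D -> (mu (neq_set A B) <= eps%:E)%E -> (mu (neq_set C D) <= del%:E)%E ->
  forall E, measurable E -> E `<=` neq_set A B `|` neq_set C D ->
  (mu E <= (eps + del)%:E)%E.
Proof.
move=> mA mB mC mD AB CD E mE sub.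
have mAB := measurable_neq_set mA mB; have mCD := measurable_neq_set mC mD.
apply: (@le_trans _ _ (mu (neq_set A B `|` neq_set C D))).
  by apply: le_measure; rewrite ?inE //; exact: measurableU.
by apply: (le_trans (measureU2 _ mAB mCD)); rewrite EFinD leeD.
Qed.

Lemma approximableU A B : approximable A -> approximable B -> approximable (A `|` B).
Proof.
move=> [mA HA] [mB HB]; split; first exact: measurableU.
move=> eps eps0; have eps2 : 0 < eps / 2 by lra.
have [A' [fA mA' AA]] := HA _ eps2; have [B' [fB mB' BB]] := HB _ eps2.
exists (A' `|` B'); split; [exact: finite_coordU | exact: measurableU |].
have -> : eps = eps / 2 + eps / 2 by lra.
apply: (measure_subset_neq_setU_le mA mA' mB mB' AA BB).
  by apply: measurable_neq_set; apply: measurableU.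
move=> x; rewrite /neq_set /=.
have := pselect (A x); have := pselect (B x); have := pselect (A' x).
by have := pselect (B' x); tauto.
Qed.

(** The union exceeds its finite stages by sets decreasing to the empty set, whose measures tend to
    zero; a late finite stage is then approximated. *)
Lemma approximable_bigcup (A : nat -> set X) : (forall k, approximable (A k)) ->
  approximable (\bigcup_k A k).
Proof.
move=> HA; have mA : measurable (\bigcup_k A k).
  by apply: bigcup_measurable => k _; case: (HA k).
split=> // eps eps0; have eps2 : 0 < eps / 2 by lra.
pose U n := \big[setU/set0]_(k < n) A k.
have apU n : approximable (U n).
  rewrite /U; elim: n => [|n IH]; last by rewrite big_ord_recr; apply: approximableU.
  rewrite big_ord0; split => // e e0; exists set0; split => //.
    by exists 0%N.
  rewrite (_ : neq_set _ _ = set0) ?measure0 ?lee_fin ?ltW //.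
  by apply/seteqP; split => x //=; rewrite /neq_set /=; tauto.
have mU n : measurable (U n) by case: (apU n).
pose C n := \bigcup_k A k `\` U n.
have UE n x : U n x <-> exists2 k, (k < n)%N & A k x.
  by rewrite /U -bigcup_mkord; split=> [[k /= kn Ak]|[k kn Ak]]; exists k.
have capC : \bigcap_n C n = set0.
  apply/seteqP; split => x //= Hx; have [[k _ Ak] _] := Hx 0%N I.
  by have [_] := Hx k.+1 I; apply; apply/UE; exists k.
have Ccvg : mu \o C @ \oo --> mu (\bigcap_n C n).
  apply: nonincreasing_cvg_mu.
  - by apply: (le_lt_trans (probability_le1 _ _)); rewrite ?ltry //; exact: measurableD.
  - by move=> n; exact: measurableD.
  - by rewrite capC.
  - move=> i j ij; apply/subsetPset => x [Ax nU]; split => // /UE [k ki Ak].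
    by apply: nU; apply/UE; exists k => //; apply: leq_trans ij.
rewrite capC measure0 in Ccvg.
have lt0 : (0 < (eps / 2)%:E)%E by rewrite lte_fin.
have [n _ /(_ n (leqnn n)) /= Hn] := Ccvg _ (open_ereal_lt' lt0).
have [_ /(_ _ eps2) [B [fB mB UB]]] := apU n.
exists B; split => //; have -> : eps = eps / 2 + eps / 2 by lra.
have CE : neq_set (\bigcup_k A k) (U n) = C n.
  apply/seteqP; split => x; rewrite /neq_set /C /=; last by move=> [a b] H; tauto.
  have sub : U n x -> (\bigcup_k A k) x by move=> /UE [k _ Ak]; exists k.
  have := pselect ((\bigcup_k A k) x); have := pselect (U n x); tauto.
have AU : (mu (neq_set (\bigcup_k A k) (U n)) <= (eps / 2)%:E)%E by rewrite CE ltW.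
apply: (measure_subset_neq_setU_le mA (mU n) (mU n) mB AU UB); first exact: measurable_neq_set.
move=> x; rewrite /neq_set /=.
have := pselect ((\bigcup_k A k) x); have := pselect (U n x).
by have := pselect (B x); tauto.
Qed.

Lemma measurable_approximable A : measurable A -> approximable A.
Proof.
move: A; apply: smallest_sub; last by move=> A; exact: approximable_cylinder.
split.
- split => // e e0; exists set0; split => //; first by exists 0%N.
  rewrite (_ : neq_set _ _ = set0) ?measure0 ?lee_fin ?ltW //.
  by apply/seteqP; split => x //=; rewrite /neq_set /=; tauto.
- by move=> A; rewrite setTD; exact: approximableC.
- exact: approximable_bigcup.
Qed.

End FiniteCoordinates.

(** * From local functions to all of L2 *)

Section L2Closure.
Variables (R : realType) (m : nat) (mu : probability (shift_space m) R).
Local Notation X := (shift_space m).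
Hypothesis mu_inv : forall A : set X, measurable A ->
  mu (shiftn 1 @^-1` A) = mu A.
Variable Nk : nat -> nat.
Hypothesis Nk0 : forall k, (0 < Nk k)%N.
Hypothesis local_small : forall (phi : seq 'I_m.+1 -> R) (B : R) (i : int) r,
  (forall u, `|phi u| <= B) ->
  asymp_small mu Nk (fun x => phi (subword_at x i r)).
Implicit Types f g : X -> R.

Lemma L2r_indic (A : set X) : measurable A -> L2r mu (\1_A : X -> R).
Proof.
move=> mA; have mi : measurable_fun setT (\1_A : X -> R) by exact: measurable_indic.
apply: (@L2r_bounded _ _ _ _ 1 mi).
by move=> x; rewrite indicE; case: (_ \in _); rewrite ?normr1 ?normr0.
Qed.

Lemma indic_asymp_small (A : set X) : measurable A -> asymp_small mu Nk (\1_A : X -> R).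
Proof.
move=> mA; apply: asymp_small_lim => //; first exact: L2r_indic.
move=> del del0; have [_ /(_ _ del0) [B [fB mB AB]]] := measurable_approximable mu mA.
have mAB := measurable_neq_set mA mB.
exists (\1_B : X -> R), (fine (mu (neq_set A B))); split.
- exact: L2r_indic.
- have [M [P BE]] := finite_coord_subword fB.
  have := @local_small (\1_P : _ -> R) 1 (- M%:Z) (M + M).+1.
  rewrite (_ : (fun x => _) = \1_B).
    by apply => u; rewrite indicE; case: (_ \in _); rewrite ?normr1 ?normr0.
  by apply/funext => x; rewrite !indicE BE.
- by move: AB; rewrite -[leLHS]fineK ?fin_num_measure // lee_fin.
have E : (\1_(neq_set A B) : X -> R) =1 (fun x => (\1_A x - \1_B x) ^+ 2).
  move=> x; rewrite !indicE.
  have [Ax|Ax] := pselect (A x); have [Bx|Bx] := pselect (B x).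
  - rewrite (mem_set Ax) (mem_set Bx) memNset ?subrr ?expr0n //.
    by rewrite /neq_set /=; tauto.
  - by rewrite (mem_set Ax) (memNset Bx) mem_set ?subr0 ?expr1n // => -[]; tauto.
  - by rewrite (mem_set Bx) (memNset Ax) mem_set ?sub0r ?sqrrN ?expr1n // => -[]; tauto.
  - rewrite (memNset Ax) (memNset Bx) memNset ?subrr ?expr0n //.
    by rewrite /neq_set /=; tauto.
apply: (has_integral_ext E); split.
  exact: integrable_indic.
by rewrite integral_indic // setIT fineK // fin_num_measure.
Qed.

Lemma asymp_small_sum (I : Type) (s : seq I) (c : I -> R) (A : I -> set X) :
  (forall i, measurable (A i)) ->
  L2r mu (fun x => \sum_(i <- s) c i * \1_(A i) x) /\
  asymp_small mu Nk (fun x => \sum_(i <- s) c i * \1_(A i) x).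
Proof.
move=> mA; elim: s => [|i s [IH1 IH2]].
  rewrite (_ : (fun x => _) = (fun x => 0 * \1_setT x)).
    split; first by apply: L2rZ; exact: L2r_indic.
    apply: asymp_smallZ => //; [exact: L2r_indic | exact: indic_asymp_small].
  by apply/funext => x; rewrite big_nil mul0r.
rewrite (_ : (fun x => _) = (fun x => c i * \1_(A i) x + \sum_(i <- s) c i * \1_(A i) x)).
  have iL := L2rZ (c i) (L2r_indic (mA i)).
  split; first exact: L2rD.
  apply: asymp_smallD => //; apply: asymp_smallZ => //; first exact: L2r_indic.
  exact: indic_asymp_small.
by apply/funext => x; rewrite big_cons.
Qed.

Lemma L2r_tail f del : L2r mu f -> 0 < del -> exists K : nat, exists v, [/\ (0 < K)%N, v <= del,
  K%:R^-1 <= del & has_integral mu setT (fun x => if `|f x| <= K%:R then 0 else f x ^+ 2) v].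
Proof.
move=> [mf fi] del0.
pose h (K : nat) x := if `|f x| <= K%:R then 0 else f x ^+ 2.
have mh K : measurable_fun setT (h K).
  apply: measurable_fun_ifT => //; last exact: measurable_funX.
  by apply: measurable_fun_ler => //; exact: measurableT_comp.
have hle K x : `|h K x| <= f x ^+ 2.
  by rewrite /h; case: ifP => _; rewrite ?normr0 ?sqr_ge0 // ger0_norm ?sqr_ge0.
have hcvg x : EFin \o (fun K => h K x) @ \oo --> 0%E.
  apply: cvg_near_cst; exists (Num.bound `|f x|) => // K /= kK.
  rewrite /h (le_trans (ltW (archi_boundP _))) //; first by rewrite ler_nat.
have [_ _] := @dominated_convergence _ _ _ mu setT measurableT
  (fun K => EFin \o h K) (cst 0%E) (EFin \o (fun x => f x ^+ 2))
  (fun K => (measurable_EFinP _ _).2 (mh K)) (measurable_cst _)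
  (aeW _ (fun x _ => hcvg x)) fi (aeW _ (fun x K _ => hle K x)).
rewrite integral0 => cvg0.
have lt0 : (0 < del%:E)%E by rewrite lte_fin.
have [k0 _ Hk0] := cvg0 _ (open_ereal_lt' lt0).
pose K := (maxn k0 (Num.bound del^-1)).+1.
have hi : mu.-integrable setT (EFin \o h K).
  apply: le_integrable fi => //; first by apply/measurable_EFinP.
  by move=> x _ /=; rewrite lee_fin [leRHS]ger0_norm ?sqr_ge0.
exists K, (Rintegral mu setT (h K)); split => //.
- have [_ E] := integrable_has_integral measurableT hi.
  rewrite -lee_fin -E ltW //; apply: (Hk0 K).
  by rewrite /= /K leqW // leq_maxl.
- rewrite -[leRHS]invrK lef_pV2 ?posrE ?invr_gt0 ?ltr0n //.
  apply: le_trans (ltW (archi_boundP _)) _; first by rewrite invr_ge0 ltW.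
  by rewrite ler_nat leqW // leq_maxr.
- exact: integrable_has_integral.
Qed.

Lemma L2r_asymp_small f : L2r mu f -> asymp_small mu Nk f.
Proof.
move=> fL; apply: asymp_small_lim => // del del0.
have [mf fi] := fL.
have e0 : 0 < Num.min (del / 2) 1 by rewrite lt_min ltr01 andbT; lra.
have [K [v [K0 vle Kdel tail]]] := L2r_tail fL e0.
have [vdel Kdel2 K1] : [/\ v <= del / 2, K%:R^-1 <= del / 2 & K%:R^-1 <= 1 :> R].
  by move: vle Kdel; rewrite !le_min => /andP[-> _] /andP[-> ->].
have K0' : 0 < K%:R :> R by rewrite ltr0n.
(* On [|f| <= K] the values of [u] lie in [[0, 2 K^2]], and rounding [u] down amounts to rounding
   [f] down to a multiple of [1 / K]; the last index serves the value [2 K^2]. Elsewhere [g] is [0]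
   and the tail estimate takes over. *)
pose u x := K%:R * f x + K%:R ^+ 2.
pose A (k : 'I_(K ^ 2 + K ^ 2).+1) : set X :=
  [set x | `|f x| <= K%:R] `&` [set x | k%:R <= u x < k.+1%:R].
pose c (k : 'I_(K ^ 2 + K ^ 2).+1) : R := (k%:R - K%:R ^+ 2) / K%:R.
have mu_ : measurable_fun setT u.
  by apply: measurable_funD => //; apply: measurable_funM.
have mA k : measurable (A k).
  apply: measurableI.
    have -> : [set x | `|f x| <= K%:R] = f @^-1` `[- K%:R, K%:R].
      by apply/seteqP; split => x; rewrite /= in_itv /= ler_norml.
    by rewrite -[X in measurable X]setTI; apply: mf => //; exact: measurable_itv.
  have -> : [set x | k%:R <= u x < k.+1%:R] = u @^-1` `[k%:R, k.+1%:R[.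
    by apply/seteqP; split => x; rewrite /= in_itv.
  by rewrite -[X in measurable X]setTI; apply: mu_ => //; exact: measurable_itv.
pose g x := \sum_(k <- index_enum 'I_(K ^ 2 + K ^ 2).+1) c k * \1_(A k) x.
have [gL gs] := asymp_small_sum (index_enum _) c mA.
have gE x : `|f x| <= K%:R -> `|f x - g x| <= K%:R^-1.
  move=> fx; have u0 : 0 <= u x.
    by rewrite /u expr2 -mulrDr mulr_ge0 // ?(ltW K0') //; move: fx; rewrite ler_norml; lra.
  have uK : u x <= (K ^ 2 + K ^ 2)%:R.
    rewrite natrD natrX /u lerD2r expr2 ler_wpM2l ?(ltW K0') //.
    exact: le_trans (ler_norm _) fx.
  have /andP[t1 t2] := truncn_itv u0.
  have tlt : (Num.truncn (u x) < (K ^ 2 + K ^ 2).+1)%N.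
    by rewrite ltnS -(ler_nat R) (le_trans t1).
  have -> : g x = c (Ordinal tlt).
    rewrite /g (bigD1 (Ordinal tlt)) //= indicE mem_set ?mulr1; last by split; rewrite //= t1 t2.
    rewrite big1 ?addr0 // => k kt; rewrite indicE memNset ?mulr0 // => -[_ /= /andP[k1 k2]].
    move/negP: kt; apply; apply/eqP/val_inj => /=.
    have := le_lt_trans k1 t2; have := le_lt_trans t1 k2.
    by rewrite !ltr_nat !ltnS => a b; apply/eqP; rewrite eqn_leq a b.
  have -> : f x - c (Ordinal tlt) = (u x - (Num.truncn (u x))%:R) / K%:R.
    by rewrite /c /u /=; field; rewrite gt_eqF.
  rewrite normrM [X in _ * X]gtr0_norm ?invr_gt0 // ler_piMl ?invr_ge0 ?(ltW K0') //.
  by rewrite ger0_norm; move: t2; rewrite -natr1; lra.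
have gE' x : ~~ (`|f x| <= K%:R) -> g x = 0.
  move=> fx; rewrite /g big1 // => k _; rewrite indicE memNset ?mulr0 // => -[/= fx' _].
  by rewrite fx' in fx.
have hL : L2r mu (fun x => f x - g x).
  by have := L2rD fL (L2rZ (-1) gL); congr L2r; apply/funext => x; rewrite mulN1r.
have hi := integrable_has_integral measurableT hL.2.
exists g, (Rintegral mu setT (fun x => (f x - g x) ^+ 2)); split => //.
have cst1 : has_integral mu setT (fun=> K%:R ^- 2) (K%:R ^- 2).
  split; first exact: finite_measure_integrable_cst.
  rewrite (_ : (fun=> _) = cst (K%:R ^- 2)%:E) // integral_cst // -[RHS]mule1.
  by congr (_ * _)%E; exact: probability_setT.
have := has_integral_le measurableT hi (has_integralD measurableT cst1 tail).
have K2 : K%:R ^- 2 <= del / 2 :> R.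
  by rewrite -exprVn expr2 (le_trans _ Kdel2) // ler_piMl // invr_ge0 ltW.
move=> H; apply: (le_trans (H _)); last by lra.
move=> x; case: ifP => [fx|/negbT fx].
  rewrite addr0 -exprVn -(real_normK (num_real (f x - g x))) ler_pXn2r ?nnegrE ?invr_ge0 ?(ltW K0') //.
  exact: gE.
by rewrite gE' // subr0 lerDr invr_ge0 exprn_ge0 // ltW.
Qed.

End L2Closure.

(** * Singularity of the spectral measures *)

Section SpectralMeasure.
Variables (R : realType) (m : nat) (mu : probability (shift_space m) R).
Local Notation X := (shift_space m).
Local Notation Rm := (measurableTypeR R).
Local Notation leb := (@lebesgue_measure R).
Hypothesis mu_inv : forall A : set X, measurable A ->
  mu (shiftn 1 @^-1` A) = mu A.
Variables (fr fi : X -> R) (sigma : {measure set Rm -> \bar R}).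
Hypothesis frL : L2r mu fr.
Hypothesis fiL : L2r mu fi.
Hypothesis sigma_f : spectral_measure_of mu fr fi sigma.

Lemma spectral_measure_integrable (h : R -> R) : continuous h ->
  (forall t, `|h t| <= 1) -> sigma.-integrable setT (EFin \o h).
Proof.
move=> ch h1; have [sfin _ _] := sigma_f.
have c1 : sigma.-integrable setT (EFin \o cst (1 : R)).
  apply/integrableP; split; first by apply/measurable_EFinP; exact: measurable_cst.
  rewrite (eq_integral (cst 1%E)); last by move=> t _; rewrite /= normr1.
  by rewrite integral_cst // mul1e.
apply: le_integrable c1 => //.
  by apply/measurable_EFinP; exact: continuous_measurable_fun.
by move=> t _ /=; rewrite lee_fin normr1.
Qed.

Lemma continuous_cos_lin (a b : R) : continuous (fun t : R => cos (a * t - b)).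
Proof.
move=> t; apply: (@continuous_comp _ _ _ (fun t : R => a * t - b) cos).
  apply: continuousB; last exact: cst_continuous.
  by apply: continuousM; [exact: cst_continuous | exact: cvg_id].
exact: continuous_cos.
Qed.

Let C (z : int) := Rintegral sigma setT (fun t => cos (2 * pi * z%:~R * t)).
Let S (z : int) := Rintegral sigma setT (fun t => sin (2 * pi * z%:~R * t)).

Lemma fourier_cos z : has_integral sigma setT (fun t => cos (2 * pi * z%:~R * t)) (C z).
Proof.
apply: integrable_has_integral => //; apply: spectral_measure_integrable; last first.
  by move=> t; exact: cos_max.
by have := @continuous_cos_lin (2 * pi * z%:~R) 0; under eq_fun do rewrite subr0.
Qed.

Lemma fourier_sin z : has_integral sigma setT (fun t => sin (2 * pi * z%:~R * t)) (S z).
Proof.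
apply: integrable_has_integral => //; apply: spectral_measure_integrable; last first.
  by move=> t; exact: sin_max.
have := @continuous_cos_lin (2 * pi * z%:~R) (pi / 2).
by under eq_fun do rewrite cosBpihalf.
Qed.

Lemma correlation_cos (j k : nat) : has_integral mu setT
  (fun x => fr (shiftn j x) * fr (shiftn k x) + fi (shiftn j x) * fi (shiftn k x))
  (C (j%:Z - k%:Z)).
Proof.
have [_ _ /(_ (j%:Z - k%:Z)) [E _]] := sigma_f.
pose h x := fr (shiftn (j%:Z - k%:Z) x) * fr x + fi (shiftn (j%:Z - k%:Z) x) * fi x.
have E0 : (fun x => h (shiftn k x)) =1 fun x => fr (shiftn j x) * fr (shiftn k x) + fi (shiftn j x) * fi (shiftn k x).
  by move=> x; rewrite /h shiftnD subrK.
apply: (has_integral_ext E0); apply: (has_integral_shiftn mu_inv (f := h)).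
rewrite /C E; apply: integrable_has_integral => //.
have i1 := L2r_mul_integrable (L2r_shiftn mu_inv (j%:Z - k%:Z) frL) frL.
have i2 := L2r_mul_integrable (L2r_shiftn mu_inv (j%:Z - k%:Z) fiL) fiL.
by have [] := has_integralD measurableT (integrable_has_integral measurableT i1)
  (integrable_has_integral measurableT i2).
Qed.

Lemma correlation_sin (j k : nat) : has_integral mu setT
  (fun x => fi (shiftn j x) * fr (shiftn k x) - fr (shiftn j x) * fi (shiftn k x))
  (S (j%:Z - k%:Z)).
Proof.
have [_ _ /(_ (j%:Z - k%:Z)) [_ E]] := sigma_f.
pose h x := fi (shiftn (j%:Z - k%:Z) x) * fr x - fr (shiftn (j%:Z - k%:Z) x) * fi x.
have E0 : (fun x => h (shiftn k x)) =1 fun x => fi (shiftn j x) * fr (shiftn k x) - fr (shiftn j x) * fi (shiftn k x).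
  by move=> x; rewrite /h shiftnD subrK.
apply: (has_integral_ext E0); apply: (has_integral_shiftn mu_inv (f := h)).
rewrite /S E; apply: integrable_has_integral => //.
have i1 := L2r_mul_integrable (L2r_shiftn mu_inv (j%:Z - k%:Z) fiL) frL.
have i2 := L2r_mul_integrable (L2r_shiftn mu_inv (j%:Z - k%:Z) frL) fiL.
have [+ _] := has_integralD measurableT (integrable_has_integral measurableT i1)
  (has_integralZ measurableT (-1) (integrable_has_integral measurableT i2)).
by congr (integrable _ _ _); apply/funext => x /=; rewrite mulN1r.
Qed.

(** Written through the Fourier coefficients of [sigma], this double sum is at once the
    [sigma]-integral of a Fejer kernel and a [mu]-integral of correlations. *)
Let V N (w : R) : R := \sum_(j < N) \sum_(k < N)
  (cos (2 * pi * w * j%:R - 2 * pi * w * k%:R) * C (j%:Z - k%:Z) +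
   sin (2 * pi * w * j%:R - 2 * pi * w * k%:R) * S (j%:Z - k%:Z)).

Definition fejer N (w t : R) : R :=
  (\sum_(j < N) cos (2 * pi * j%:R * (t - w))) ^+ 2 +
  (\sum_(j < N) sin (2 * pi * j%:R * (t - w))) ^+ 2.

Lemma fejer_has_integral N w : has_integral sigma setT (fejer N w) (V N w).
Proof.
have E : (fun t => \sum_(j < N) \sum_(k < N)
    (cos (2 * pi * w * j%:R - 2 * pi * w * k%:R) * cos (2 * pi * (j%:Z - k%:Z)%:~R * t) +
     sin (2 * pi * w * j%:R - 2 * pi * w * k%:R) * sin (2 * pi * (j%:Z - k%:Z)%:~R * t)))
    =1 fejer N w.
  move=> t; rewrite /fejer sqr_sum_cos_sin; apply: eq_bigr => j _; apply: eq_bigr => k _.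
  by rewrite -cosB -cosN; congr cos; rewrite intrB; ring.
apply: (@has_integral_ext _ Rm R sigma _ _ _ _ E).
apply: has_integral_sum => // j _; apply: has_integral_sum => // k _.
apply: has_integralD => //; apply: has_integralZ => //.
  exact: fourier_cos.
exact: fourier_sin.
Qed.

(* [V N w] is the energy at [w] of the complex function [fr + i fi]. *)
Lemma fejer_mean_le N w : V N w <= 2 * spectral_energy mu N fr w + 2 * spectral_energy mu N fi w.
Proof.
pose c j := cos (2 * pi * w * j%:R) : R; pose s j := sin (2 * pi * w * j%:R) : R.
pose P x := (\sum_(j < N) (fr (shiftn (j : nat) x) * c j + fi (shiftn (j : nat) x) * s j)) ^+ 2 +
  (\sum_(j < N) (fi (shiftn (j : nat) x) * c j - fr (shiftn (j : nat) x) * s j)) ^+ 2.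
have PV : has_integral mu setT P (V N w).
  have E : (fun x => \sum_(j < N) \sum_(k < N)
    (cos (2 * pi * w * j%:R - 2 * pi * w * k%:R) *
       (fr (shiftn (j : nat) x) * fr (shiftn (k : nat) x) + fi (shiftn (j : nat) x) * fi (shiftn (k : nat) x)) +
     sin (2 * pi * w * j%:R - 2 * pi * w * k%:R) *
       (fi (shiftn (j : nat) x) * fr (shiftn (k : nat) x) - fr (shiftn (j : nat) x) * fi (shiftn (k : nat) x))))
    =1 P.
    move=> x; rewrite /P !expr2 !mulr_suml -big_split /=; apply: eq_bigr => j _.
    rewrite !mulr_sumr -big_split /=; apply: eq_bigr => k _.
    by rewrite cosB sinB /c /s; ring.
  apply: (has_integral_ext E).
  apply: has_integral_sum => // j _; apply: has_integral_sum => // k _.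
  apply: has_integralD => //; apply: has_integralZ => //.
    exact: correlation_cos.
  exact: correlation_sin.
have H := has_integralD measurableT
  (has_integralZ measurableT 2 (twisted_has_integral mu_inv N w frL))
  (has_integralZ measurableT 2 (twisted_has_integral mu_inv N w fiL)).
apply: (has_integral_le measurableT PV H) => x.
rewrite /P /twisted -/(c _) big_split sumrB /=.
set a := \sum_(j < N) _ * c j; set b := \sum_(j < N) _ * s j.
set a' := \sum_(j < N) _ * c j; set b' := \sum_(j < N) _ * s j.
have := sqr_ge0 (a - b); have := sqr_ge0 (a' + b'); rewrite !expr2; nra.
Qed.

Lemma spectral_measure_itv_le N (w e : R) : (0 < N)%N -> 
  spectral_energy mu N fr w <= e * N%:R -> spectral_energy mu N fi w <= e * N%:R ->
  (sigma `[(w - (8 * N)%N%:R^-1)%R, (w + (8 * N)%N%:R^-1)%R]%classic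
    <= (16 * e / N%:R)%R%:E)%E.
Proof.
move=> N0 Gr Gi; have N0' : 0 < N%:R :> R by rewrite ltr0n.
have fge0 t : 0 <= fejer N w t by rewrite addr_ge0 ?sqr_ge0.
have th0 : 0 < N%:R ^+ 2 / 2 :> R by rewrite divr_gt0 ?exprn_gt0.
have := @has_integral_markov _ Rm R sigma setT measurableT _ _ _ (fejer_has_integral N w) fge0 th0.
rewrite setTI => mk; apply: (@le_trans _ _ (sigma [set t | N%:R ^+ 2 / 2 <= fejer N w t])).
  apply: le_measure; rewrite ?inE.
  - exact: measurable_itv.
  - have [/integrableP[mh _] _] := fejer_has_integral N w; have /measurable_EFinP {}mh := mh.
    have := mh measurableT _ (measurable_itv `[N%:R ^+ 2 / 2, +oo[).
    by rewrite setTI preimage_itvcy.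
  - move=> t; rewrite /= in_itv /= => tw.
    have := @cos_sin_sum_ge R _ (index_enum 'I_N) (fun j : 'I_N => 2 * pi * j%:R * (t - w)).
    have szN : size (index_enum 'I_N) = N by rewrite -[index_enum _]enumT size_enum_ord.
    rewrite szN; apply => j.
    have p0 := pi_gt0 R.
    have tw' : `|t - w| <= (8 * N)%:R^-1 by rewrite ler_norml; apply/andP; split; lra.
    rewrite normrM ger0_norm ?mulr_ge0 ?(ltW p0) //.
    apply: (@le_trans _ _ (2 * pi * N%:R * (8 * N)%:R^-1)).
      rewrite ler_pM ?mulr_ge0 ?(ltW p0) // ler_wpM2l ?mulr_ge0 ?(ltW p0) // ler_nat.
      exact: ltnW.
    rewrite le_eqVlt; apply/orP; left; apply/eqP; rewrite natrM; field.
    by rewrite gt_eqF.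
(* The two energies give a mean of at most [4 e N]; dividing by [N^2 / 2] yields [8 e / N], so that
   [16] leaves some room. *)
apply: (le_trans mk); rewrite lee_fin ler_pdivrMr //.
apply: (le_trans (fejer_mean_le N w)).
have -> : 16 * e / N%:R * (N%:R ^+ 2 / 2) = 8 * (e * N%:R) by field; rewrite gt_eqF.
have : 0 <= e * N%:R by apply: le_trans Gr; exact: spectral_energy_ge0.
lra.
Qed.

End SpectralMeasure.

Section Singular.
Variables (R : realType) (m : nat) (mu : probability (shift_space m) R).
Local Notation X := (shift_space m).
Local Notation Rm := (measurableTypeR R).
Local Notation leb := (@lebesgue_measure R).
Hypothesis mu_inv : forall A : set X, measurable A ->
  mu (shiftn 1 @^-1` A) = mu A.
Variable Nk : nat -> nat.
Hypothesis Nk0 : forall k, (0 < Nk k)%N.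
Variables (fr fi : X -> R) (sigma : {measure set Rm -> \bar R}).
Hypothesis frL : L2r mu fr.
Hypothesis fiL : L2r mu fi.
Hypothesis frs : asymp_small mu Nk fr.
Hypothesis fis : asymp_small mu Nk fi.
Hypothesis sigma_f : spectral_measure_of mu fr fi sigma.

(* Among the [8 N] intervals of length [1/(8 N)], those which contain a good frequency
   have spectral measure [O(eps / N)]. *)
Lemma spectral_measure_off_small_set (eps : R) : 0 < eps -> exists Bad : set R,
  [/\ measurable Bad, (leb Bad <= eps%:E)%E & (sigma (~` Bad) <= eps%:E)%E].
Proof.
(* The [8 N] intervals, each of spectral mass at most [16 e / N], add up to [128 e]. *)
move=> eps0; pose e := eps / 128.
have e0 : 0 < e by rewrite divr_gt0.
have [kr Hr] := frs e0; have [ki Hi] := fis e0.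
pose k := maxn kr ki; pose N := Nk k.
have [Br [mBr lBr HBr]] := Hr k (leq_maxl _ _).
have [Bi [mBi lBi HBi]] := Hi k (leq_maxr _ _).
pose Bad := Br `|` Bi.
have mBad : measurable Bad by exact: measurableU.
have N0 : (0 < N)%N := Nk0 k.
have N0' : 0 < N%:R :> R by rewrite ltr0n.
have N8 : 0 < (8 * N)%:R :> R by rewrite ltr0n muln_gt0.
exists Bad; split=> //.
  rewrite /Bad; apply: (le_trans (measureU2 _ _ _)) => //.
  apply: (le_trans (leeD lBr lBi)).
  by rewrite -EFinD lee_fin /e; lra.
have [_ sigma01 _] := sigma_f.
pose J (i : nat) : set Rm := `[i%:R / (8 * N)%:R, i.+1%:R / (8 * N)%:R[%classic `\` Bad.
have mJ i : measurable (J i).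
  by apply: measurableD => //; exact: measurable_itv.
have Jle (i : nat) : (i < 8 * N)%N -> (sigma (J i) <= (16 * e / N%:R)%:E)%E.
  move=> iN; have [->|/set0P[w [wi wB]]] := eqVneq (J i) set0.
    by rewrite measure0 lee_fin divr_ge0 ?mulr_ge0 // ltW.
  move: wi; rewrite /= in_itv /= => /andP[w1 w2].
  have iN' : i.+1%:R / (8 * N)%:R <= 1 :> R by rewrite ler_pdivrMr // mul1r ler_nat.
  have w01 : 0 <= w <= 1.
    by rewrite (le_trans _ w1) ?divr_ge0 //= (le_trans (ltW w2)).
  have /not_orP[wr wi] := wB.
  apply: (le_trans _ (spectral_measure_itv_le mu_inv frL fiL sigma_f N0 (HBr w w01 wr) (HBi w w01 wi))).
  apply: le_measure; rewrite ?inE //.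
  move=> t [+ _]; rewrite /= !in_itv /= => /andP[t1 t2].
  move: w2 t2; rewrite -natr1 mulrDl mul1r => w2 t2.
  by apply/andP; split; lra.
pose U : set Rm := \big[setU/set0]_(i < 8 * N) J i.
have mU : measurable U by apply: bigsetU_measurable => i _; exact: mJ.
have m01 : measurable (~` `[0, 1[%classic : set Rm).
  by apply: measurableC; exact: measurable_itv.
apply: (@le_trans _ _ (sigma (U `|` ~` `[0%R, 1%R[%classic))).
  apply: le_measure; rewrite ?inE.
  - exact: measurableC.
  - exact: measurableU.
  move=> t tB; have [t01|] := pselect (`[0, 1[%classic t); last by right.
  left; move: t01; rewrite /= in_itv /= => /andP[t0 t1].
  have u0 : 0 <= (8 * N)%:R * t by rewrite mulr_ge0 // ltW.
  have /andP[a b] := truncn_itv u0.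
  rewrite /U -bigcup_mkord; exists (Num.truncn ((8 * N)%:R * t)) => /=.
    rewrite -(ltr_nat R); apply: (le_lt_trans a).
    by rewrite -[ltRHS]mulr1 ltr_pM2l.
  by split=> //; rewrite /= in_itv /= ler_pdivrMr // ltr_pdivlMr // [t * _]mulrC a b.
apply: (le_trans (measureU2 _ mU m01)); rewrite -[leRHS]adde0.
apply: leeD; last by rewrite le_eqVlt; apply/orP; left; apply/eqP.
apply: (le_trans (Boole_inequality sigma (A := J) (n := 8 * N) (fun i _ => mJ i))).
apply: (@le_trans _ _ (\sum_(i < 8 * N) (16 * e / N%:R)%:E)%E).
  by apply: lee_sum => i _; exact: Jle.
rewrite sumEFin lee_fin sumr_const card_ord -[leLHS]mulr_natl natrM.
have -> : 8 * N%:R * (16 * e / N%:R) = eps by rewrite /e; field; rewrite gt_eqF.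
by [].
Qed.

(** The limsup of the bad sets is Lebesgue null by Borel-Cantelli. Its complement is the union of
    the [D n], and [D n] avoids [Bad k] for every [k >= n], so its spectral mass is at most every
    [2^-(k+1)] with [k >= n]. *)
Lemma spectral_measure_singular : exists N : set R,
  [/\ measurable N, leb N = 0%E & sigma (~` N) = 0%E].
Proof.
have e0 k : 0 < 1 / (2 ^ k.+1)%:R :> R by rewrite divr_gt0 // ltr0n expn_gt0.
pose Bad k := sval (cid (spectral_measure_off_small_set (e0 k))).
have BadP k : [/\ measurable (Bad k), (leb (Bad k) <= (1 / (2 ^ k.+1)%:R)%:E)%E &
    (sigma (~` Bad k) <= (1 / (2 ^ k.+1)%:R)%:E)%E].
  by rewrite /Bad; case: cid.
have mBad k : measurable (Bad k) by case: (BadP k).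
exists (lim_sup_set Bad); split.
- apply: bigcap_measurable => // k _; apply: bigcup_measurable => j _; exact: mBad.
- apply: lim_sup_set_cvg0 => //; apply: (@le_lt_trans _ _ 1%E); last exact: ltry.
  apply: le_trans (@epsilon_trick0 R 1 xpredT ler01); apply: lee_nneseries => // k _.
  by case: (BadP k).
pose D n : set Rm := \bigcap_(k in [set k | (n <= k)%N]) ~` Bad k.
have mD n : measurable (D n).
  by apply: bigcap_measurableType => k _; apply: measurableC; exact: mBad.
have D0 n : sigma (D n) = 0%E.
  apply/eqP; rewrite eq_le measure_ge0 andbT; apply/lee_addgt0Pr => eps eps0.
  rewrite add0e.
  pose k := maxn n (Num.bound eps^-1).
  apply: (@le_trans _ _ (sigma (~` Bad k))).
    apply: le_measure; rewrite ?inE.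
    - exact: mD.
    - by apply: measurableC; exact: mBad.
    by move=> t Dt; apply: Dt => /=; exact: leq_maxl.
  have [_ _ sk] := BadP k; apply: (le_trans sk); rewrite lee_fin.
  rewrite ler_pdivrMr ?ltr0n ?expn_gt0 // mulrC -ler_pdivrMr // div1r.
  apply: le_trans (ltW (archi_boundP _)) _; first by rewrite invr_ge0 ltW.
  rewrite ler_nat; apply: (@leq_trans k); first exact: leq_maxr.
  by rewrite ltnW // (leq_trans (ltn_expl k (ltnSn 1))) // leq_exp2l.
apply/eqP; rewrite eq_le measure_ge0 andbT.
apply: (@le_trans _ _ (\sum_(0 <= n <oo) sigma (D n))%E).
  apply: measure_sigma_subadditive => //.
    apply: measurableC; apply: bigcap_measurable => // k _.
    by apply: bigcup_measurable => j _; exact: mBad.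
  move=> t tN; apply: contrapT => tD; apply: tN => n _.
  apply: contrapT => tn; apply: tD; exists n => // k /= nk tk.
  by apply: tn; exists k.
by rewrite eseries0 // => n _ _; exact: D0.
Qed.

End Singular.

Unset Implicit Arguments.
Theorem theorem2p4 (R : realType) (n : nat) (zeta : substitution n.+2)
  (theta1 : R) :
  subst_nonempty zeta ->
  subst_primitive zeta ->
  subst_aperiodic zeta ->
  \det (map_mx (fun z : int => z%:~R : rat) (subst_mx zeta)) != 0 ->
  irreducible_poly (char_poly (map_mx (fun z : int => z%:~R : rat) (subst_mx zeta))) ->
  PF_eigenvalue (subst_mx zeta) theta1 ->
  (exists chi : \bar R,
      top_lyapunov zeta chi /\ (chi < (ln theta1 / 2)%:E)%E) ->
  forall mu : probability (shift_space n.+1) R,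
    invariant_on_subst_space zeta mu ->
    pure_singular_spectrum mu.
Proof.
move=> zne zprim _ _ zirr PF [chi [chiP chith]] mu [mu_inv mu_full] fr fi.
case=> mfr mfi ifr ifi sigma sigma_f.
have frL : L2r mu fr by [].
have fiL : L2r mu fi by [].
have loc (phi : seq 'I_n.+2 -> R) (B : R) (i : int) r : (forall u, `|phi u| <= B) ->
    asymp_small mu (minlen zeta) (fun x => phi (subword_at x i r)).
  by move=> phiB; exact: (local_asymp_small zne zprim zirr mu_full i r phiB PF chiP chith mu_inv).
have N0 k : (0 < minlen zeta k)%N by exact: minlen_gt0.
have frs := L2r_asymp_small mu_inv N0 loc frL.
have fis := L2r_asymp_small mu_inv N0 loc fiL.
exact: (spectral_measure_singular mu_inv N0 frL fiL frs fis sigma_f).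
Qed.
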